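(* Let $\Bbbk$ be a field of characteristic zero and let $C$ be a pre-Lie algebra over $\Bbbk$ with a well-ordered linear basis $Y$. Let $L$ be the universal enveloping Lie RB-algebra of weight $0$ of $C$, let $(A,R)$ be the universal enveloping associative RB-algebra of weight $0$ of $L$, and let $U(C)$ be the preassociative subalgebra of $A^{(R)}_0$ generated by the image of $C$ (this is the universal enveloping preassociative algebra of $C$). Let $E$ be the set of words defined in the context, and for $e\in E$ let $\bar e\in A$ be its value in $A$. Then the set $\{\bar e\mid e\in E\}$ is a linear basis of $U(C)$.
   Context: All algebras are over $\Bbbk$; associative algebras are not assumed unital. RB-algebras. An RB-operator of weight $0$ on an algebra $A$ is a linear map $R:A\to A$ with $R(x)R(y)=R(R(x)y+xR(y))$ (for Lie algebras the product is the bracket). An RB-algebra is an algebra with such an operator; homomorphisms commute with the operators. For an associative RB-algebra $(A,R)$, $A^{(-)}$ is the Lie RB-algebra with bracket $xy-yx$ and the same $R$. A pre-Lie algebra is a space with a bilinear product $\circ$ satisfying $(x\circ y)\circ z-x\circ(y\circ z)=(y\circ x)\circ z-y\circ(x\circ z)$. A preassociative (dendriform) algebra has bilinear operations $\succ,\prec$ with $(x\succ y+x\prec y)\succ z=x\succ(y\succ z)$, $(x\succ y)\prec z=x\succ(y\prec z)$, $x\prec(y\succ z+y\prec z)=(x\prec y)\prec z$. For an associative RB-algebra $(A,R)$ of weight $0$, $A^{(R)}_0$ is the space $A$ with $x\succ y=R(x)y$, $x\prec y=xR(y)$; it is preassociative. For a Lie RB-algebra $(L,P)$ of weight $0$, $L^{(P)}_0$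 is the space $L$ with $x\circ y=[P(x),y]$; it is pre-Lie. The universal enveloping Lie RB-algebra of $C$ is a Lie RB-algebra $(L,P)$ of weight $0$ with a pre-Lie homomorphism $C\to L^{(P)}_0$ through which every pre-Lie homomorphism $C\to M^{(Q)}_0$, $(M,Q)$ a Lie RB-algebra of weight $0$, factors by a unique RB-Lie homomorphism $L\to M$. The universal enveloping associative RB-algebra of $L$ is an associative RB-algebra $(A,R)$ of weight $0$ with an RB-Lie homomorphism $L\to A^{(-)}$ universal among RB-Lie homomorphisms $L\to B^{(-)}$, $B$ an associative RB-algebra of weight $0$. The universal enveloping preassociative algebra of $C$ is the one universal for pre-Lie homomorphisms from $C$ to preassociative algebras considered as pre-Lie algebras under $x\circ y=x\succ y-y\prec x$. The set $E$. Let $Y'=\{y'\mid y\in Y\}$ be a disjoint copy of $Y$ (with $y'$ standing for $P(y)=R(y)$) and $Y^+=Y\cup Y'$, well-ordered so that it extends the order of $Y$ and, for $y<z$ in $Y$, $y<y'<z<z'$. For a well-ordered set $Z$ let $\mathrm{Com}(Z)$ be the set of nonempty words $w_1\ldots w_k$ with $w_j\in Z$, $w_1\le\ldots\le w_k$. The elements of $E$ are formal words in the letters $Y^+$ and a formal unary symbol $R$, defined by induction: $Y\subset E$; and $$a=R(z_1)w_1R(z_2)w_2\ldots R(z_s)w_sR(z_{s+1})$$ lies in $E$ whenever $s\ge1$, $w_1,\ldots,w_s\in\mathrm{Com}(Y^+)$, $z_2,\ldots,z_s\in E\setminus Y$, the factor $R(z_1)$ is either absent or has $z_1\in E\setminus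 Y$, the factor $R(z_{s+1})$ is either absent or has $z_{s+1}\in E\setminus Y$, and 1) exactly one of the $w_i$ contains a letter from $Y$, and it contains exactly one such letter (counted with multiplicity); 2) no (present) $z_i$ is of the form $$R(q_1)u_1R(q_2)u_2\ldots R(q_t)u_t\,y\,(y')^k\,R(q_{t+1})$$ with $t\ge1$, $k\ge0$, $y\in Y$, $q_2,\ldots,q_t\in E\setminus Y$, each of $R(q_1)$, $R(q_{t+1})$ either absent or with $q_1\in E\setminus Y$, respectively $q_{t+1}\in E\setminus Y$, $u_1,\ldots,u_{t-1}\in\mathrm{Com}(Y')$, $u_t\in\mathrm{Com}(Y')$ or $u_t$ empty, and $y$ greater than all letters of $u_t$. The value $\bar e\in A$ of $e\in E$ is obtained by replacing each letter $y\in Y$ by its image in $A$, each letter $y'$ by $R$ applied to the image of $y$, and the symbol $R$ by the operator $R$ of $A$. *)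

(* Defs.v *)
From Stdlib Require Import List.
From HB Require Import structures.
From mathcomp Require Import all_boot all_order all_algebra sesquilinear.
From mathcomp Require Import boolp classical_sets wochoice.

Set Implicit Arguments.
Unset Strict Implicit.
Unset Printing Implicit Defensive.

Import Order.TTheory GRing.Theory.
Local Open Scope classical_set_scope.
Local Open Scope ring_scope.

Section Bases.
Variables (K : fieldType) (V : lmodType K).
Implicit Types S U : set V.

Definition lin_indep S : Prop :=
  forall (s : seq V) (c : V -> K), uniq s -> (forall v, v \in s -> S v) ->
    \sum_(v <- s) c v *: v = 0 -> forall v, v \in s -> c v = 0.

Definition lin_span S : set V :=
  [set x | exists (s : seq V) (c : V -> K),
     (forall v, v \in s -> S v) /\ x = \sum_(v <- s) c v *: v].

Definition lin_basis S U : Prop := lin_indep S /\ lin_span S = U.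

End Bases.

Notation bilinear_op m := (bilinear_for *:%R *:%R m).

Record prelieAlg (K : fieldType) := PreLieAlg {
  prelie_car :> lmodType K;
  prelie_mul : prelie_car -> prelie_car -> prelie_car;
  prelie_bilin : bilinear_op prelie_mul;
  prelie_axiom : forall x y z,
    prelie_mul (prelie_mul x y) z - prelie_mul x (prelie_mul y z) =
    prelie_mul (prelie_mul y x) z - prelie_mul y (prelie_mul x z) }.

Record preassAlg (K : fieldType) := PreAssAlg {
  preass_car :> lmodType K;
  preass_succ : preass_car -> preass_car -> preass_car;
  preass_prec : preass_car -> preass_car -> preass_car;
  preass_succ_bilin : bilinear_op preass_succ;
  preass_prec_bilin : bilinear_op preass_prec;
  preass_axiom1 : forall x y z,
    preass_succ (preass_succ x y + preass_prec x y) z =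
    preass_succ x (preass_succ y z);
  preass_axiom2 : forall x y z,
    preass_prec (preass_succ x y) z = preass_succ x (preass_prec y z);
  preass_axiom3 : forall x y z,
    preass_prec x (preass_succ y z + preass_prec y z) =
    preass_prec (preass_prec x y) z }.

Definition rb_operator (V : zmodType) (m : V -> V -> V) (R : V -> V) : Prop :=
  forall x y, m (R x) (R y) = R (m (R x) y + m x (R y)).

Record rbLieAlg (K : fieldType) := RBLieAlg {
  rblie_car :> lmodType K;
  rblie_br : rblie_car -> rblie_car -> rblie_car;
  rblie_op : rblie_car -> rblie_car;
  rblie_bilin : bilinear_op rblie_br;
  rblie_alt : forall x, rblie_br x x = 0;
  rblie_jacobi : forall x y z,
    rblie_br x (rblie_br y z) + rblie_br y (rblie_br z x) +
    rblie_br z (rblie_br x y) = 0;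
  rblie_op_linear : linear rblie_op;
  rblie_rb : rb_operator rblie_br rblie_op }.

Record rbAssAlg (K : fieldType) := RBAssAlg {
  rbass_car :> lmodType K;
  rbass_mul : rbass_car -> rbass_car -> rbass_car;
  rbass_op : rbass_car -> rbass_car;
  rbass_bilin : bilinear_op rbass_mul;
  rbass_assoc : associative rbass_mul;
  rbass_op_linear : linear rbass_op;
  rbass_rb : rb_operator rbass_mul rbass_op }.

Section Bilinear.
Variables (K : fieldType) (V : lmodType K) (m : V -> V -> V).
Hypothesis mB : bilinear_op m.

Lemma bil_addl x y z : m (x + y) z = m x z + m y z.
Proof. by have := mB.1 z 1 x y; rewrite /= !scale1r. Qed.

Lemma bil_addr x y z : m x (y + z) = m x y + m x z.
Proof. by have := mB.2 x 1 y z; rewrite /= !scale1r. Qed.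

Lemma bil_0l z : m 0 z = 0.
Proof. by apply: (addrI (m 0 z)); rewrite addr0 -bil_addl addr0. Qed.

Lemma bil_0r x : m x 0 = 0.
Proof. by apply: (addrI (m x 0)); rewrite addr0 -bil_addr addr0. Qed.

Lemma bil_oppl x z : m (- x) z = - m x z.
Proof. by apply: (addrI (m x z)); rewrite -bil_addl !subrr bil_0l. Qed.

Lemma bil_oppr x z : m x (- z) = - m x z.
Proof. by apply: (addrI (m x z)); rewrite -bil_addr !subrr bil_0r. Qed.

Lemma bil_subl x y z : m (x - y) z = m x z - m y z.
Proof. by rewrite bil_addl bil_oppl. Qed.

Lemma bil_subr x y z : m x (y - z) = m x y - m x z.
Proof. by rewrite bil_addr bil_oppr. Qed.

Variable R : V -> V.
Hypothesis RL : linear R.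

Lemma lin_add x y : R (x + y) = R x + R y.
Proof. by have := RL 1 x y; rewrite /= !scale1r. Qed.

Lemma lin_sub x y : R (x - y) = R x - R y.
Proof. by rewrite addrC -scaleN1r RL scaleN1r addrC. Qed.

Lemma bil_opl : bilinear_op (fun x y => m (R x) y).
Proof.
split=> [z a x y|x a y z]; last exact: mB.2.
by rewrite RL mB.1.
Qed.

Lemma bil_opr : bilinear_op (fun x y => m x (R y)).
Proof.
split=> [z a x y|x a y z]; first exact: mB.1.
by rewrite RL mB.2.
Qed.

Lemma bil_comm : bilinear_op (fun x y => m x y - m y x).
Proof.
by split=> [z a x y|x a y z]; rewrite /= mB.1 mB.2 /= scalerBr opprD addrACA.
Qed.

End Bilinear.

Section PreLieOfRBLie.
Variables (K : fieldType) (L : rbLieAlg K).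
Let br := @rblie_br K L.
Let P := @rblie_op K L.
Let circ x y := br (P x) y.

Lemma rblie_anti x y : br x y = - br y x.
Proof.
have B : bilinear_op br := rblie_bilin L; apply/eqP; rewrite -addr_eq0; apply/eqP.
have Z u : br u u = 0 := rblie_alt u.
by have := Z (x + y); rewrite (bil_addl B) !(bil_addr B) !Z addr0 add0r.
Qed.

Lemma rblie_circ_axiom x y z :
  circ (circ x y) z - circ x (circ y z) = circ (circ y x) z - circ y (circ x z).
Proof.
have B : bilinear_op br := rblie_bilin L; rewrite /circ.
have J : br (br (P x) (P y)) z = br (P x) (br (P y) z) - br (P y) (br (P x) z).
  have := rblie_jacobi (P x) (P y) z; rewrite -/br.
  rewrite [br z (P x)]rblie_anti (bil_oppr B) [br z (br _ _)]rblie_anti.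
  by move/eqP; rewrite subr_eq0 => /eqP.
have -> : br (P (br (P x) y)) z = br (br (P x) (P y)) z + br (P (br (P y) x)) z.
  rewrite -(bil_addl B); congr (br _ z).
  rewrite [br (P x) (P y)]rblie_rb -(lin_add (@rblie_op_linear _ L)).
  by congr (P _); rewrite -addrA -/br [br x _]rblie_anti addNr addr0.
by rewrite J [LHS](ACl (3*2*(1*4)))/= addrN addr0.
Qed.

Definition prelie_of_rblie : prelieAlg K :=
  PreLieAlg (bil_opl (rblie_bilin L) (@rblie_op_linear _ L)) rblie_circ_axiom.

End PreLieOfRBLie.

Section OfRBAss.
Variables (K : fieldType) (A : rbAssAlg K).
Let mul := @rbass_mul K A.
Let R := @rbass_op K A.
Let comm x y := mul x y - mul y x.

Lemma comm_alt x : comm x x = 0.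
Proof. exact: subrr. Qed.

Lemma comm_jacobi x y z :
  comm x (comm y z) + comm y (comm z x) + comm z (comm x y) = 0.
Proof.
have B : bilinear_op mul := rbass_bilin A.
rewrite /comm !(bil_subl B) !(bil_subr B) /mul !rbass_assoc -/mul.
rewrite !opprB !addrA.
rewrite (ACl ((1*12)*(2*7)*(3*10)*(4*5)*(6*11)*(8*9)))/=.
by rewrite !(addrN, addNr) !addr0.
Qed.

Lemma comm_rb : rb_operator comm R.
Proof.
move=> x y; rewrite /comm /mul !rbass_rb -(lin_sub (@rbass_op_linear _ A)).
by congr (R _); rewrite opprD [LHS](AC (2*2) ((1*4)*(2*3))).
Qed.

Definition rblie_of_rbass : rbLieAlg K :=
  RBLieAlg (bil_comm (rbass_bilin A)) comm_alt comm_jacobi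
    (@rbass_op_linear _ A) comm_rb.

Let succ x y := mul (R x) y.
Let prec x y := mul x (R y).

Lemma rbass_preass1 x y z : succ (succ x y + prec x y) z = succ x (succ y z).
Proof. by rewrite /succ /prec /R /mul -rbass_rb rbass_assoc. Qed.

Lemma rbass_preass2 x y z : prec (succ x y) z = succ x (prec y z).
Proof. by rewrite /succ /prec /mul rbass_assoc. Qed.

Lemma rbass_preass3 x y z : prec x (succ y z + prec y z) = prec (prec x y) z.
Proof. by rewrite /succ /prec /R /mul -rbass_rb rbass_assoc. Qed.

Definition preass_of_rbass : preassAlg K :=
  PreAssAlg (bil_opl (rbass_bilin A) (@rbass_op_linear _ A))
    (bil_opr (rbass_bilin A) (@rbass_op_linear _ A))
    rbass_preass1 rbass_preass2 rbass_preass3.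

End OfRBAss.

Definition prelie_hom (K : fieldType) (C D : prelieAlg K) (f : C -> D) : Prop :=
  linear f /\ forall x y, f (prelie_mul x y) = prelie_mul (f x) (f y).

Definition rblie_hom (K : fieldType) (L M : rbLieAlg K) (f : L -> M) : Prop :=
  [/\ linear f, forall x y, f (rblie_br x y) = rblie_br (f x) (f y)
    & forall x, f (rblie_op x) = rblie_op (f x)].

Definition rbass_hom (K : fieldType) (A B : rbAssAlg K) (f : A -> B) : Prop :=
  [/\ linear f, forall x y, f (rbass_mul x y) = rbass_mul (f x) (f y)
    & forall x, f (rbass_op x) = rbass_op (f x)].

Definition univ_rblie (K : fieldType) (C : prelieAlg K) (L : rbLieAlg K)
    (i : C -> L) : Prop :=
  @prelie_hom K C (prelie_of_rblie L) i /\
  forall (M : rbLieAlg K) (f : C -> M),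
    @prelie_hom K C (prelie_of_rblie M) f ->
    exists2 g : L -> M, rblie_hom g /\ g \o i =1 f &
      forall h : L -> M, rblie_hom h -> h \o i =1 f -> h =1 g.

Definition univ_rbass (K : fieldType) (L : rbLieAlg K) (A : rbAssAlg K)
    (j : L -> A) : Prop :=
  @rblie_hom K L (rblie_of_rbass A) j /\
  forall (B : rbAssAlg K) (f : L -> B),
    @rblie_hom K L (rblie_of_rbass B) f ->
    exists2 g : A -> B, rbass_hom g /\ g \o j =1 f &
      forall h : A -> B, rbass_hom h -> h \o j =1 f -> h =1 g.

Definition preass_closed (K : fieldType) (D : preassAlg K) (U : set D) : Prop :=
  [/\ U 0, forall (a : K) x y, U x -> U y -> U (a *: x + y),
      forall x y, U x -> U y -> U (preass_succ x y)
    & forall x y, U x -> U y -> U (preass_prec x y)].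

Definition preass_gen (K : fieldType) (D : preassAlg K) (S : set D) : set D :=
  smallest (@preass_closed K D) S.

Inductive sym (Z : Type) : Type := Letter of Z | Rsym of seq (sym Z).
Notation word Z := (seq (sym Z)).

(* Y^+ : (y, false) is the letter y and (y, true) is the letter y'; in the
   lexicographic order y < y' < z < z' for y < z. *)
Notation plus Y := (Y *l bool)%type.

Section E.
Variables (d : Order.disp_t) (Y : orderType d).

Definition unprimed (y : Y) : plus Y := (y, false).
Definition primed (y : Y) : plus Y := (y, true).

Lemma plus_order (y z : Y) : (y < z)%O ->
  [/\ (unprimed y < primed y)%O, (primed y < unprimed z)%O
    & (unprimed z < primed z)%O].
Proof.
have lt2 t : (unprimed t < primed t)%O by rewrite ltxi_pair lexx.
by move=> yz; split=> //; rewrite ltxi_pair (ltW yz) leNgt yz.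
Qed.

Definition inY (c : plus Y) : bool := ~~ c.2.
Definition inY' (c : plus Y) : bool := c.2.

Definition in_Com (w : seq (plus Y)) : bool := (w != [::]) && sorted <=%O w.

Definition letter_words : set (word (plus Y)) :=
  range (fun y => [:: Letter (unprimed y)]).

Definition optR (o : option (word (plus Y))) : word (plus Y) :=
  if o is Some z then [:: Rsym z] else [::].

(* R(z_1) w_1 R(z_2) w_2 ... R(z_s) w_s R(z_{s+1}), for ws = [w_1; ...; w_s]
   and zs = [z_2; ...; z_s]; used only when size ws = (size zs).+1. *)
Definition alternating (z1 : option (word (plus Y))) (ws : seq (seq (plus Y)))
    (zs : seq (word (plus Y))) (zl : option (word (plus Y))) : word (plus Y) :=
  optR z1 ++ [seq Letter c | c <- head [::] ws] ++
  flatten [seq Rsym p.1 :: [seq Letter c | c <- p.2] | p <- zip zs (behead ws)]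
  ++ optR zl.

Definition present (z1 : option (word (plus Y))) (zs : seq (word (plus Y)))
    (zl : option (word (plus Y))) : seq (word (plus Y)) :=
  seq_of_opt z1 ++ zs ++ seq_of_opt zl.

(* R(q_1) u_1 R(q_2) u_2 ... R(q_t) u_t y (y')^k R(q_{t+1}), where X plays the
   role of E and us = [u_1; ...; u_{t-1}]; only u_t may be empty. *)
Definition excluded (X : set (word (plus Y))) : set (word (plus Y)) :=
  [set z | exists q1 us (ut : seq (plus Y)) y k qs ql,
    [/\ size us = size qs,
        List.Forall (X `\` letter_words) (present q1 qs ql),
        all (fun u => in_Com u && all inY' u) us,
        sorted <=%O ut && all inY' ut && all (fun c => (c < unprimed y)%O) ut
      & z = alternating q1 (rcons us (ut ++ unprimed y :: nseq k (primed y)))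
              qs ql]].

Definition one_unprimed (ws : seq (seq (plus Y))) : bool :=
  (count (has inY) ws == 1%N) &&
  all (fun w => has inY w ==> (count inY w == 1%N)) ws.

Definition E_step (X : set (word (plus Y))) : set (word (plus Y)) :=
  letter_words `|`
  [set a | exists z1 ws zs zl,
    [/\ size ws = (size zs).+1 /\ all in_Com ws,
        List.Forall (X `\` letter_words) (present z1 zs zl),
        one_unprimed ws,
        List.Forall (~` excluded X) (present z1 zs zl)
      & a = alternating z1 ws zs zl]].

(* E occurs negatively in E_step through ~` excluded X, so no Inductive type can
   be used; the induction is on the nesting depth of R, and E_unfold shows that
   the result satisfies the intended closed equation. *)
Fixpoint E_depth (n : nat) : set (word (plus Y)) :=
  if n is m.+1 then E_step (E_depth m) else set0.

Definition E : set (word (plus Y)) := [set a | exists n, E_depth n a].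

Lemma in_alternating z1 ws zs zl z : size ws = (size zs).+1 ->
  List.In (Rsym z) (alternating z1 ws zs zl) <-> List.In z (present z1 zs zl).
Proof.
have letF w : List.In (Rsym z) [seq Letter c | c <- w] <-> False.
  by elim: w => [|c w IH] //=; rewrite IH; split=> [[]|].
have optE o : List.In (Rsym z) (optR o) <-> List.In z (seq_of_opt o).
  by case: o => [q|] //=; split=> [[[->]|//]|[->|//]]; left.
have app (T : Type) (t : T) u v : List.In t (u ++ v) <-> List.In t u \/ List.In t v.
  exact: List.in_app_iff.
case: ws => [|w ws] //= [sz]; rewrite /alternating /present !app !optE letF /=.
suff -> : List.In (Rsym z) (flatten
    [seq Rsym p.1 :: [seq Letter c | c <- p.2] | p <- zip zs ws]) <->
    List.In z zs by tauto.
elim: zs ws sz => [|q zs IH] [|u ws] //= [sz].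
rewrite app letF IH //; split=> [[[->]|[//|?]]|[->|?]]; by [left|right|right;right].
Qed.

Lemma excludedS X X' z : X `<=` X' -> excluded X z -> excluded X' z.
Proof.
move=> sXX' [q1 [us [ut [y [k [qs [ql [sz Xq Hu Ht ->]]]]]]]].
exists q1, us, ut, y, k, qs, ql; split=> //.
by apply: List.Forall_impl Xq => q [Xq ?]; split=> //; apply: sXX'.
Qed.

Let closed (X : set (word (plus Y))) :=
  forall z q, X z -> List.In (Rsym q) z -> (X `\` letter_words) q.

Lemma E_stepS X X' : closed X -> X `<=` X' -> E_step X `<=` E_step X'.
Proof.
move=> cX sXX' a [la|]; first by left.
move=> [z1 [ws [zs [zl [szC Xz one nex ->]]]]]; right.
exists z1, ws, zs, zl; split=> //.
  by apply: List.Forall_impl Xz => q [Xq ?]; split=> //; apply: sXX'.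
apply/List.Forall_forall => z zin ex; move/List.Forall_forall: nex => /(_ z zin).
apply; move/List.Forall_forall: Xz => /(_ z zin) [Xz _].
case: ex => [q1 [us [ut [y [k [qs [ql [sz X'q Hu Ht ez]]]]]]]].
exists q1, us, ut, y, k, qs, ql; split=> //.
apply/List.Forall_forall => q qin; apply: (cX z) => //; rewrite ez.
by apply/in_alternating => //; rewrite size_rcons sz.
Qed.

Lemma E_step_in X a q :
  E_step X a -> List.In (Rsym q) a -> (X `\` letter_words) q.
Proof.
case=> [[y _ <-] /= []//|[z1 [ws [zs [zl [[sz _] Xz _ _ ->]]]]]].
by move/in_alternating => /(_ sz); move/List.Forall_forall: Xz; apply.
Qed.

Lemma E_depth_closed n :
  closed (E_depth n) /\ E_depth n `<=` E_depth n.+1.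
Proof.
elim: n => [|n [cn sn]]; first by split.
split; last exact: E_stepS.
by move=> z q zE /(E_step_in zE) [qE ?]; split=> //; apply: sn.
Qed.

Lemma E_depthS m n : (m <= n)%N -> E_depth m `<=` E_depth n.
Proof.
move/subnK <-; elim: (n - m)%N => [//|p IH] a /IH.
exact: (E_depth_closed _).2.
Qed.

Lemma E_unfold : E = E_step E.
Proof.
apply/seteqP; split=> a.
  case=> -[//|n]; apply: E_stepS; first exact: (E_depth_closed n).1.
  by move=> z; exists n.
case=> [la|[z1 [ws [zs [zl [szC Xz one nex ->]]]]]]; first by exists 1%N; left.
have [n Xn] : exists n, List.Forall (E_depth n `\` letter_words)
    (present z1 zs zl).
  elim: {nex} (present _ _ _) Xz => [|z s IH]; first by exists 0%N; constructor.
  move=> /List.Forall_cons_iff[[[m zm] nl] /IH[n sn]]; exists (maxn m n).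
  constructor; first by split=> //; apply: E_depthS zm; apply: leq_maxl.
  apply: List.Forall_impl sn => q [qn ?]; split=> //.
  by apply: E_depthS qn; apply: leq_maxr.
exists n.+1; right; exists z1, ws, zs, zl; split=> //.
apply: List.Forall_impl nex => z nz ex; apply: nz.
by apply: excludedS ex => q; exists n.
Qed.

End E.

Arguments E {d} Y.

Section Value.
Variables (K : fieldType) (A : rbAssAlg K) (d : Order.disp_t) (Y : orderType d).
Variable x : Y -> A.

(* The algebra has no unit: the empty word, which never occurs in E, gets the
   junk value 0. *)
Definition mulseq (s : seq A) : A :=
  if s is a :: s' then foldl (@rbass_mul K A) a s' else 0.

Fixpoint value_sym (s : sym (plus Y)) : A :=
  match s with
  | Letter c => if inY c then x c.1 else rbass_op (x c.1)
  | Rsym w => rbass_op (mulseq (map value_sym w))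
  end.

Definition value (w : word (plus Y)) : A := mulseq (map value_sym w).

End Value.

(* Main.v *)
Require Import Defs.
From Stdlib Require List.
From HB Require Import structures.
From mathcomp Require Import all_boot all_order all_algebra finmap zify.
From mathcomp Require Import boolp classical_sets wochoice.
From mathcomp.multinomials Require Import monalg.

(** The proof builds an associative RB-algebra in which the words of E are
    visibly independent, and a linear map from it back to A which shows that
    their values span U(C).

    Normal words. Call a word in the letters Y^+ and the symbols R(z) normal
    if its runs of letters are sorted, no two symbols R(z) are adjacent, and
    every such z is legal: normal, with exactly one unprimed letter, and not
    exceptional, where a word is exceptional if the greatest letter of its
    last run, up to primes, is the unprimed one. Then E consists of the marked
    words, that is, of the normal words with exactly one unprimed letter
    (E_marked).

    The product. Let F be the vector space with basis all words. The letters
    span the pre-Lie algebra C + eC, where e^2 = 0, eC acts by zero, the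
    primed letters span C and the unprimed ones eC. A run of letters is read
    as a monomial of its symmetric algebra, on which a letter a acts by
    multiplication plus the derivation x -> a o x: this is the description of
    Oudom and Guin of the enveloping algebra of a pre-Lie algebra. Two symbols
    are multiplied by the recursion R(p)R(q) = R(R(p)q + pR(q)). The resulting
    operators satisfy the relations of a representation (fock); a normal word
    acts on every representation, and its action on F is an associative
    product (extact_fmul, fmulA).

    The operator. It is obtained by inverting a derivation. There is a
    derivation der of F with y' -> y and R(z) -> z, from the words without
    unprimed letters to the marked words. If e is legal, then der R(e) = e. If
    e is exceptional, then priming its unprimed letter gives a word t, every
    unmarked word with a letter arises exactly once in this way, and der t
    equals (k+1)e modulo legal words and words of lower degree
    (leading_term). In characteristic zero this makes der bijective from the
    unmarked vectors without constant term to the marked ones. Its inverse rb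
    is a Rota-Baxter operator, since the Rota-Baxter identity for an inverse
    of a derivation is the Leibniz rule (rb_rb).

    Independence. The embedding of C into F extends by universality to a
    homomorphism from A. It maps the value of a marked word e to e plus words
    of lower degree (triangular), so the values are independent.

    Spanning. Over the dual numbers of the unitization of A, let y' act as
    left multiplication by R(y), y as left multiplication by ey, and R(z) as
    left multiplication by R of the value of z. This is a representation, so
    each vector of F has a value. The relation imT_der between this value and
    der shows that the e-components of the values of the marked vectors are
    closed under both preassociative operations; hence they contain U(C). By
    triangularity they are the linear combinations of the values of the words
    in E. *)

Set Implicit Arguments.
Unset Strict Implicit.
Unset Printing Implicit Defensive.

Import Order.TTheory GRing.Theory.
Local Open Scope ring_scope.

(** * Identities in abelian groups *)

Section AbelianNormalization.
Variable V : zmodType.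

Inductive zexp := ZX of nat | ZO | ZD of zexp & zexp | ZN of zexp.

Fixpoint zval (env : seq V) e : V :=
  match e with
  | ZX i => env`_i
  | ZO => 0
  | ZD e1 e2 => zval env e1 + zval env e2
  | ZN e1 => - zval env e1
  end.

Fixpoint zcoef (i : nat) e : int :=
  match e with
  | ZX j => (i == j)%:Z
  | ZO => 0
  | ZD e1 e2 => zcoef i e1 + zcoef i e2
  | ZN e1 => - zcoef i e1
  end.

Lemma zvalE env e : zval env e = \sum_(i < size env) env`_i *~ zcoef i e.
Proof.
elim: e => [j||e1 IH1 e2 IH2|e1 IH1] /=.
- have [jn|nj] := ltnP j (size env).
    rewrite (bigD1 (Ordinal jn)) //= eqxx big1 ?addr0 // => i.
    by rewrite -val_eqE /= => /negbTE ->.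
  rewrite nth_default // big1 // => i _.
  by rewrite ltn_eqF ?mulr0z // (leq_trans (ltn_ord i) nj).
- by rewrite big1.
- by rewrite IH1 IH2 -big_split; apply: eq_bigr => i _; rewrite mulrzDr.
- by rewrite IH1 -sumrN; apply: eq_bigr => i _; rewrite mulrNz.
Qed.

Lemma zmod_correct env e1 e2 :
  all (fun i => zcoef i e1 == zcoef i e2) (iota 0 (size env)) ->
  zval env e1 = zval env e2.
Proof.
move=> /allP H; rewrite !zvalE; apply: eq_bigr => i _.
by rewrite (eqP (H i _)) // mem_iota ltn_ord.
Qed.

End AbelianNormalization.

Ltac zsame x y :=
  match goal with
  | _ => let _ := match goal with _ => constr_eq x y end in constr:(true)
  | _ => let _ := match goal with _ => unify x y end in constr:(true)
  | _ => constr:(false)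
  end.
Ltac zindex x l :=
  lazymatch l with
  | ?y :: ?l' =>
      let b := zsame x y in
      lazymatch b with
      | true => constr:(0%N)
      | false => let n := zindex x l' in constr:(n.+1)
      end
  end.
Ltac zmem x l :=
  lazymatch l with
  | ?y :: ?l' =>
      let b := zsame x y in
      lazymatch b with true => constr:(true) | false => zmem x l' end
  | _ => constr:(false)
  end.
Ltac zatoms l t :=
  lazymatch t with
  | ?a + ?b => let l1 := zatoms l a in zatoms l1 b
  | - ?a => zatoms l a
  | 0 => l
  | _ => let m := zmem t l in
         lazymatch m with true => l | false => constr:(t :: l) end
  end.
Ltac zreify l t :=
  lazymatch t with
  | ?a + ?b => let x := zreify l a in let y := zreify l b in constr:(ZD x y)
  | - ?a => let x := zreify l a in constr:(ZN x)
  | 0 => constr:(ZO)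
  | _ => let n := zindex t l in constr:(ZX n)
  end.
(** By reflection: both sides are expanded into integer combinations of their
    atoms, and the coefficients are compared by computation. *)
Ltac zmodule :=
  lazymatch goal with |- @eq ?T ?a ?b =>
    let l0 := constr:(@nil T) in
    let l1 := zatoms l0 a in let l := zatoms l1 b in
    let x := zreify l a in let y := zreify l b in
    exact: (@zmod_correct _ l x y isT)
  end.

(** * Free modules *)

(** A copy of the monoid algebra whose operations are locked, so that
    conversion never unfolds a vector. *)
Definition freemod (K : fieldType) (T : choiceType) : Type := {malg K[T]}.

HB.lock Definition fm_zero (K : fieldType) (T : choiceType) : freemod K T :=
  (0 : {malg K[T]}).
HB.lock Definition fm_add (K : fieldType) (T : choiceType) (x y : freemod K T) :
  freemod K T := (x : {malg K[T]}) + (y : {malg K[T]}).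
HB.lock Definition fm_opp (K : fieldType) (T : choiceType) (x : freemod K T) :
  freemod K T := - (x : {malg K[T]}).
HB.lock Definition fm_scale (K : fieldType) (T : choiceType) (c : K)
  (x : freemod K T) : freemod K T := c *: (x : {malg K[T]}).
HB.lock Definition bas (K : fieldType) (T : choiceType) (t : T) : freemod K T :=
  (<< t >> : {malg K[T]}).

Section FreeModuleOps.
Variables (K : fieldType) (T : choiceType).
Implicit Types x y z : freemod K T.
Local Notation fm_zero := (fm_zero K T).
Local Notation fm_add := (@fm_add K T).
Local Notation fm_opp := (@fm_opp K T).
Local Notation fm_scale := (@fm_scale K T).
Local Notation bas := (@bas K T).

Lemma fm_addA : associative fm_add.
Proof. by move=> x y z; rewrite !fm_add.unlock addrA. Qed.
Lemma fm_addC : commutative fm_add.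
Proof. by move=> x y; rewrite !fm_add.unlock addrC. Qed.
Lemma fm_add0 : left_id fm_zero fm_add.
Proof. by move=> x; rewrite fm_add.unlock fm_zero.unlock add0r. Qed.
Lemma fm_addN : left_inverse fm_zero fm_opp fm_add.
Proof. by move=> x; rewrite fm_add.unlock fm_zero.unlock fm_opp.unlock addNr. Qed.

HB.instance Definition _ := Choice.copy (freemod K T) {malg K[T]}.
HB.instance Definition _ :=
  GRing.isZmodule.Build (freemod K T) fm_addA fm_addC fm_add0 fm_addN.

Lemma fm_scaleA a b x : fm_scale a (fm_scale b x) = fm_scale (a * b) x.
Proof. by rewrite fm_scale.unlock scalerA. Qed.
Lemma fm_scale1 : left_id 1 fm_scale.
Proof. by move=> x; rewrite fm_scale.unlock scale1r. Qed.
Lemma fm_scaleDr : right_distributive fm_scale fm_add.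
Proof. by move=> c x y; rewrite fm_scale.unlock fm_add.unlock scalerDr. Qed.
Lemma fm_scaleDl x : {morph fm_scale^~ x : a b / a + b >-> fm_add a b}.
Proof. by move=> a b; rewrite fm_scale.unlock fm_add.unlock scalerDl. Qed.

HB.instance Definition _ := GRing.Zmodule_isLmodule.Build K (freemod K T)
  fm_scaleA fm_scale1 fm_scaleDr fm_scaleDl.

Definition fcoef x (t : T) : K := mcoeff t (x : {malg K[T]}).
Definition fm_supp x : {fset T} := msupp (x : {malg K[T]}).

Lemma fcoefP x y : fcoef x =1 fcoef y -> x = y.
Proof. by move=> e; apply/malgP => t; apply: e. Qed.

Lemma fcoef_linear t : linear (fcoef^~ t : freemod K T -> K^o).
Proof.
move=> c x y; rewrite /fcoef /GRing.scale /GRing.add /= fm_add.unlock fm_scale.unlock.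
by rewrite mcoeffD mcoeffZ.
Qed.

Lemma fcoef0 t : fcoef 0 t = 0.
Proof. by rewrite /fcoef /GRing.zero /= fm_zero.unlock mcoeff0. Qed.

Lemma fcoefD x y t : fcoef (x + y) t = fcoef x t + fcoef y t.
Proof. by have := fcoef_linear t 1 x y; rewrite /= !scale1r. Qed.

Lemma fcoefZ c x t : fcoef (c *: x) t = c * fcoef x t.
Proof. by have := fcoef_linear t c x 0; rewrite /= addr0 fcoef0 addr0. Qed.

Lemma fcoef_bas t u : fcoef (bas t) u = (t == u)%:R.
Proof. by rewrite /fcoef bas.unlock mcoeffU. Qed.

Lemma mem_supp x t : (t \in fm_supp x) = (fcoef x t != 0).
Proof. by rewrite /fm_supp /fcoef mcoeff_neq0. Qed.

Lemma supp_bas t : fm_supp (bas t) = [fset t]%fset.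
Proof. by rewrite /fm_supp bas.unlock msuppU oner_eq0. Qed.

Lemma fcoef_outdom x t : t \notin fm_supp x -> fcoef x t = 0.
Proof. by rewrite mem_supp negbK => /eqP. Qed.

Lemma supp0 : fm_supp 0 = fset0.
Proof. by apply/fsetP => t; rewrite mem_supp fcoef0 eqxx in_fset0. Qed.

Lemma suppD_le x y : (fm_supp (x + y)%R `<=` fm_supp x `|` fm_supp y)%fset.
Proof.
apply/fsubsetP => t; rewrite in_fsetU !mem_supp fcoefD.
by apply: contraNT; rewrite negb_or !negbK => /andP [/eqP -> /eqP ->]; rewrite addr0.
Qed.

Lemma suppZ_le c x : (fm_supp (c *: x)%R `<=` fm_supp x)%fset.
Proof.
apply/fsubsetP => t; rewrite !mem_supp fcoefZ.
by apply: contraNN => /eqP ->; rewrite mulr0.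
Qed.

Lemma fcoef_sum (I : Type) (r : seq I) (f : I -> freemod K T) t :
  fcoef (\sum_(i <- r) f i) t = \sum_(i <- r) fcoef (f i) t.
Proof.
by elim: r => [|i r IH]; rewrite ?big_nil ?fcoef0 // !big_cons fcoefD IH.
Qed.

Lemma freemodE x : x = \sum_(t <- fm_supp x) fcoef x t *: bas t.
Proof.
apply: fcoefP => t; rewrite fcoef_sum.
under eq_bigr do rewrite fcoefZ fcoef_bas.
have [ts|ts] := boolP (t \in fm_supp x).
  rewrite (bigD1_seq t) ?fset_uniq //= eqxx mulr1 big1 ?addr0 // => u ut.
  by rewrite (negbTE ut) mulr0.
rewrite (fcoef_outdom ts) big_seq big1 // => u us.
by rewrite (_ : u == t = false) ?mulr0 //; apply: contraNF ts => /eqP <-.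
Qed.

End FreeModuleOps.
Arguments bas {K T} t.
Notation "'{free' K [ T ] }" := (freemod K T)
  (at level 0, K at level 2, format "'{free'  K [ T ] }").

(** The linear extension of a function on the basis. *)
HB.lock Definition ext (K : fieldType) (T : choiceType) (V : lmodType K)
  (f : T -> V) (x : freemod K T) : V := \sum_(t <- fm_supp x) fcoef x t *: f t.

Arguments ext {K T V} f x.
Section FreeModule.
Variable K : fieldType.

Section Ext.
Variables (T : choiceType) (V : lmodType K).
Implicit Types (f g : T -> V) (x y : {free K[T]}).

Lemma extE f x : ext f x = \sum_(t <- fm_supp x) fcoef x t *: f t.
Proof. by rewrite ext.unlock. Qed.

Lemma extEw f x (d : {fset T}) : (fm_supp x `<=` d)%fset ->
  ext f x = \sum_(t <- d) fcoef x t *: f t.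
Proof.
move=> /fsubsetP sub; rewrite !extE.
rewrite [RHS](bigID (fun t => t \in fm_supp x)) /= [X in _ + X]big1 ?addr0.
  rewrite -[RHS]big_filter; apply: perm_big; apply: uniq_perm.
  - exact: fset_uniq.
  - by rewrite filter_uniq ?fset_uniq.
  - by move=> t; rewrite mem_filter andb_idr //; apply: sub.
by move=> t /fcoef_outdom ->; rewrite scale0r.
Qed.

Lemma ext_is_linear f : linear (ext f).
Proof.
move=> c x y; pose d := (fm_supp x `|` fm_supp y)%fset.
have sx : (fm_supp x `<=` d)%fset := fsubsetUl _ _.
have sy : (fm_supp y `<=` d)%fset := fsubsetUr _ _.
have sz : (fm_supp (c *: x + y)%R `<=` d)%fset.
  apply: fsubset_trans (suppD_le _ _) _; apply: fsetSU; exact: suppZ_le.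
rewrite (extEw _ sx) (extEw _ sy) (extEw _ sz) scaler_sumr -big_split /=.
by apply: eq_bigr => t _; rewrite fcoefD fcoefZ scalerDl scalerA.
Qed.

HB.instance Definition _ f :=
  GRing.isLinear.Build K {free K[T]} V *:%R (ext f) (ext_is_linear f).

Lemma ext_bas f t : ext f (bas t) = f t.
Proof. by rewrite !extE supp_bas big_seq_fset1 fcoef_bas eqxx scale1r. Qed.

Lemma eq_in_ext f g x : {in fm_supp x, f =1 g} -> ext f x = ext g x.
Proof. by move=> fg; rewrite !extE; apply: eq_big_seq => t /fg ->. Qed.

Lemma eq_ext f g x : f =1 g -> ext f x = ext g x.
Proof. by move=> fg; apply: eq_in_ext => t _. Qed.

Lemma extD f g x : ext (fun t => f t + g t) x = ext f x + ext g x.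
Proof. by rewrite !extE -big_split; apply: eq_bigr => t _; rewrite scalerDr. Qed.

Lemma extB f g x : ext (fun t => f t - g t) x = ext f x - ext g x.
Proof. by rewrite !extE -sumrB; apply: eq_bigr => t _; rewrite scalerBr. Qed.

Lemma extZ c f x : ext (fun t => c *: f t) x = c *: ext f x.
Proof.
rewrite !extE scaler_sumr; apply: eq_bigr => t _.
by rewrite !scalerA mulrC.
Qed.

Lemma ext0 x : ext (fun=> 0 : V) x = 0.
Proof. by rewrite !extE big1 // => t _; rewrite scaler0. Qed.

Definition subspace (Q : V -> Prop) :=
  Q 0 /\ forall c u v, Q u -> Q v -> Q (c *: u + v).

Lemma subspaceD Q u v : subspace Q -> Q u -> Q v -> Q (u + v).
Proof. by move=> [_ H] /(H 1) h /h; rewrite scale1r. Qed.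

Lemma subspaceZ Q c u : subspace Q -> Q u -> Q (c *: u).
Proof. by move=> [H0 H] /(H c) h; have := h _ H0; rewrite addr0. Qed.

Lemma subspaceB Q u v : subspace Q -> Q u -> Q v -> Q (u - v).
Proof. by move=> [_ H] Qu /(H (-1)) h; rewrite addrC -scaleN1r; exact: h. Qed.

Lemma subspace_ext Q f x : subspace Q ->
  (forall t, t \in fm_supp x -> Q (f t)) -> Q (ext f x).
Proof.
move=> sQ H; rewrite !extE big_seq; apply: big_ind => [|u v|t /H].
- by case: sQ.
- exact: subspaceD.
- exact: subspaceZ.
Qed.

End Ext.

Lemma ext_lin (T : choiceType) (V V' : lmodType K) (h : {linear V -> V'})
    (f : T -> V) x : h (ext f x) = ext (fun t => h (f t)) x.
Proof. by rewrite !extE linear_sum; apply: eq_bigr => t _; rewrite linearZ. Qed.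

Lemma ext_ext (T T' : choiceType) (V : lmodType K) (f : T' -> V)
    (g : T -> {free K[T']}) x :
  ext f (ext g x) = ext (fun t => ext f (g t)) x.
Proof. exact: (ext_lin (ext f)). Qed.

Lemma ext_swap (T T' : choiceType) (V : lmodType K) (F : T -> T' -> V) x y :
  ext (fun t => ext (F t) y) x = ext (fun t' => ext (fun t => F t t') x) y.
Proof.
rewrite !extE; under eq_bigr do rewrite extE scaler_sumr.
rewrite exchange_big; apply: eq_bigr => t' _; rewrite extE scaler_sumr.
by apply: eq_bigr => t _; rewrite !scalerA mulrC.
Qed.

Lemma ext_id (T : choiceType) (x : {free K[T]}) : ext (@bas K T) x = x.
Proof.
by rewrite extE [RHS]freemodE.
Qed.

(** Gradings and filtrations are expressed through supports. *)
Definition supported (T : choiceType) (P : pred T) (x : {free K[T]}) : Prop :=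
  all P (fm_supp x).

Lemma supportedP (T : choiceType) (P : pred T) x :
  supported P x <-> forall t, t \in fm_supp x -> P t.
Proof. by split=> [/allP|H]; [|apply/allP]. Qed.

Lemma supported_subspace (T : choiceType) (P : pred T) : subspace (supported P).
Proof.
split=> [|c u v /supportedP su /supportedP sv]; apply/supportedP => t.
  by rewrite supp0 in_fset0.
move/(fsubsetP (suppD_le _ _)); rewrite in_fsetU => /orP[|]; last exact: sv.
by move/(fsubsetP (suppZ_le _ _)); apply: su.
Qed.

Lemma supportedD (T : choiceType) (P : pred T) x y :
  supported P x -> supported P y -> supported P (x + y).
Proof. exact: (subspaceD (supported_subspace P)). Qed.

Lemma supportedB (T : choiceType) (P : pred T) x y :
  supported P x -> supported P y -> supported P (x - y).
Proof. exact: (subspaceB (supported_subspace P)). Qed.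

Lemma supportedZ (T : choiceType) (P : pred T) c x :
  supported P x -> supported P (c *: x).
Proof. exact: (subspaceZ _ (supported_subspace P)). Qed.

Lemma supported0 (T : choiceType) (P : pred T) : supported P 0.
Proof. exact: (supported_subspace P).1. Qed.

Lemma supported_bas (T : choiceType) (P : pred T) t :
  P t -> supported P (bas t).
Proof. by move=> Pt; apply/supportedP => u; rewrite supp_bas in_fset1 => /eqP ->. Qed.

Lemma supportedW (T : choiceType) (P Q : pred T) x :
  (forall t, P t -> Q t) -> supported P x -> supported Q x.
Proof. by move=> PQ; exact: sub_all. Qed.

Lemma subspace_supported (T : choiceType) (V : lmodType K) (Q : V -> Prop)
    (P : pred T) (f : T -> V) x :
  subspace Q -> (forall t, P t -> Q (f t)) -> supported P x -> Q (ext f x).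
Proof. by move=> sQ H /supportedP sx; apply: subspace_ext => // t /sx /H. Qed.

Lemma supported_ext (T T' : choiceType) (Q : pred T') (P : pred T)
    (f : T -> {free K[T']}) x :
  (forall t, P t -> supported Q (f t)) -> supported P x -> supported Q (ext f x).
Proof. exact: subspace_supported (supported_subspace Q). Qed.

Lemma eq_supported (T : choiceType) (V : lmodType K) (P : pred T) (f g : T -> V)
    x : (forall t, P t -> f t = g t) -> supported P x -> ext f x = ext g x.
Proof. by move=> fg /supportedP sx; apply: eq_in_ext => t /sx /fg. Qed.

End FreeModule.
Arguments subspace {K V} Q.
Arguments supported_subspace {K T} P.

(** * Substituting for one letter of a word *)

Section Substitution.
Variables (K : fieldType) (Z : choiceType).
Implicit Types (A B : Z -> {free K[Z]}) (s t : seq Z).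

(** The multilinear extension of f evaluated at the derivation of s that
    extends A. *)
Fixpoint dersum (V : lmodType K) A (f : seq Z -> V) s : V :=
  if s is a :: s' then
    ext (fun z => f (z :: s')) (A a) + dersum A (fun t => f (a :: t)) s'
  else 0.

Lemma eq_dersum (V : lmodType K) A (f g : seq Z -> V) s :
  (forall t, size t = size s -> f t = g t) -> dersum A f s = dersum A g s.
Proof.
elim: s f g => //= a s IH f g fg; congr (_ + _).
  by apply: eq_ext => z; apply: fg.
by apply: IH => t st; apply: fg; rewrite /= st.
Qed.

Lemma dersum_lin (V V' : lmodType K) (h : {linear V -> V'}) A f s :
  h (dersum A f s) = dersum A (fun t => h (f t)) s.
Proof.
elim: s f => [|a s IH] f /=; first by rewrite linear0.
by rewrite linearD ext_lin IH.
Qed.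

Section Valued.
Variable V : lmodType K.
Implicit Types f g : seq Z -> V.

Lemma dersumD A f g s :
  dersum A (fun t => f t + g t) s = dersum A f s + dersum A g s.
Proof.
elim: s f g => [|a s IH] f g /=; first by rewrite addr0.
by rewrite IH extD addrACA.
Qed.

Lemma dersumZ A c f s : dersum A (fun t => c *: f t) s = c *: dersum A f s.
Proof.
elim: s f => [|a s IH] f /=; first by rewrite scaler0.
by rewrite IH extZ scalerDr.
Qed.

Lemma dersumB A f g s :
  dersum A (fun t => f t - g t) s = dersum A f s - dersum A g s.
Proof.
elim: s f g => [|a s IH] f g /=; first by rewrite subr0.
by rewrite IH extB opprD addrACA.
Qed.

Lemma dersum0 A s : dersum A (fun=> 0 : V) s = 0.
Proof. by elim: s => //= a s ->; rewrite ext0 addr0. Qed.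

Lemma dersum_ext (T : choiceType) A (F : T -> seq Z -> V) x s :
  dersum A (fun t => ext (F^~ t) x) s = ext (fun u => dersum A (F u) s) x.
Proof.
elim: s F => [|a s IH] F /=; first by rewrite ext0.
by rewrite (IH (fun u t => F u (a :: t))) extD; congr (_ + _); rewrite ext_swap.
Qed.

Lemma dersum_cat A f s t :
  dersum A f (s ++ t) =
  dersum A (fun s' => f (s' ++ t)) s + dersum A (fun t' => f (s ++ t')) t.
Proof.
elim: s f => [|a s IH] f /=; first by rewrite add0r.
by rewrite IH addrA.
Qed.

Lemma dersum_zero (A : Z -> {free K[Z]}) f s :
  (forall a, a \in s -> A a = 0) -> dersum A f s = 0.
Proof.
elim: s f => //= a s IH f H; rewrite H ?mem_head // linear0 add0r IH // => b bs.
by apply: H; rewrite inE bs orbT.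
Qed.

Definition perm_inv n f := forall s t, size s = n -> perm_eq s t -> f s = f t.

(** The sum runs over the positions of the word, and for a symmetric f a
    permutation merely rearranges them. *)
Lemma dersum_perm A f n : perm_inv n f -> perm_inv n (dersum A f).
Proof.
elim: n f => [|n IH] f fP s t.
  by move/size0nil=> -> /perm_size; case: t.
case: s => // a s [sn] pt.
have at_ : a \in t by rewrite -(perm_mem pt) mem_head.
case/splitPr: at_ pt => l r pt.
have ps : perm_eq s (l ++ r).
  by rewrite -(perm_cons a) (perm_trans pt) // perm_sym -cat1s perm_catCA.
have slr : (size (l ++ r)).+1 = n.+1 by rewrite -(perm_size ps) sn.
rewrite dersum_cat /= addrCA; congr (_ + _).
  apply: eq_ext => z; apply: fP; rewrite /= ?sn //.
  apply: perm_trans (_ : perm_eq (z :: l ++ r) _); first by rewrite perm_cons.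
  by rewrite perm_sym -[z :: r]cat1s -[z :: l ++ r]cat1s perm_catCA.
rewrite (IH (fun t => f (a :: t)) _ s (l ++ r)) //; last first.
  by move=> u u' su uu'; apply: fP; rewrite /= ?su // perm_cons.
have mv u u' : size (u ++ u') = n -> f (a :: u ++ u') = f (u ++ a :: u').
  move=> su; apply: fP; first by rewrite /= su.
  by rewrite perm_sym -[a :: u']cat1s -[a :: u ++ u']cat1s perm_catCA.
case: slr => slr; rewrite dersum_cat; congr (_ + _); apply: eq_dersum => u su.
  by apply: mv; rewrite size_cat su -size_cat.
by apply: mv; rewrite size_cat su -size_cat.
Qed.

(** The commutator of two derivations is the derivation which extends the
    commutator; the terms that change two different letters cancel. *)
Lemma dersumC A B f s :
  dersum A (dersum B f) s - dersum B (dersum A f) s =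
  dersum (fun a => ext B (A a) - ext A (B a)) f s.
Proof.
elim: s f => [|a s IH] f /=; first by rewrite subr0.
have E A' x : dersum A' (fun t => ext (fun z => f (z :: t)) x) s =
  ext (fun z => dersum A' (fun t => f (z :: t)) s) x.
  exact: (dersum_ext _ (fun z t => f (z :: t))).
rewrite !extD !dersumD !E -IH linearB /= !ext_ext; zmodule.
Qed.

End Valued.
End Substitution.

(** * Monomials in a pre-Lie algebra *)

Section Monomials.
Variables (K : fieldType) (Z : choiceType) (br : Z -> Z -> {free K[Z]}).
Implicit Types (s t : seq Z).

(** The recursion is on n, the length of s, because substitution replaces s by
    other words of the same length. *)
Fixpoint monoN (V : lmodType K) (rho : Z -> V -> V) (v : V) (n : nat) s : V :=
  match n, s with
  | m.+1, a :: s' =>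
      rho a (monoN rho v m s') - dersum (br a) (monoN rho v m) s'
  | _, _ => v
  end.

(** The action of the monomial s of the symmetric algebra, solved from the
    formula for the product of a letter and a monomial, which is a s plus the
    derivation of s by the bracket with a. *)
Definition mono (V : lmodType K) (rho : Z -> V -> V) (v : V) s : V :=
  monoN rho v (size s) s.

Lemma mono_cons (V : lmodType K) (rho : Z -> V -> V) v a s :
  mono rho v (a :: s) = rho a (mono rho v s) - dersum (br a) (mono rho v) s.
Proof. by congr (_ - _); apply: eq_dersum => t; rewrite /mono => ->. Qed.

(** The recursion has a unique solution, so any family f satisfying the
    product formula is given by it. *)
Lemma mono_unique (V : lmodType K) (rho : Z -> V -> V) (f : seq Z -> V) :
  (forall a s, rho a (f s) = f (a :: s) + dersum (br a) f s) ->
  forall s, mono rho (f [::]) s = f s.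
Proof.
move=> H s; have [n] := ubnP (size s); elim: n s => // n IH [|a s] //= sn.
rewrite mono_cons IH // H (eq_dersum _ (g := f)) => [|t st]; first by zmodule.
by apply: IH; rewrite st.
Qed.

Lemma mono_lin (V V' : lmodType K) (rho : Z -> V -> V) (rho' : Z -> V' -> V')
    (F : {linear V -> V'}) v s :
  (forall a u, F (rho a u) = rho' a (F u)) ->
  F (mono rho v s) = mono rho' (F v) s.
Proof.
move=> H; have [n] := ubnP (size s); elim: n s => // n IH [|a s] //= sn.
rewrite !mono_cons linearB /= H IH // dersum_lin; congr (_ - _).
by apply: eq_dersum => t st; apply: IH; rewrite st.
Qed.

Lemma dersum_subspace (V : lmodType K) (Q : V -> Prop) (A : Z -> {free K[Z]})
    (mk : Z -> nat) k (f : seq Z -> V) s : subspace Q ->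
  (forall b, supported (fun z => mk z == mk b + k)%N (A b)) ->
  (forall t, size t = size s ->
     sumn [seq mk z | z <- t] = (sumn [seq mk z | z <- s] + k)%N -> Q (f t)) ->
  Q (dersum A f s).
Proof.
move=> sQ HA; elim: s f => [|b s IH] f H /=; first by case: sQ.
apply: subspaceD => //.
  apply: subspace_supported (HA b) => // z /eqP mz; apply: H => //=.
  by rewrite mz addnAC.
by apply: IH => t st mt; apply: H; rewrite /= ?st // mt addnA.
Qed.

(** The number of unprimed letters is additive under the bracket, hence a
    grading m, whereas the bracket merges two letters into one, so that the
    length n only gives a filtration. *)
Lemma mono_graded (V : lmodType K) (Q : nat -> nat -> V -> Prop)
    (mk : Z -> nat) (rho : Z -> V -> V) :
  (forall m n, subspace (Q m n)) ->
  (forall m n v, Q m n v -> Q m n.+1 v) ->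
  (forall a b, supported (fun z => mk z == mk b + mk a)%N (br a b)) ->
  (forall a m n v, Q m n v -> Q (mk a + m)%N n.+1 (rho a v)) ->
  forall m n v s, Q m n v ->
    Q (sumn [seq mk a | a <- s] + m)%N (size s + n)%N (mono rho v s).
Proof.
move=> sQ Qm Hbr Hrho m n v s Qv.
have [N] := ubnP (size s); elim: N s => // N IH [|a s] //= sN.
rewrite mono_cons -addnA; apply: subspaceB => //.
  by rewrite addSn; apply: Hrho; apply: IH.
apply: (dersum_subspace (mk := mk) (k := mk a)) => // t st mt.
rewrite addnA [(mk a + _)%N]addnC -mt -st addSn; apply: Qm.
by apply: IH; rewrite st.
Qed.

Section Symmetry.
Hypothesis brP : forall a b c,
  ext (br^~ c) (br a b - br b a) = ext (br a) (br b c) - ext (br b) (br a c).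
Variables (V : lmodType K) (rho : Z -> {linear V -> V}).
Hypothesis rhoC : forall a b u,
  rho a (rho b u) - rho b (rho a u) = ext (fun z => rho z u) (br a b - br b a).
Variable v : V.
Let M s := mono rho v s.

Lemma dersum_br a b (f : seq Z -> V) s :
  dersum (br a) (dersum (br b) f) s - dersum (br b) (dersum (br a) f) s =
  - ext (fun z => dersum (br z) f s) (br a b - br b a).
Proof.
rewrite dersumC; elim: s f => [|c s IH] f /=; first by rewrite ext0 oppr0.
rewrite IH extD opprD -ext_ext; congr (_ + _).
by rewrite brP !linearB /=; zmodule.
Qed.

(** Expanding both orders leaves the commutator of rho a and rho b on one side
    and the commutator of the two substitutions on the other; the first is the
    action of the commutator of a and b, and the pre-Lie identity says the
    same of the second. *)
Lemma mono_swap a b s : M (a :: b :: s) = M (b :: a :: s).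
Proof.
have E a' b' : M (a' :: b' :: s) = rho a' (rho b' (M s)) -
    (dersum (br b') (fun t => rho a' (M t)) s
     + dersum (br a') (fun t => rho b' (M t)) s)
    - ext (fun z => rho z (M s)) (br a' b')
    + ext (fun z => dersum (br z) M s) (br a' b')
    + dersum (br a') (dersum (br b') M) s.
  rewrite [M _]mono_cons -/M /= [mono _ v (b' :: s)]mono_cons -/M linearB /=.
  rewrite dersum_lin [X in _ - (_ + X)](eq_dersum _ (g := fun t =>
    rho b' (M t) - dersum (br b') M t)); last by move=> t _; rewrite /M mono_cons.
  rewrite dersumB [X in _ - (X + _)](eq_ext (g := fun z =>
    rho z (M s) - dersum (br z) M s)); last by move=> z; rewrite /M mono_cons.
  by rewrite extB; zmodule.
apply/eqP; rewrite -subr_eq0 !E; apply/eqP.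
have /eqP := rhoC a b (M s); have /eqP := dersum_br a b M s.
rewrite !linearB /= -subr_eq0 => /eqP e1 /eqP e2.
transitivity (0 + (0 : V)); last exact: addr0.
rewrite -{1}e1.
move/eqP: e2; rewrite -subr_eq0 => /eqP <-; zmodule.
Qed.

(** This is what allows a run of letters to be read as a commutative monomial.
    *)
Lemma mono_perm s t : perm_eq s t -> M s = M t.
Proof.
suff H n : perm_inv n M by move=> /H; apply.
elim/ltn_ind: n => n IH {}s {}t.
case: s => [|a s] /=; first by move=> _ /perm_size; case: t.
move=> sn; subst n.
have M_cons x (u u' : seq Z) : (size u < (size s).+1)%N -> perm_eq u u' ->
    M (x :: u) = M (x :: u').
  move=> su uu'; rewrite /M !mono_cons; congr (rho x _ - _).
    exact: (IH _ su u u').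
  exact: (dersum_perm (br x) (IH _ su) erefl uu').
move=> pt; have at_ : a \in t by rewrite -(perm_mem pt) mem_head.
case/splitPr: at_ pt => l r pt.
have ps : perm_eq s (l ++ r).
  by rewrite -(perm_cons a) (perm_trans pt) // perm_sym -cat1s perm_catCA.
rewrite (M_cons a s (l ++ r)) //.
case: l pt ps => [|b l] // pt ps.
have slr : size s = (size (l ++ r)).+1 by rewrite (perm_size ps).
rewrite /= mono_swap; apply: M_cons.
  by rewrite slr /= ltnS.
by rewrite -[a :: r]cat1s -[a :: _]cat1s perm_catCA.
Qed.

End Symmetry.
End Monomials.

(** * Normal words *)

HB.instance Definition _ (Z : Type) := gen_eqMixin (sym Z).
HB.instance Definition _ (Z : Type) := gen_choiceMixin (sym Z).

Section Words.
Variables (d : Order.disp_t) (Y : orderType d).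
Local Notation Z := (plus Y).
Local Notation W := (word Z).
Implicit Types (s t : seq Z) (w p q : W) (c : Z).

Definition run s : W := [seq Letter c | c <- s].

Definition is_letter (x : sym Z) : bool := if x is Letter _ then true else false.
Definition no_letter_head w : bool := if w is Letter _ :: _ then false else true.
Definition no_R_head w : bool := if w is Rsym _ :: _ then false else true.

Fixpoint firstrun w : seq Z :=
  if w is Letter c :: w' then c :: firstrun w' else [::].
Fixpoint rest w : W := if w is Letter c :: w' then rest w' else w.

Lemma run_split w : run (firstrun w) ++ rest w = w.
Proof. by elim: w => [//|[c|z] w IH] //=; rewrite IH. Qed.

Lemma no_letter_rest w : no_letter_head (rest w).
Proof. by elim: w => [|[]]. Qed.

Lemma firstrun_run s w : no_letter_head w -> firstrun (run s ++ w) = s.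
Proof. by move=> nw; elim: s => [|c s /= ->] //=; case: w nw => [|[]]. Qed.

Lemma rest_run s w : no_letter_head w -> rest (run s ++ w) = w.
Proof. by move=> nw; elim: s => [|c s] //=; case: w nw => [|[]]. Qed.

Lemma run_cat s t : run (s ++ t) = run s ++ run t.
Proof. exact: map_cat. Qed.

Lemma word_ind (P : W -> Prop) : P [::] ->
  (forall s w, no_letter_head w -> s != [::] -> P w -> P (run s ++ w)) ->
  (forall z w, P w -> P (Rsym z :: w)) -> forall w, P w.
Proof.
move=> P0 PL PR w; have [n] := ubnP (size w); elim: n w => // n IH w.
rewrite -(run_split w); have := no_letter_rest w.
case: (firstrun w) (rest w) => [|c s] r nr /=; last first.
  move=> sw; apply: (PL (c :: s)) => //; apply: IH.
  by move: sw; rewrite size_cat ltnS; apply: leq_ltn_trans; rewrite leq_addl.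
case: r nr => [//|[//|z] r] _ /= sr; apply: PR; exact: IH.
Qed.

Definition mk c : nat := inY c.
Definition mkS (x : sym Z) : nat := if x is Letter c then mk c else 0.
(** Letters inside a symbol R(z) do not count. *)
Definition marks w : nat := sumn (map mkS w).

Fixpoint degS (x : sym Z) : nat :=
  if x is Rsym w then sumn (map degS w) else 1.
(** All letters count, whatever their depth inside the symbols R(z). *)
Definition deg w : nat := sumn (map degS w).

Fixpoint szS (x : sym Z) : nat :=
  if x is Rsym w then (sumn (map szS w)).+1 else 1.
(** The measure for recursion inside R(z): unlike deg, it decreases strictly
    when R is removed. *)
Definition sz w : nat := sumn (map szS w).

Definition adj (x y : sym Z) : bool :=
  match x, y with
  | Letter a, Letter b => (a <= b)%O
  | Rsym _, Rsym _ => false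
  | _, _ => true
  end.

(** In reverse order. It is the run before the last symbol R(z) if the word
    ends with a symbol. *)
Definition lastrun w : seq Z :=
  firstrun (if rev w is Rsym _ :: r then r else rev w).

(** Among the letters of the run, up to primes, an unprimed one is greatest.
    Stated without reference to the order of the run, it is visibly invariant
    under sorting. *)
Definition rexc s : bool :=
  has (fun c => inY c && all (fun c' => (c' <= primed c.1)%O) s) s.
Definition wexc w : bool := rexc (lastrun w).

Fixpoint okS (x : sym Z) : bool :=
  if x is Rsym w then
    [&& sorted adj w, all okS w, marks w == 1%N & ~~ wexc w]
  else true.
Definition normal w : bool := sorted adj w && all okS w.
(** The words that may stand inside R(z) in a normal word. *)
Definition legal w : bool := okS (Rsym w).

Lemma legalE w : legal w = [&& normal w, marks w == 1%N & ~~ wexc w].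
Proof. by rewrite /legal /normal /= !andbA. Qed.

Lemma marks_cat w1 w2 : marks (w1 ++ w2) = (marks w1 + marks w2)%N.
Proof. by rewrite /marks map_cat sumn_cat. Qed.
Lemma deg_cat w1 w2 : deg (w1 ++ w2) = (deg w1 + deg w2)%N.
Proof. by rewrite /deg map_cat sumn_cat. Qed.
Lemma sz_cat w1 w2 : sz (w1 ++ w2) = (sz w1 + sz w2)%N.
Proof. by rewrite /sz map_cat sumn_cat. Qed.
Lemma marks_run s : marks (run s) = sumn (map mk s).
Proof. by rewrite /marks -map_comp. Qed.
Lemma deg_run s : deg (run s) = size s.
Proof. by rewrite /deg -map_comp; elim: s => //= c s ->. Qed.
Lemma marks_R z w : marks (Rsym z :: w) = marks w.
Proof. by []. Qed.
Lemma deg_R z w : deg (Rsym z :: w) = (deg z + deg w)%N.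
Proof. by []. Qed.

Lemma adj_path_head x w : no_letter_head w -> is_letter x -> path adj x w = sorted adj w.
Proof. by case: w x => [|[c|z] w] [a|r]. Qed.

Lemma normal_run s w : no_letter_head w ->
  normal (run s ++ w) = sorted <=%O s && normal w.
Proof.
move=> nw; rewrite /normal all_cat.
have -> : all okS (run s) by apply/allP => x /mapP [c _ ->].
rewrite [true && _]andTb andbA; congr (_ && _).
case: s => [|c s]; first by [].
rewrite -[sorted adj _]/(path adj (Letter c) (run s ++ w)) cat_path.
rewrite (adj_path_head nw); last by elim: s c => /=.
by congr (_ && _); elim: s c => //= b s IH c; rewrite -/(run s) IH.
Qed.

Lemma normal_R z w : normal (Rsym z :: w) = [&& legal z, no_R_head w & normal w].
Proof.
rewrite /normal; case: w => [|x w]; first by rewrite /= !andbT.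
rewrite [sorted _ _]/= [all _ _]/= -/(legal z) /no_R_head.
by case: x => [c|y] /=; rewrite ?andbF // andbCA.
Qed.

Lemma normal_cat w1 w2 : normal (w1 ++ w2) ->
  normal w1 /\ normal w2.
Proof.
rewrite /normal all_cat => /andP [s12 /andP [-> ->]]; rewrite !andbT.
by move/cat_sorted2: s12 => [].
Qed.

Lemma normal_rcons_R w z :
  normal (rcons w (Rsym z)) = [&& no_R_head (rev w), normal w & legal z].
Proof.
rewrite /normal all_rcons -[okS (Rsym z)]/(legal z).
have -> : sorted adj (rcons w (Rsym z)) = no_R_head (rev w) && sorted adj w.
  case/lastP: w => [//|w y]; rewrite rev_rcons -cats1.
  case: w => [|x w]; first by case: y.
  by rewrite rcons_cons /= cat_path last_rcons /= andbT andbC; case: y.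
by case: (legal z); rewrite ?andbF ?andbT ?andbA /= ?andbF ?andbT ?andbA.
Qed.

Lemma firstrun_rcons_R r z : firstrun (rcons r (Rsym z)) = firstrun r.
Proof. by elim: r => [|[c|y] r /= IH] //; rewrite IH. Qed.

Lemma lastrun_R z w : lastrun (Rsym z :: w) = lastrun w.
Proof.
rewrite /lastrun rev_cons; case: (rev w) => [|[c|y] r] //=.
  by rewrite firstrun_rcons_R.
by rewrite firstrun_rcons_R.
Qed.

Lemma wexc_R z w : wexc (Rsym z :: w) = wexc w.
Proof. by rewrite /wexc lastrun_R. Qed.

Lemma lastrun_rcons_R w z : lastrun (rcons w (Rsym z)) = firstrun (rev w).
Proof. by rewrite /lastrun rev_rcons. Qed.

Lemma rexc_perm s t : perm_eq s t -> rexc s = rexc t.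
Proof.
move=> st; rewrite /rexc (eq_has_r (perm_mem st)); apply: eq_has => c.
by rewrite (eq_all_r (perm_mem st)).
Qed.

End Words.

(** * Products of symbols R(z) *)

(** R(p)q, given the product st of two symbols: a symbol at the head of q is
    merged with R(p). *)
HB.lock Definition pre0 (K : fieldType) (d : Order.disp_t) (Y : orderType d)
    (st : word (plus Y) -> word (plus Y) -> {free K[word (plus Y)]})
    (p q : word (plus Y)) : {free K[word (plus Y)]} :=
  if q is Rsym q1 :: q' then ext (fun z => bas (Rsym z :: q')) (st p q1)
  else bas (Rsym p :: q).

(** The mirror image pR(q) of pre0. *)
HB.lock Definition app0 (K : fieldType) (d : Order.disp_t) (Y : orderType d)
    (st : word (plus Y) -> word (plus Y) -> {free K[word (plus Y)]})
    (p q : word (plus Y)) : {free K[word (plus Y)]} :=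
  if rev p is Rsym p1 :: r then
    ext (fun z => bas (rcons (rev r) (Rsym z))) (st p1 q)
  else bas (rcons p (Rsym q)).

(** R(p)R(q) = R(R(p)q + pR(q)), where the outer R is left implicit. The
    recursion is on a bound n for the total size. *)
Fixpoint starN (K : fieldType) (d : Order.disp_t) (Y : orderType d) n
    (p q : word (plus Y)) : {free K[word (plus Y)]} :=
  if n is m.+1 then pre0 (starN K m) p q + app0 (starN K m) p q else 0.

HB.lock Definition star (K : fieldType) (d : Order.disp_t) (Y : orderType d)
    (p q : word (plus Y)) : {free K[word (plus Y)]} :=
  starN K (sz p + sz q).+1 p q.

Section Star.
Variables (K : fieldType) (d : Order.disp_t) (Y : orderType d).
Local Notation Z := (plus Y).
Local Notation W := (word Z).
Local Notation F := {free K[W]}.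
Implicit Types (s t : seq Z) (w p q : W) (c : Z).
Local Notation starN := (@starN K d Y).
Local Notation star := (@star K d Y).

Lemma starNS n p q : starN n.+1 p q = pre0 (starN n) p q + app0 (starN n) p q.
Proof. by []. Qed.

Definition pre p q : F := pre0 star p q.
Definition app p q : F := app0 star p q.

Lemma sz_R z w : sz (Rsym z :: w) = (sz z + sz w).+1.
Proof. by []. Qed.

Lemma sz_rev w : sz (rev w) = sz w.
Proof. by rewrite /sz map_rev sumn_rev. Qed.

Lemma sz_rcons w x : sz (rcons w x) = (sz w + szS x)%N.
Proof. by rewrite -cats1 sz_cat /sz /= addn0. Qed.

Lemma starN_stable m n p q : (sz p + sz q < m)%N -> (sz p + sz q < n)%N ->
  starN m p q = starN n p q.
Proof.
elim: m n p q => [n p q|m IH [p q _|n p q Hm Hn]]; rewrite ?ltn0; try by case.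
rewrite (starNS m) (starNS n); apply: (f_equal2 +%R).
  rewrite pre0.unlock; case: q Hm Hn => [|[c|q1] q'] //; rewrite sz_R => Hm Hn.
  by rewrite (IH n) //; lia.
rewrite app0.unlock; have := sz_rev p; case: (rev p) => [|[c|p1] r] //; rewrite sz_R => e.
by rewrite (IH n) //; lia.
Qed.

Lemma starE p q : star p q = pre p q + app p q.
Proof.
rewrite star.unlock starNS; apply: (f_equal2 +%R).
  rewrite /pre pre0.unlock star.unlock; case: q => [|[c|q1] q'] //; rewrite sz_R.
  by congr (ext _ _); apply: starN_stable; lia.
rewrite /app app0.unlock star.unlock; have := sz_rev p; case: (rev p) => [|[c|p1] r] //; rewrite sz_R => e.
by congr (ext _ _); apply: starN_stable; lia.
Qed.

Lemma pre_R p q w : pre p (Rsym q :: w) = ext (fun z => bas (Rsym z :: w)) (star p q).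
Proof. by rewrite /pre pre0.unlock. Qed.
Lemma pre_bas p w : no_R_head w -> pre p w = bas (Rsym p :: w).
Proof. by rewrite /pre pre0.unlock; case: w => [|[]]. Qed.
Lemma app_R p w q : app (rcons w (Rsym p)) q =
  ext (fun z => bas (rcons w (Rsym z))) (star p q).
Proof. by rewrite /app app0.unlock rev_rcons revK. Qed.
Lemma app_bas w q : no_R_head (rev w) -> app w q = bas (rcons w (Rsym q)).
Proof. by rewrite /app app0.unlock star.unlock; case: (rev w) => [|[]]. Qed.

Lemma deg_rcons w x : deg (rcons w x) = (deg w + degS x)%N.
Proof. by rewrite -cats1 deg_cat /deg /= addn0. Qed.
Lemma marks_rcons w x : marks (rcons w x) = (marks w + mkS x)%N.
Proof. by rewrite -cats1 marks_cat /marks /= addn0. Qed.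

Lemma lastrun_letter w : no_R_head (rev w) -> lastrun w = firstrun (rev w).
Proof. by rewrite /lastrun; case: (rev w) => [|[]]. Qed.

Definition homog n w : bool := legal w && (deg w == n).

Lemma legal_normal w : legal w -> normal w.
Proof. by rewrite legalE => /andP[]. Qed.

(** Multiplication by R(p) on the left leaves the runs of q unchanged, in
    particular the last one, which decides whether a word is exceptional. *)
Lemma pre_homog_aux p q :
  (forall q1 q', q = Rsym q1 :: q' -> supported (homog (deg p + deg q1)) (star p q1)) ->
  legal p -> normal q ->
  supported (fun w => [&& normal w, marks w == marks q, deg w == deg p + deg q,
     wexc w == wexc q & ~~ no_R_head w])%N (pre p q).
Proof.
case: q => [|[c|q1] q'] IH Gp nq; try (by rewrite pre_bas //; apply: supported_bas;
  rewrite normal_R Gp nq ?marks_R ?deg_R ?wexc_R !eqxx).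
rewrite pre_R; apply: supported_ext (IH q1 q' erefl).
move=> z /andP [Gz /eqP dz]; apply: supported_bas.
move: nq; rewrite !normal_R !marks_R !deg_R !wexc_R Gz dz => /and3P [_ -> ->].
by rewrite addnA !eqxx.
Qed.

Lemma app_homog_aux p q :
  (forall p1 p', p = rcons p' (Rsym p1) ->
    supported (homog (deg p1 + deg q)) (star p1 q)) ->
  normal p -> legal q ->
  supported (fun w => [&& normal w, marks w == marks p, deg w == deg p + deg q,
     wexc w == wexc p & ~~ no_R_head (rev w)])%N (app p q).
Proof.
have [lp|] := boolP (no_R_head (rev p)).
  move=> _ np Gq; rewrite app_bas //; apply: supported_bas.
  rewrite normal_rcons_R lp np Gq marks_rcons deg_rcons addn0.
  by rewrite /wexc lastrun_rcons_R lastrun_letter // rev_rcons !eqxx.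
case/lastP: p => [|p [c|p1]] //; rewrite ?rev_rcons // => _ IH.
rewrite app_R => np Gq; apply: supported_ext (IH p1 p erefl).
move=> z /andP [Gz /eqP dz]; apply: supported_bas.
move: np; rewrite rev_rcons !marks_rcons !deg_rcons /= -!/(deg _) dz addnA.
rewrite /wexc !lastrun_rcons_R !eqxx !andbT.
by rewrite !normal_rcons_R Gz => /and3P [-> -> _].
Qed.

Lemma legal_in_R z w : normal (Rsym z :: w) -> legal z.
Proof. by rewrite normal_R => /andP[]. Qed.
Lemma legal_in_rcons z w : normal (rcons w (Rsym z)) -> legal z.
Proof. by rewrite /normal all_rcons => /and3P[]. Qed.

(** Words inside R stay legal when symbols are multiplied, and no letter is
    created or lost. *)
Lemma star_homog p q : legal p -> legal q -> supported (homog (deg p + deg q)) (star p q).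
Proof.
have [n] := ubnP (sz p + sz q); elim: n p q => // n IH p q sn Gp Gq.
have [np nq] := (legal_normal Gp, legal_normal Gq).
rewrite starE; apply: supportedD.
  apply: supportedW (pre_homog_aux _ Gp nq).
    move=> w /and5P [nw /eqP mw /eqP dw /eqP ew _]; rewrite /homog legalE nw mw ew dw eqxx.
    by move: Gq; rewrite legalE andbT => /andP [_ ->].
  move=> q1 q' e; apply: IH => //; last by apply: (@legal_in_R _ q'); rewrite -e.
  by move: sn; rewrite e sz_R; lia.
apply: supportedW (app_homog_aux _ np Gq).
  move=> w /and5P [nw /eqP mw /eqP dw /eqP ew _]; rewrite /homog legalE nw mw ew dw eqxx.
  by move: Gp; rewrite legalE andbT => /andP [_ ->].
move=> p1 p' e; apply: IH => //; last by apply: (@legal_in_rcons _ p'); rewrite -e.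
by move: sn; rewrite e sz_rcons /= -/(sz p1); lia.
Qed.

End Star.

(** * Linear maps on a free module *)

Section LinearExtension.
Variables (K : fieldType) (T : choiceType).

Lemma eq_on_basis (V : lmodType K) (f g : {free K[T]} -> V) :
  linear f -> linear g -> (forall t, f (bas t) = g (bas t)) -> f =1 g.
Proof.
move=> lf lg H u; rewrite -(ext_id u).
apply: (subspace_ext (Q := fun x => f x = g x)) => //; split=> [|c x y ex ey].
  have f0 : f 0 = 0 by rewrite -[LHS](addKr (f 0)) -{2}[f 0]scale1r -lf scale1r addr0 addNr.
  have g0 : g 0 = 0 by rewrite -[LHS](addKr (g 0)) -{2}[g 0]scale1r -lg scale1r addr0 addNr.
  by rewrite f0 g0.
by rewrite lf lg ex ey.
Qed.

Lemma linear_ext (V V' : lmodType K) (F : T -> V -> V') x :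
  (forall t, linear (F t)) -> linear (fun u => ext (F^~ u) x).
Proof.
by move=> lF c u v; rewrite -extZ -extD; apply: eq_ext => t; rewrite lF.
Qed.

Lemma linear_sub (V V' : lmodType K) (f g : V -> V') :
  linear f -> linear g -> linear (fun u => f u - g u).
Proof. by move=> lf lg c u v; rewrite lf lg scalerBr; zmodule. Qed.

Lemma linear_add (V V' : lmodType K) (f g : V -> V') :
  linear f -> linear g -> linear (fun u => f u + g u).
Proof. by move=> lf lg c u v; rewrite lf lg scalerDr; zmodule. Qed.

Lemma linear_comp (V V' V'' : lmodType K) (f : V' -> V'') (g : V -> V') :
  linear f -> linear g -> linear (fun u => f (g u)).
Proof. by move=> lf lg c u v; rewrite lg lf. Qed.

Lemma linear_lin (V V' : lmodType K) (f : {linear V -> V'}) : linear f.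
Proof. exact: linearP. Qed.

End LinearExtension.

(** * Associativity for symbols R(z) *)

Section StarAssoc.
Variables (K : fieldType) (d : Order.disp_t) (Y : orderType d).
Local Notation Z := (plus Y).
Local Notation W := (word Z).
Implicit Types (w p q r : W).

Notation star := (@star K d Y).
Notation pre := (@pre K d Y).
Notation app := (@app K d Y).

Definition assoc3 p q r := ext (star^~ r) (star p q) = ext (star p) (star q r).

Lemma pre_star p q r :
  (forall r1 r', r = Rsym r1 :: r' -> assoc3 p q r1) ->
  ext (pre^~ r) (star p q) = ext (pre p) (pre q r).
Proof.
have [nr _|] := boolP (no_R_head r).
  rewrite (pre_bas _ q nr) ext_bas pre_R; apply: eq_ext => z; exact: pre_bas.
case: r => [|[c|r1] r'] // _ IH.
rewrite pre_R ext_ext [RHS](eq_ext (g := fun z => ext (fun t => bas (Rsym t :: r')) (star p z))); last first.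
  by move=> z; rewrite ext_bas pre_R.
rewrite -(ext_ext _ (star p)) -(IH _ _ erefl) ext_ext.
by apply: eq_ext => z; rewrite pre_R.
Qed.

Lemma app_star p q r :
  (forall p1 p', p = rcons p' (Rsym p1) -> assoc3 p1 q r) ->
  ext (app^~ r) (app p q) = ext (app p) (star q r).
Proof.
have [np _|] := boolP (no_R_head (rev p)).
  by rewrite (app_bas _ q np) ext_bas app_R; apply: eq_ext => z; rewrite app_bas.
case/lastP: p => [|p [c|p1]] //; rewrite ?rev_rcons // => _ IH.
rewrite app_R ext_ext [LHS](eq_ext (g := fun z => ext (fun t => bas (rcons p (Rsym t))) (star z r))); last first.
  by move=> z; rewrite ext_bas app_R.
rewrite -(ext_ext _ (star^~ r)) (IH _ _ erefl) ext_ext.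
by apply: eq_ext => z; rewrite app_R.
Qed.

(** The left end and the right end of q do not interact, because there is a
    letter between them. *)
Lemma pre_app p q r : has (@is_letter d Y) q ->
  ext (pre p) (app q r) = ext (app^~ r) (pre p q).
Proof.
case: q => [|x q]; first by [].
case/lastP: q => [|l y].
  by case: x => [c|z] // _; rewrite app_bas // pre_bas // !ext_bas pre_bas // app_bas.
move=> _; rewrite -!rcons_cons.
case: x y => [c|q1] [c'|q2].
- rewrite app_bas ?rev_rcons // pre_bas // !ext_bas pre_bas // [RHS]app_bas //.
  by rewrite -rcons_cons rev_rcons.
- rewrite app_R pre_bas // ext_ext ext_bas -rcons_cons app_R.
  by apply: eq_ext => z; rewrite ext_bas pre_bas.
- rewrite app_bas ?rev_rcons // !rcons_cons pre_R ext_bas pre_R ext_ext.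
  apply: eq_ext => z; rewrite ext_bas -rcons_cons app_bas //.
  by rewrite -rcons_cons rev_rcons.
rewrite app_R rcons_cons pre_R !ext_ext.
rewrite (eq_ext (g := fun z => ext (fun u => bas (Rsym u :: rcons l (Rsym z))) (star p q1))).
  rewrite ext_swap; apply: eq_ext => u; rewrite ext_bas -rcons_cons app_R.
  by apply: eq_ext => z; rewrite rcons_cons.
by move=> z; rewrite ext_bas rcons_cons pre_R.
Qed.

Lemma has_letter_marks w : (0 < marks w)%N -> has (@is_letter d Y) w.
Proof. by elim: w => [|[c|z] w IH]. Qed.

Lemma legal_has_letter w : legal w -> has (@is_letter d Y) w.
Proof. by rewrite legalE => /and3P [_ /eqP mw _]; apply: has_letter_marks; rewrite mw. Qed.

(** The three axioms of a preassociative algebra for pre and app, added up.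
    The outer ones reduce to the associativity for shorter words, and the
    middle one is pre_app. *)
Lemma star_assoc p q r : legal p -> legal q -> legal r -> assoc3 p q r.
Proof.
have [n] := ubnP (sz p + sz q + sz r); elim: n p q r => // n IH p q r sn Gp Gq Gr.
have starD1 x : ext (star^~ r) x = ext (pre^~ r) x + ext (app^~ r) x.
  by rewrite -extD; apply: eq_ext => z; apply: starE.
have starD2 x : ext (star p) x = ext (pre p) x + ext (app p) x.
  by rewrite -extD; apply: eq_ext => z; apply: starE.
have Epre : ext (pre^~ r) (star p q) = ext (pre p) (pre q r).
  apply: pre_star => r1 r' e; apply: IH => //.
    by move: sn; rewrite e sz_R; lia.
  by apply: (@legal_in_R _ _ _ r'); rewrite -e legal_normal.
have Eapp : ext (app^~ r) (app p q) = ext (app p) (star q r).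
  apply: app_star => p1 p' e; apply: IH => //.
    by move: sn; rewrite e sz_rcons /= -/(sz p1); lia.
  by apply: (@legal_in_rcons _ _ _ p'); rewrite -e legal_normal.
have Emix : ext (pre p) (app q r) = ext (app^~ r) (pre p q).
  exact/pre_app/legal_has_letter.
rewrite /assoc3 starD1 starD2 Epre -Eapp [in LHS](starE K p q) [in RHS](starE K q r).
by rewrite 2!linearD /= Emix addrA.
Qed.

End StarAssoc.

(** * The pre-Lie algebra spanned by the letters *)

Section Structure.
Variables (K : fieldType) (d : Order.disp_t) (Y : orderType d).
Local Notation Z := (plus Y).
Local Notation W := (word Z).
Implicit Types (s t : seq Z) (w p q r : W).

Variable cc : Y -> Y -> {free K[Y]}.
Hypothesis ccP : forall a b c,
  ext (cc^~ c) (cc a b - cc b a) = ext (cc a) (cc b c) - ext (cc b) (cc a c).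

(** A vector of C as a combination of primed (e = true) or unprimed letters.
    *)
Definition tagY (e : bool) (x : {free K[Y]}) : {free K[Z]} :=
  ext (fun y => bas (y, e)) x.

(** C acts by its product on itself and on eC, and eC acts by zero. Then a o b
    - b o a is the commutator of the letters a and b in an RB-algebra, where
    y' is R(y), to first order in e. *)
Definition br (a b : Z) : {free K[Z]} :=
  if a.2 then tagY b.2 (cc a.1 b.1) else 0.

Lemma brP a b c :
  ext (br^~ c) (br a b - br b a) = ext (br a) (br b c) - ext (br b) (br a c).
Proof.
have tE f (e : bool) x : ext f (tagY e x) = ext (fun y => f (y, e)) x :> {free K[Z]}.
  by rewrite /tagY ext_ext; apply: eq_ext => y; rewrite ext_bas.
have tB e x y : tagY e (x - y) = tagY e x - tagY e y.
  exact: linearB.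
have E1 x z e : ext (br^~ (z, e)) (tagY true x) = tagY e (ext (cc^~ z) x).
  rewrite tE; symmetry; exact: ext_ext.
have E2 x y e : ext (br (y, true)) (tagY e x) = tagY e (ext (cc y) x).
  rewrite tE; symmetry; exact: ext_ext.
have br0 y x : ext (br (y, false)) x = 0 by exact: ext0.
have br0' x z : ext (br^~ z) (tagY false x) = 0.
  by rewrite tE; exact: ext0.
have b0 y z : br (y, false) z = 0 by [].
have b1 y z e : br (y, true) (z, e) = tagY e (cc y z) by [].
case: a b c => [a []] [b []] [c e].
- by rewrite !b1 -tB E1 ccP tB -!E2.
- by rewrite !b0 b1 subr0 br0' !br0 linear0 subr0.
- by rewrite !b0 b1 sub0r linearN /= br0' !br0 !linear0 addr0.
by rewrite !b0 subr0 !linear0 ?addr0 ?subr0 ?oppr0.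
Qed.

End Structure.

(** * Representations *)

Section Action.
Variables (K : fieldType) (d : Order.disp_t) (Y : orderType d).
Variable cc : Y -> Y -> {free K[Y]}.
Local Notation Z := (plus Y).
Local Notation W := (word Z).
Local Notation br := (@br K d Y cc).
Local Notation mono := (mono br).
Implicit Types (s t : seq Z) (w p q r : W).

Section Raw.
Variable V : lmodType K.
Implicit Types (rho : Z -> V -> V) (tau : W -> V -> V) (v : V).

(** The word is read from the left and acc collects the current run, because a
    monomial acts as a whole. The symbols are given as operators so that the
    recursion is structural, which allows it to be nested inside a recursion
    on symbols. *)
Fixpoint actL rho v (acc : seq Z) (l : seq (Z + (V -> V))) : V :=
  match l with
  | [::] => mono rho v acc
  | inl a :: l' => actL rho v (rcons acc a) l'
  | inr h :: l' => mono rho (h (actL rho v [::] l')) acc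
  end.

Definition tag_sym tau (x : sym Z) : Z + (V -> V) :=
  match x with Letter a => inl a | Rsym z => inr (tau z) end.

Definition act rho tau v w : V := actL rho v [::] (map (tag_sym tau) w).

Lemma act_R rho tau v z w : act rho tau v (Rsym z :: w) = tau z (act rho tau v w).
Proof. by []. Qed.

Lemma act_run rho tau v s w : no_letter_head w ->
  act rho tau v (run s ++ w) = mono rho (act rho tau v w) s.
Proof.
move=> nw; rewrite /act.
suff H acc : actL rho v acc (map (tag_sym tau) (run s ++ w)) =
  mono rho (actL rho v [::] (map (tag_sym tau) w)) (acc ++ s) by rewrite H.
elim: s acc => [|a s IH] acc /=; last by rewrite IH cat_rcons.
by rewrite cats0; case: w nw => [|[c|z] w].
Qed.

Lemma act_cat rho tau v w1 w2 : no_letter_head w2 ->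
  act rho tau v (w1 ++ w2) = act rho tau (act rho tau v w2) w1.
Proof.
move=> n2; elim/word_ind: w1 => [//|s w nw s0 IH|z w IH].
  rewrite -catA !act_run ?IH //; by case: (w) nw.
by rewrite cat_cons !act_R IH.
Qed.

End Raw.

(** Intertwining operators commute with the action of a word. *)
Lemma act_lin (V V' : lmodType K) (rho : Z -> V -> V) (rho' : Z -> V' -> V')
    tau tau' (F : {linear V -> V'}) v w :
  (forall a u, F (rho a u) = rho' a (F u)) ->
  (forall z u, Rsym z \in w -> F (tau z u) = tau' z (F u)) ->
  F (act rho tau v w) = act rho' tau' (F v) w.
Proof.
move=> Hr; elim/word_ind: w => [//|s w nw s0 IH|z w IH] Ht.
  rewrite !act_run // (mono_lin _ _ _ Hr) IH // => z u zw.
  by apply: Ht; rewrite mem_cat zw orbT.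
rewrite !act_R Ht ?mem_head // IH // => y u yw.
by apply: Ht; rewrite inE yw orbT.
Qed.

Lemma mk_br (a b : Z) : supported (fun z => mk z == mk b + mk a)%N (br a b).
Proof.
rewrite /br; case: a => [a []] /=; last exact: supported0.
apply: (supported_ext (P := predT)); last exact: all_predT.
move=> y _; apply: supported_bas.
by rewrite /mk addn0.
Qed.

Lemma act_graded (V : lmodType K) (Q : nat -> nat -> V -> Prop)
    (rho : Z -> V -> V) tau :
  (forall m n, subspace (Q m n)) ->
  (forall m n v, Q m n v -> Q m n.+1 v) ->
  (forall a m n v, Q m n v -> Q (mk a + m)%N n.+1 (rho a v)) ->
  (forall z m n v, legal z -> Q m n v -> Q m (deg z + n)%N (tau z v)) ->
  forall m n v w, all (@okS d Y) w -> Q m n v ->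
    Q (marks w + m)%N (deg w + n)%N (act rho tau v w).
Proof.
move=> sQ Qm Hr Ht m n v w; elim/word_ind: w => [//|s w nw s0 IH|z w IH].
  rewrite all_cat => /andP [_ ow] Qv.
  rewrite act_run // marks_cat deg_cat marks_run deg_run -!addnA.
  exact: (mono_graded sQ Qm mk_br Hr) (IH ow Qv).
move=> /= /andP [Gz ow] Qv.
by rewrite act_R marks_R deg_R -addnA; apply: Ht => //; apply: IH.
Qed.

(** The relations between the multiplications by letters and by symbols R(z)
    in an RB-algebra that receives C, where the unprimed letters carry a
    scalar e with e^2 = 0 and therefore commute with each other. *)
Record rep (V : lmodType K) := Rep {
  rho : Z -> {linear V -> V};
  tau : W -> {linear V -> V};
  rhoC : forall a b u,
    rho a (rho b u) - rho b (rho a u) = ext (fun z => rho z u) (br a b - br b a);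
  tauM : forall p q u, legal p -> legal q ->
    tau p (tau q u) = ext (fun z => tau z u) (star K p q) }.

Definition ract (V : lmodType K) (r : rep V) (v : V) (w : W) : V :=
  act (rho r) (tau r) v w.

Section PreLie.
Hypothesis ccP : forall a b c,
  ext (cc^~ c) (cc a b - cc b a) = ext (cc a) (cc b c) - ext (cc b) (cc a c).
Let brP := brP ccP.

Local Notation F := {free K[W]}.

(** The run t followed by the word r. Sorting turns the run into a monomial,
    so that t matters only up to permutation. *)
Definition mu (r : W) (t : seq Z) : F := bas (run (sort <=%O t) ++ r).

Lemma mu_perm r s t : perm_eq s t -> mu r s = mu r t.
Proof.
by move=> st; rewrite /mu; congr (bas (run _ ++ r)); apply/perm_sort_leP.
Qed.

(** The product of the letter a and the monomial at the head of the word, in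
    the enveloping algebra. *)
Definition lam0 a w : F :=
  if normal w then
    mu (rest w) (a :: firstrun w) + dersum (br a) (mu (rest w)) (firstrun w)
  else 0.

Definition lam (a : Z) : {linear F -> F} := ext (lam0 a).

Definition tauP (p : W) : {linear F -> F} :=
  ext (fun w => if normal w then pre K p w else 0).

Lemma lam_mu a r t : no_letter_head r -> normal r ->
  lam a (mu r t) = mu r (a :: t) + dersum (br a) (mu r) t.
Proof.
move=> nr or; rewrite /lam /= ext_bas /lam0 normal_run // or andbT.
rewrite sort_le_sorted firstrun_run // rest_run //.
have ps : perm_eq (sort <=%O t) t by rewrite perm_sort.
congr (_ + _); first by apply: mu_perm; rewrite perm_cons.
by apply: dersum_perm ps => // x y _; apply: mu_perm.
Qed.

Lemma mu_sorted r t : sorted <=%O t -> mu r t = bas (run t ++ r).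
Proof. by move=> st; rewrite /mu sorted_sort //; exact: le_trans. Qed.

Lemma lam_not_normal a w : ~~ normal w -> lam a (bas w) = 0.
Proof. by rewrite /lam /= ext_bas /lam0 => /negbTE ->. Qed.

Lemma normal_parts w : normal w ->
  [/\ no_letter_head (rest w), normal (rest w) & mu (rest w) (firstrun w) = bas w].
Proof.
move=> nw; have nr := no_letter_rest w.
move: (nw); rewrite -{1}(run_split w) normal_run // => /andP [sf ->].
by split=> //; rewrite mu_sorted // run_split.
Qed.

#[local] Opaque mu lam lam0.

(** On monomials this is the theorem of Oudom and Guin: multiplication plus
    derivation defines an action of the Lie algebra of commutators. *)
Lemma lamC a b u :
  lam a (lam b u) - lam b (lam a u) = ext (fun z => lam z u) (br a b - br b a).
Proof.
apply: (eq_on_basis (f := fun u => lam a (lam b u) - lam b (lam a u))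
  (g := fun u => ext (fun z => lam z u) (br a b - br b a))).
- by apply: linear_sub; apply: linear_comp; exact: linear_lin.
- by apply: linear_ext => z; exact: linear_lin.
move=> w; have [nw|nw] := boolP (normal w); last first.
  have la x : lam x (bas w) = 0 := lam_not_normal x nw.
  rewrite !la !linear0 addr0.
  by rewrite (eq_ext (g := fun=> 0)) ?ext0.
have [nr or <-] := normal_parts nw; set r := rest w in nr or *; set s := firstrun w.
have E a' b' : lam a' (lam b' (mu r s)) = mu r [:: a', b' & s]
   + ext (fun z => mu r (z :: s)) (br a' b')
   + dersum (br a') (fun t => mu r (b' :: t)) s
   + dersum (br b') (fun t => mu r (a' :: t)) s
   + dersum (br b') (dersum (br a') (mu r)) s.
  rewrite lam_mu // linearD /= lam_mu // dersum_lin /=.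
  rewrite [X in _ + X = _](eq_dersum _ (g := fun t => mu r (a' :: t) + dersum (br a') (mu r) t)).
    by rewrite dersumD /=; zmodule.
  by move=> t _; rewrite lam_mu.
rewrite !E [RHS](eq_ext (g := fun z => mu r (z :: s) + dersum (br z) (mu r) s)); last first.
  by move=> z; rewrite lam_mu.
have e := dersum_br brP a b (mu r) s.
have -> : mu r [:: b, a & s] = mu r [:: a, b & s].
  by apply: mu_perm; rewrite -[b :: _]cat1s -[a :: s]cat1s -[a :: b :: s]cat1s -[b :: s]cat1s perm_catCA.
rewrite extD -[X in _ = _ + X]opprK -e linearB /=; zmodule.
Qed.

Lemma tauP_bas p w : normal w -> tauP p (bas w) = pre K p w.
Proof. by move=> nw; rewrite /tauP /= ext_bas nw. Qed.

Lemma tauP_not_normal p w : ~~ normal w -> tauP p (bas w) = 0.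
Proof. by move=> /negbTE nw; rewrite /tauP /= ext_bas nw. Qed.

Lemma pre_homog p q : legal p -> normal q ->
  supported (fun w => [&& normal w, marks w == marks q, deg w == deg p + deg q,
     wexc w == wexc q & ~~ no_R_head w])%N (pre K p q).
Proof.
move=> Gp nq; apply: pre_homog_aux => // q1 q' e; apply: star_homog => //.
by apply: (@legal_in_R _ _ _ q'); rewrite -e.
Qed.

(** On a word with a symbol at its head this is the associativity of star;
    otherwise nothing has to be merged. *)
Lemma tauPM p q u : legal p -> legal q ->
  tauP p (tauP q u) = ext (fun z => tauP z u) (star K p q).
Proof.
move=> Gp Gq.
apply: (eq_on_basis (f := fun u => tauP p (tauP q u))
  (g := fun u => ext (fun z => tauP z u) (star K p q))).
- by apply: linear_comp; exact: linear_lin.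
- by apply: linear_ext => z; exact: linear_lin.
move=> w; have [nw|nw] := boolP (normal w); last first.
  rewrite tauP_not_normal // linear0.
  by rewrite (eq_ext (g := fun=> 0)) ?ext0 // => z; rewrite tauP_not_normal.
rewrite (eq_ext (g := (@pre K d Y)^~ w)); last by move=> z; rewrite tauP_bas.
rewrite pre_star; last first.
  move=> r1 r' e; apply: star_assoc => //; apply: (@legal_in_R _ _ _ r').
  by rewrite -e.
rewrite (tauP_bas _ nw); apply: (eq_supported (P := @normal d Y)).
  by move=> t nt; rewrite nt.
by apply: supportedW (pre_homog Gq nw) => v /andP[].
Qed.

(** The vector space on the words as a representation. Acting on the empty
    word recovers each normal word, so it is the regular one. *)
Definition fock : rep F := Rep lamC tauPM.

End PreLie.
End Action.

(** * The associative product *)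

Section MkLin.
Variables (K : fieldType) (V V' : lmodType K) (f : V -> V') (fL : linear f).
Definition mklin : {linear V -> V'} :=
  HB.pack f (GRing.isLinear.Build K V V' *:%R f fL).
Lemma mklinE x : mklin x = f x. Proof. by []. Qed.
End MkLin.

Section Product.
Variables (K : fieldType) (d : Order.disp_t) (Y : orderType d).
Variable cc : Y -> Y -> {free K[Y]}.
Hypothesis ccP : forall a b c,
  ext (cc^~ c) (cc a b - cc b a) = ext (cc a) (cc b c) - ext (cc b) (cc a c).
Local Notation Z := (plus Y).
Local Notation W := (word Z).
Local Notation F := {free K[W]}.
Local Notation br := (@br K d Y cc).
Local Notation mono := (mono br).
Local Notation rep := (@rep K d Y cc).
Local Notation lam := (lam cc).
Local Notation tauP := (@tauP K d Y).
Local Notation fock := (fock ccP).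
Implicit Types (s t : seq Z) (w p q : W).

Lemma fock_tau z x : tau fock z x = tauP z x. Proof. by []. Qed.

Lemma mono_linear (V : lmodType K) (rho : Z -> {linear V -> V}) s :
  linear (fun v => mono rho v s).
Proof.
have [n] := ubnP (size s); elim: n s => // n IH [|a s] //= sn c u v.
rewrite !mono_cons IH // linearP.
rewrite (eq_dersum _ (g := fun t => c *: mono rho u t + mono rho v t)).
  by rewrite dersumD dersumZ scalerBr; zmodule.
by move=> t st; rewrite IH // st.
Qed.

Section Orbit.
Variables (V : lmodType K) (r : rep V).
Implicit Types v : V.

Lemma ract_linear w : linear (fun v => ract r v w).
Proof.
elim/word_ind: w => [//|s w nw s0 IH|z w IH] c u v.
  by rewrite /ract !act_run // -!/(ract _ _ _) IH mono_linear.
by rewrite /ract !act_R -!/(ract _ _ _) IH linearP.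
Qed.

Lemma ract_R v z w : ract r v (Rsym z :: w) = tau r z (ract r v w).
Proof. by []. Qed.

Lemma ract_run v s w : no_letter_head w ->
  ract r v (run s ++ w) = mono (rho r) (ract r v w) s.
Proof. exact: act_run. Qed.

Lemma ract_cat v w1 w2 : no_letter_head w2 ->
  ract r v (w1 ++ w2) = ract r (ract r v w2) w1.
Proof. exact: act_cat. Qed.

Definition extact v : {linear F -> V} :=
  ext (fun w => if normal w then ract r v w else 0).

Lemma extact_bas v w : normal w -> extact v (bas w) = ract r v w.
Proof. by move=> nw; rewrite /extact /= ext_bas nw. Qed.

Lemma extact_not_normal v w : ~~ normal w -> extact v (bas w) = 0.
Proof. by move=> /negbTE nw; rewrite /extact /= ext_bas nw. Qed.

Lemma extact_linear x : linear (extact^~ x).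
Proof.
apply: linear_ext => w; case: (normal w); first exact: ract_linear.
by move=> c u v; rewrite scaler0 addr0.
Qed.

Lemma extact_mu v u t : no_letter_head u -> normal u ->
  extact v (mu K u t) = mono (rho r) (ract r v u) t.
Proof.
move=> nu ou; rewrite /mu extact_bas; last first.
  by rewrite normal_run // ou andbT; apply: sort_sorted; exact: le_total.
rewrite ract_run //; apply: (mono_perm (brP ccP) (rhoC r)).
by rewrite perm_sort.
Qed.

(** Acting by the letter a and then by a monomial is how the action of the
    product monomial was defined, so lam corresponds to rho. *)
Lemma extact_lam v a x : extact v (lam a x) = rho r a (extact v x).
Proof.
apply: (eq_on_basis (f := fun x => extact v (lam a x))
  (g := fun x => rho r a (extact v x))).
- by apply: linear_comp; exact: linear_lin.
- by apply: linear_comp; exact: linear_lin.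
move=> w; have [nw|nw] := boolP (normal w); last first.
  by rewrite lam_not_normal // extact_not_normal // !linear0.
have [nu ou <-] := normal_parts K nw.
rewrite lam_mu // linearD /= dersum_lin !extact_mu // mono_cons.
rewrite (eq_dersum _ (g := mono (rho r) (ract r v (rest w)))); first by zmodule.
by move=> t _; rewrite extact_mu.
Qed.

Lemma extact_tau v p x : legal p -> extact v (tauP p x) = tau r p (extact v x).
Proof.
move=> Gp; apply: (eq_on_basis (f := fun x => extact v (tauP p x))
  (g := fun x => tau r p (extact v x))).
- by apply: linear_comp; exact: linear_lin.
- by apply: linear_comp; exact: linear_lin.
move=> w; have [nw|nw] := boolP (normal w); last first.
  by rewrite tauP_not_normal // extact_not_normal // !linear0.
rewrite tauP_bas // extact_bas //.
have [hw|] := boolP (no_R_head w).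
  by rewrite pre_bas // extact_bas // normal_R Gp hw.
case: w nw => [|[c|q] w] // nw _; rewrite pre_R ext_lin ract_R.
have Gq := legal_in_R nw; move: nw; rewrite normal_R => /and3P [_ hw nw].
rewrite tauM //; apply: (eq_supported _ (star_homog K Gp Gq)) => z /andP [Gz _].
by rewrite extact_bas // normal_R Gz hw.
Qed.

(** The map from F to V given by the action on v intertwines the two
    representations. *)
Lemma extact_ract v y w : all (@okS d Y) w ->
  extact v (ract fock y w) = ract r (extact v y) w.
Proof.
move=> ow; apply: act_lin => [a u|z u zw]; first exact: extact_lam.
by apply: extact_tau; move/allP: ow => /(_ _ zw).
Qed.

End Orbit.

(** A non-normal word on the left multiplies by zero. *)
Definition fmul (x y : F) : F := extact fock y x.

(** The product is made so that words act as they multiply; associativity is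
    the special case of the representation on F itself. *)
Lemma extact_fmul (V : lmodType K) (r : rep V) v x y :
  extact r v (fmul x y) = extact r (extact r v y) x.
Proof.
rewrite /fmul; apply: (eq_on_basis (f := fun x => extact r v (extact fock y x))
  (g := extact r (extact r v y))).
- by apply: linear_comp; exact: linear_lin.
- exact: linear_lin.
move=> w; have [nw|nw] := boolP (normal w); last first.
  by rewrite !extact_not_normal // linear0.
by rewrite !extact_bas // extact_ract //; case/andP: nw.
Qed.

Lemma fmulA : associative fmul.
Proof. by move=> x y z; rewrite {1}/fmul -extact_fmul. Qed.

Lemma fmul_bilinear : bilinear_op fmul.
Proof. by split=> [y c x x'|x c y y']; [exact: linearP|exact: extact_linear]. Qed.

Lemma fmul_bas w x : normal w -> fmul (bas w) x = ract fock x w.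
Proof. by move=> nw; rewrite /fmul extact_bas. Qed.

Lemma fmul_lam a x y : fmul (lam a x) y = lam a (fmul x y).
Proof. exact: extact_lam. Qed.

Lemma fmul_tau z x y : legal z -> fmul (tauP z x) y = tauP z (fmul x y).
Proof. exact: extact_tau. Qed.

Lemma fmul1x x : fmul (bas [::]) x = x.
Proof. by rewrite fmul_bas. Qed.

Lemma mono_mu u s : no_letter_head u -> normal u -> mono lam (bas u) s = mu K u s.
Proof.
move=> nu ou; have {1}-> : bas u = mu K u [::] by rewrite mu_sorted.
by apply: (mono_unique (f := mu K u)) => a t; exact: lam_mu.
Qed.

(** The action of a word only has to straighten the junction of the two words,
    and here the junction is normal already. *)
Lemma ract_concat w w0 : normal (w ++ w0) ->
  no_letter_head w0 || no_letter_head (rev w) ->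
  ract fock (bas w0) w = bas (w ++ w0).
Proof.
elim/word_ind: w => [//|s w nw s0 IH|z w IH].
  rewrite -catA rev_cat => nsw hw.
  have hw0 : no_letter_head w0 || no_letter_head (rev w).
    by case: (rev w) hw => [|x l] //; rewrite orbT.
  have nw0 : no_letter_head (w ++ w0).
    case: w nw hw {hw0 nsw IH} => [|[]] //= _ /orP[//|].
    by case/lastP: s s0 => // s c _; rewrite /run map_rcons rev_rcons.
  have [_ nww] := normal_cat nsw.
  rewrite ract_run // IH // -/(bas _) mono_mu // mu_sorted //.
  by move: nsw; rewrite normal_run // => /andP[].
rewrite cat_cons normal_R rev_cons => /and3P [Gz hw nw] h.
rewrite ract_R IH //; first by rewrite fock_tau tauP_bas // pre_bas.
by case: (rev w) h => [|[]] //; rewrite orbT.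
Qed.

Lemma fmul_concat w w0 : normal (w ++ w0) ->
  no_letter_head w0 || no_letter_head (rev w) ->
  fmul (bas w) (bas w0) = bas (w ++ w0).
Proof.
by move=> n h; rewrite fmul_bas; [exact: ract_concat | case: (normal_cat n)].
Qed.

Lemma fmulx1 x : supported (@normal d Y) x -> fmul x (bas [::]) = x.
Proof.
move=> sx; rewrite -[RHS](ext_id x) -[x in LHS]ext_id /fmul ext_lin.
apply: (eq_supported _ sx) => w nw.
by rewrite -/(fmul _ _) fmul_concat ?cats0.
Qed.

Lemma app_fmul p q : normal p -> legal q -> fmul (bas p) (bas [:: Rsym q]) = app K p q.
Proof.
move=> np Gq.
have [hp|] := boolP (no_R_head (rev p)).
  by rewrite app_bas // fmul_concat ?cats1 // normal_rcons_R hp np.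
case/lastP: p np => [|p [c|p1]] // np; rewrite ?rev_rcons // => _.
have Gp1 := legal_in_rcons np.
rewrite app_R fmul_bas // -cats1 ract_cat // ract_R fock_tau tauP_bas //; last first.
  by rewrite normal_R Gq.
rewrite pre_R -[LHS]/(mklin (ract_linear fock p) _) ext_lin.
apply: (eq_supported _ (star_homog K Gp1 Gq)) => z /andP [Gz _].
rewrite mklinE ract_concat ?cats1 //.
by move: np; rewrite !normal_rcons_R Gz => /and3P [-> -> _].
Qed.

End Product.

(** * The derivation *)

Section Derivation.
Variables (K : fieldType) (d : Order.disp_t) (Y : orderType d).
Variable cc : Y -> Y -> {free K[Y]}.
Hypothesis ccP : forall a b c,
  ext (cc^~ c) (cc a b - cc b a) = ext (cc a) (cc b c) - ext (cc b) (cc a c).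
Local Notation Z := (plus Y).
Local Notation W := (word Z).
Local Notation F := {free K[W]}.
Local Notation br := (@br K d Y cc).
Local Notation mono := (mono br).
Local Notation rep := (@rep K d Y cc).
Local Notation lam := (lam cc).
Local Notation tauP := (@tauP K d Y).
Local Notation fmul := (fmul ccP).
Implicit Types (s t : seq Z) (w p q : W).

(** The values of the derivation on letters: y' goes to y, and y to zero. *)
Definition mark (a : Z) : {free K[Z]} := if a.2 then bas (unprimed a.1) else 0.

Definition lamd (a : Z) (x : F) : F := ext (fun z => lam z x) (mark a).

Lemma lamd_linear a : linear (lamd a).
Proof. by apply: linear_ext => z; exact: linear_lin. Qed.

Lemma lamdE y e x : lamd (y, e) x = if e then lam (unprimed y) x else 0.
Proof. by rewrite /lamd /mark; case: e; rewrite ?ext_bas ?linear0. Qed.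

Lemma ext_tagY (V : lmodType K) (f : Z -> V) e x :
  ext f (tagY e x) = ext (fun y => f (y, e)) x.
Proof. by rewrite /tagY ext_ext; apply: eq_ext => y; rewrite ext_bas. Qed.

Lemma lamdC a b u :
  (lamd a (lam b u) - lam b (lamd a u)) + (lam a (lamd b u) - lamd b (lam a u)) =
  ext (fun z => lamd z u) (br a b - br b a).
Proof.
have b0 y z : br (y, false) z = 0 by [].
have b1 y z e : br (y, true) (z, e) = tagY e (cc y z) by [].
have lE y z e : ext (fun z => lam z u) (br (y, true) (z, e)) =
  ext (fun z => lam (z, e) u) (cc y z) by rewrite b1 ext_tagY.
have dE y z : ext (fun z => lamd z u) (br (y, true) (z, true)) =
  ext (fun z => lam (unprimed z) u) (cc y z).
  by rewrite b1 ext_tagY; apply: eq_ext => t; rewrite lamdE.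
have dE0 y z : ext (fun z => lamd z u) (br (y, true) (z, false)) = 0.
  by rewrite b1 ext_tagY -[RHS](ext0 _ (cc y z)); apply: eq_ext => t; rewrite lamdE.
have LB (f : Z -> F) x y : ext f (x - y) = ext f x - ext f y by exact: linearB.
have L0 (f : Z -> F) : ext f 0 = 0 by exact: linear0.
case: a b => [a []] [b []]; rewrite !lamdE /unprimed.
- by rewrite !lamC // !LB !dE !b0 !lE !L0; zmodule.
- by rewrite lamC // !LB dE0 !b0 !L0 !linear0; zmodule.
- by rewrite lamC // !LB dE0 !b0 !L0 !linear0; zmodule.
by rewrite !LB !b0 !L0 !linear0; zmodule.
Qed.

Lemma fst_linear : linear (fst : F * F -> F). Proof. by []. Qed.
Lemma snd_linear : linear (snd : F * F -> F). Proof. by []. Qed.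

Definition drho0 (a : Z) (x : F * F) : F * F := (lam a x.1, lamd a x.1 + lam a x.2).
Lemma drho_linear a : linear (drho0 a).
Proof.
move=> c u v; rewrite /drho0 /= !linearP lamd_linear; congr (_, _) => /=.
by rewrite scalerDr; zmodule.
Qed.
Definition drho a := mklin (drho_linear a).

Lemma drhoC a b u :
  drho a (drho b u) - drho b (drho a u) = ext (fun z => drho z u) (br a b - br b a).
Proof.
have E : ext (fun z => drho z u) (br a b - br b a) =
  (ext (fun z => lam z u.1) (br a b - br b a),
   ext (fun z => lamd z u.1) (br a b - br b a) + ext (fun z => lam z u.2) (br a b - br b a)).
  rewrite [LHS]surjective_pairing; congr (_, _).
    exact: (ext_lin (mklin fst_linear)).
  by rewrite -extD; exact: (ext_lin (mklin snd_linear)).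
rewrite E -!lamC // -lamdC; congr (_, _) => /=.
by rewrite !linearD /=; zmodule.
Qed.

Lemma fmulDl x y z : fmul (x + y) z = fmul x z + fmul y z.
Proof. exact: bil_addl (fmul_bilinear ccP) _ _ _. Qed.
Lemma fmulDr x y z : fmul x (y + z) = fmul x y + fmul x z.
Proof. exact: bil_addr (fmul_bilinear ccP) _ _ _. Qed.
Definition dtau0 z (x : F * F) : F * F := (tauP z x.1, fmul (bas z) x.1 + tauP z x.2).
Lemma fmul_linearr x : linear (fmul x).
Proof. by move=> c y z; rewrite (fmul_bilinear ccP).2. Qed.
Lemma fmul_linearl y : linear (fmul^~ y).
Proof. by move=> c x z; rewrite (fmul_bilinear ccP).1. Qed.
Lemma dtau_linear z : linear (dtau0 z).
Proof.
move=> c u v; rewrite /dtau0 /= !linearP fmul_linearr; congr (_, _) => /=.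
by rewrite scalerDr; zmodule.
Qed.
Definition dtau z := mklin (dtau_linear z).

Lemma ext_fmul (x u : F) : ext (fun z => fmul (bas z) u) x = fmul x u.
Proof.
rewrite -[in RHS](ext_id x) -[RHS]/(mklin (fmul_linearl u) _) ext_lin.
exact: eq_ext.
Qed.

Lemma fmul_R q x : legal q -> fmul (bas [:: Rsym q]) x = tauP q x.
Proof. by move=> Gq; rewrite fmul_bas // normal_R Gq. Qed.

(** By its definition star is the sum of the two products R(p)q and pR(q) in
    F. *)
Lemma fmul_star p q u : legal p -> legal q ->
  fmul (star K p q) u = fmul (bas p) (tauP q u) + tauP p (fmul (bas q) u).
Proof.
move=> Gp Gq; rewrite starE -(app_fmul ccP (legal_normal Gp) Gq) addrC.
rewrite fmulDl -fmulA fmul_R //.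
by rewrite -(tauP_bas _ _ (legal_normal Gq)) fmul_tau.
Qed.

(** In the e-component this says that star is the product of symbols with the
    outer R removed, which is fmul_star. *)
Lemma dtauM p q u : legal p -> legal q ->
  dtau p (dtau q u) = ext (fun z => dtau z u) (star K p q).
Proof.
move=> Gp Gq.
have -> : ext (fun z => dtau z u) (star K p q) =
  (ext (fun z => tauP z u.1) (star K p q),
   ext (fun z => fmul (bas z) u.1) (star K p q) + ext (fun z => tauP z u.2) (star K p q)).
  rewrite [LHS]surjective_pairing; congr (_, _).
    exact: (ext_lin (mklin fst_linear)).
  by rewrite -extD; exact: (ext_lin (mklin snd_linear)).
rewrite -!tauPM // ext_fmul fmul_star //; congr (_, _) => /=.
by rewrite linearD /=; zmodule.
Qed.

(** A derivation is an algebra homomorphism into the dual numbers. So the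
    derivation is read off from the action on F + eF in which a letter a acts
    as a + e(mark a), and R(z) as R(z) + ez. *)
Definition dual : rep (F * F)%type := Rep drhoC dtauM.

Definition der (x : F) : F := (extact dual (bas [::], 0) x).2.

Lemma der_linear : linear der.
Proof. by move=> c x y; rewrite /der linearP. Qed.

Lemma extact_dual1 u x : (extact dual u x).1 = fmul x u.1.
Proof.
apply: (eq_on_basis (f := fun x => (extact dual u x).1) (g := fmul^~ u.1)).
- by move=> c y z; rewrite linearP.
- exact: fmul_linearl.
move=> w; have [nw|nw] := boolP (normal w); last first.
  by rewrite /fmul !extact_not_normal.
rewrite extact_bas // fmul_bas //.
exact: (act_lin _ (F := mklin fst_linear)).
Qed.

Lemma extact_dual2 u x : supported (@normal d Y) x ->
  (extact dual u x).2 = fmul (der x) u.1 + fmul x u.2.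
Proof.
move=> sx.
pose f (a : F * F) := (fmul a.1 u.1, fmul a.2 u.1 + fmul a.1 u.2).
have fL : linear f.
  move=> c a b; rewrite /f /= !fmul_linearl; congr (_, _) => /=.
  by rewrite scalerDr; zmodule.
have fr a v : f (drho a v) = drho a (f v).
  congr (_, _) => /=; rewrite ?fmul_lam // fmulDl fmul_lam.
  rewrite (linearD (lam a)) /= -!addrA; congr (_ + _).
  by rewrite /lamd -[LHS]/(mklin (fmul_linearl u.1) _) ext_lin; apply: eq_ext => z; exact: fmul_lam.
have ft z v : legal z -> f (dtau z v) = dtau z (f v).
  move=> Gz; congr (_, _) => /=; rewrite ?fmul_tau // fmulDl fmul_tau //.
  by rewrite (linearD (tauP z)) /= -fmulA -!addrA.
have f1 : f (bas [::], 0) = u.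
  rewrite /f /= !fmul1x (_ : fmul 0 _ = 0) ?add0r; first by case: (u).
  exact: bil_0l (fmul_bilinear ccP) _.
have fE w : normal w -> ract dual u w = f (ract dual (bas [::], 0) w).
  move=> nw; rewrite -{1}f1 /ract; symmetry; apply: (act_lin _ (F := mklin fL)) => [a v|z v zw].
    exact: fr.
  by apply: ft; case/andP: nw => _ /allP /(_ _ zw).
have -> : extact dual u x = f (extact dual (bas [::], 0) x).
  rewrite -(ext_id x) !ext_lin -[RHS]/(mklin fL _) ext_lin.
  by apply: (eq_supported _ sx) => w nw; rewrite !extact_bas // fE.
by rewrite /f /= extact_dual1 /= fmulx1.
Qed.

Lemma der_fmul x y : supported (@normal d Y) x -> supported (@normal d Y) y ->
  der (fmul x y) = fmul (der x) y + fmul x (der y).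
Proof.
by move=> sx sy; rewrite /der extact_fmul extact_dual2 // extact_dual1 /= fmulx1.
Qed.

Lemma der1 : der (bas [::]) = 0.
Proof. by rewrite /der extact_bas. Qed.

Lemma der_R z : legal z -> der (bas [:: Rsym z]) = bas z.
Proof.
move=> Gz; have nz := legal_normal Gz.
rewrite /der extact_bas ?normal_R ?Gz // ract_R /= fmulx1; last exact: supported_bas.
by rewrite linear0 addr0.
Qed.

(** Removing the prime of a letter commutes with the pre-Lie action of a fixed
    letter. *)
Lemma mark_br a (f : seq Z -> F) s :
  dersum mark (dersum (br a) f) s = dersum (br a) (dersum mark f) s.
Proof.
apply/eqP; rewrite -subr_eq0 dersumC; apply/eqP/dersum_zero => c _.
rewrite /mark /br; case: a c => [a []] [c []] /=; rewrite ?ext_bas ?linear0 ?subr0 //.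
- rewrite /br /= ext_tagY /tagY /=; rewrite [X in _ - X](eq_ext (g := fun y => bas (y, false))) ?subrr //.
- by rewrite ext_tagY ext0 subr0.
- by rewrite addr0.
by rewrite addr0.
Qed.

(** Leibniz rule on a monomial. *)
Lemma mono_dual (u v : F) s :
  mono (drho : Z -> (F * F) -> (F * F)) (u, v) s =
  (mono lam u s, mono lam v s + dersum mark (mono lam u) s).
Proof.
pose M := mono lam u; pose N := mono lam v.
have -> : (u, v) = (M [::], N [::] + dersum mark M [::]) by rewrite /= addr0.
apply: (mono_unique (f := fun s => (M s, N s + dersum mark M s))) => a t.
have M1 t' : lam a (M t') = M (a :: t') + dersum (br a) M t'.
  by rewrite /M mono_cons; zmodule.
have N1 t' : lam a (N t') = N (a :: t') + dersum (br a) N t'.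
  by rewrite /N mono_cons; zmodule.
rewrite [in RHS]/=.
have -> : dersum (br a) (fun s => (M s, N s + dersum mark M s)) t =
   (dersum (br a) M t, dersum (br a) N t + dersum (br a) (dersum mark M) t).
  rewrite [LHS]surjective_pairing; congr (_, _).
    exact: (dersum_lin (mklin fst_linear)).
  by rewrite -dersumD; exact: (dersum_lin (mklin snd_linear)).
congr (_, _) => /=; first exact: M1.
rewrite linearD /= N1 dersum_lin.
rewrite [X in _ + (_ + X) = _](eq_dersum _ (g := fun t' => M (a :: t') + dersum (br a) M t')); last by move=> t' _; exact: M1.
rewrite dersumD mark_br.
have -> : lamd a (M t) = ext (fun z => M (z :: t)) (mark a).
  rewrite /lamd /mark; case: a {M1 N1} => [a []]; last by rewrite !linear0.
  by rewrite /= !ext_bas /M mono_cons dersum_zero // subr0.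
zmodule.
Qed.

Lemma der_run s : sorted <=%O s -> der (bas (run s)) = dersum mark (mu K [::]) s.
Proof.
move=> ss; have ns : normal (run s) by rewrite -[run s]cats0 normal_run // ss.
rewrite /der extact_bas // -[run s]cats0 ract_run // [ract _ _ _]/= mono_dual /=.
rewrite -[mono lam 0 s]/(mklin (mono_linear cc lam s) 0) linear0 add0r.
by apply: eq_dersum => t _; exact: mono_mu.
Qed.

End Derivation.

(** * Exceptional words and unmarked words *)

Section Shapes.
Variables (d : Order.disp_t) (Y : orderType d).
Local Notation Z := (plus Y).
Local Notation W := (word Z).
Implicit Types (s t u v : seq Z) (w r X e : W).

Local Notation has_letter := (has (@is_letter d Y)).

Lemma firstrun_cat_R l z m : firstrun (l ++ Rsym z :: m : W) = firstrun l.
Proof. by elim: l => [|[c|y] l IH] //=; rewrite IH. Qed.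

Lemma lastrun_cat w r : no_letter_head r -> has_letter r ->
  lastrun (w ++ r) = lastrun r.
Proof.
case: r => [|[c|z] r] // _ /= hr.
rewrite /lastrun rev_cat rev_cons -!cats1 -catA.
have : has_letter (rev r) by rewrite has_rev.
by case: (rev r) => [|[c|y] l] //= _; rewrite !firstrun_cat_R.
Qed.

Lemma rev_run s : rev (run s) = run (rev s).
Proof. by rewrite /run map_rev. Qed.

Lemma firstrun_run0 s : firstrun (run s) = s.
Proof. by rewrite -[run s]cats0 firstrun_run. Qed.

Lemma lastrun_run s o : lastrun (run s ++ optR o) = rev s.
Proof.
rewrite /lastrun rev_cat rev_run; case: o => [q|] /=.
  by rewrite firstrun_run0.
case E: (run (rev s)) => [|[c|z] l]; first by case: (rev s) E.
  by rewrite -E firstrun_run0.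
by case: (rev s) E.
Qed.

(** A run appended to X starts a new run. *)
Definition closed_end X := no_letter_head (rev X).

Lemma lastrun_closed X s o : s != [::] -> closed_end X ->
  lastrun (X ++ run s ++ optR o) = rev s.
Proof.
case/lastP: X => [|X [c|z]] s0; rewrite /closed_end ?rev_rcons //.
  by rewrite lastrun_run.
move=> _; rewrite cat_rcons lastrun_cat ?lastrun_R ?lastrun_run //=.
by rewrite has_cat; case: s s0.
Qed.

Lemma no_letter_tail r : normal r -> ~~ has_letter r -> exists o, r = optR o.
Proof.
case: r => [|[c|z] [|[c'|z'] r]] //=; first by exists None.
by exists (Some z).
Qed.

(** The last run, what precedes it, and the symbol that may follow it. *)
Lemma letter_decomp w : normal w -> has_letter w ->
  exists X s o, [/\ w = X ++ run s ++ optR o, s != [::] & closed_end X].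
Proof.
elim/word_ind: w => [//|s w nw s0 IH|z w IH].
  move=> n hw; have [_ nw'] := normal_cat n.
  have [/(IH nw') [X [s' [o [e s'0 cX]]]]|hn] := boolP (has_letter w).
    exists (run s ++ X), s', o; split=> //; first by rewrite e catA.
    rewrite /closed_end rev_cat; case: X cX e nw => [|x X] cX e nw.
      by move: nw; rewrite e; case: (s') s'0.
    by move: cX; rewrite /closed_end rev_cons; case: (rev X).
  have [o ->] := no_letter_tail nw' hn.
  by exists [::], s, o.
rewrite normal_R /= => /and3P [Gz hw nw] /(IH nw) [X [s [o [e s0 cX]]]].
exists (Rsym z :: X), s, o; split=> //; first by rewrite e.
by move: cX; rewrite /closed_end rev_cons; case: (rev X) => [|[]].
Qed.

Lemma normal_closed_cat X w : closed_end X -> no_R_head w ->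
  normal (X ++ w) = normal X && normal w.
Proof.
rewrite /normal all_cat; case/lastP: X => [|X [c|z]]; rewrite /closed_end ?rev_rcons //.
move=> _ hw; rewrite andbACA; congr (_ && _).
case: X => [|x X]; first by case: w hw => [|[c|z'] w].
rewrite rcons_cons /= cat_path last_rcons; congr (_ && _).
by case: w hw => [|[]].
Qed.

Lemma rexc_primed s : all (@inY' d Y) s -> ~~ rexc s.
Proof.
move=> /allP H; apply/hasPn => c /H; rewrite /inY' /inY => ->.
by [].
Qed.

(** Further primed letters can only raise the maximum. *)
Lemma rexc_add s v : all (@inY' d Y) v -> rexc (s ++ v) -> rexc s.
Proof.
move=> /allP H /hasP [c]; rewrite mem_cat => /orP [cs|/H].
  move=> /andP [ic]; rewrite all_cat => /andP [a _].
  by apply/hasP; exists c; rewrite // ic.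
by rewrite /inY' /inY => ->.
Qed.

Lemma marks0_primed s : (sumn (map (@mk d Y) s) == 0)%N = all (@inY' d Y) s.
Proof.
elim: s => //= c s IH; rewrite addn_eq0 IH /mk /inY /inY'.
by case: (c.2).
Qed.

Lemma marks_optR (o : option W) : marks (optR o) = 0%N.
Proof. by case: o. Qed.

Lemma plus_le (y z : Y) (a b : bool) :
  ((y, a) <= (z, b) :> Z)%O = (y < z)%O || (y == z) && (a ==> b).
Proof. by rewrite lexi_pair le_eqVlt; case: (ltgtP y z); case: a; case: b. Qed.

Lemma plus_lt (y z : Y) (a b : bool) :
  ((y, a) < (z, b) :> Z)%O = (y < z)%O || (y == z) && (~~ a && b).
Proof. by rewrite ltxi_pair le_eqVlt; case: (ltgtP y z); case: a; case: b. Qed.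

Lemma sorted_cat_le s t : sorted <=%O (s ++ t) =
  [&& allrel <=%O s t, sorted <=%O s & sorted <=%O t].
Proof. by rewrite !(sorted_pairwise le_trans) pairwise_cat. Qed.

Lemma primed_decomp v : v != [::] -> sorted <=%O v -> all (@inY' d Y) v ->
  exists u y k, [/\ v = u ++ nseq k.+1 (primed y) & all (fun c => c < unprimed y)%O u].
Proof.
elim/last_ind: v => // v c IH _; rewrite -cats1 sorted_cat_le all_cat /= !andbT.
move=> /andP [/allrelP vc sv] /andP [pv pc].
case: c pc vc => [z []] // _ vc.
case: (altP (v =P [::])) => [->|v0]; first by exists [::], z, 0%N.
have [u [y [k [ev lu]]]] := IH v0 sv pv.
have : (primed y <= (z, true) :> Z)%O.
  by apply: vc; rewrite ?mem_head // ev mem_cat mem_nseq eqxx orbT.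
rewrite plus_le implybT andbT => /orP [yz|/eqP yz]; last first.
  exists u, y, k.+1; split=> //; rewrite ev -yz -catA; congr (u ++ _).
  by rewrite -/(primed y); elim: (k.+1) => //= n ->.
exists v, z, 0%N; split=> //; apply/allP => c; rewrite ev mem_cat => /orP [cu|].
  apply: lt_trans (allP lu _ cu) _; by rewrite plus_lt yz.
by rewrite mem_nseq => /andP [_ /eqP ->]; rewrite plus_lt yz.
Qed.

(** The unprimed letter y is followed by its own primed copies only, since
    these are the only letters after y that are not greater up to primes. *)
Lemma rexc_decomp s : sorted <=%O s -> sumn (map (@mk d Y) s) = 1%N -> rexc s ->
  exists u y k, [/\ s = u ++ unprimed y :: nseq k (primed y),
     all (@inY' d Y) u & all (fun c => c < unprimed y)%O u].
Proof.
move=> ss ms /hasP [[y b] ys /andP [iy /allP al]].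
case: b iy ys al => // _ ys al; case/splitPr: ys ss ms al => l r ss ms al.
move: ms; rewrite map_cat sumn_cat /= {2}/mk /= => ms.
have ml : (sumn (map (@mk d Y) l) == 0)%N by apply/eqP; lia.
have mr : (sumn (map (@mk d Y) r) == 0)%N by apply/eqP; lia.
rewrite !marks0_primed in ml mr.
move: ss; rewrite -cat1s catA sorted_cat_le sorted_cat_le allrel_catl.
move=> /and3P [/andP [_ /allrelP yr] /andP [/allrelP ly _] _].
exists l, y, (size r); split=> //; last first.
  apply/allP => c cl; rewrite lt_neqAle ly ?mem_head // andbT.
  by apply: contraTneq (allP ml _ cl) => ->.
suff er : r = nseq (size r) (primed y) by rewrite -er -catA.
apply/all_pred1P/allP => -[z b] zr.
have := allP mr _ zr; case: b zr => // zr _.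
have := al (z, true); rewrite mem_cat inE zr !orbT plus_le => /(_ isT).
have := yr _ _ (mem_head _ _) zr; rewrite !plus_le /=.
by case: (ltgtP y z) => //= ->; rewrite eqxx.
Qed.

Lemma rexc_mark u y k : all (@inY' d Y) u -> all (fun c => c < unprimed y)%O u ->
  rexc (u ++ unprimed y :: nseq k (primed y)).
Proof.
move=> pu /allP lu; apply/hasP; exists (unprimed y); rewrite ?mem_cat ?mem_head ?orbT //.
rewrite all_cat /= /primed plus_le eqxx orbT /=; apply/andP; split.
  apply/allP => c /lu cy; apply: ltW; apply: lt_trans cy _.
  by rewrite plus_lt eqxx orbT.
by apply/allP => c; rewrite mem_nseq => /andP [_ /eqP ->].
Qed.

(** Removing the prime below the greatest letter leaves a primed letter as the
    maximum. *)
Lemma not_rexc_mark (u v : seq Z) y k z : sumn (map (@mk d Y) (u ++ v)) = 0%N ->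
  (z < y)%O -> ~~ rexc (u ++ unprimed z :: v ++ nseq k.+1 (primed y)).
Proof.
move=> muv zy; apply/hasPn => c; rewrite mem_cat inE mem_cat => ci.
have /allP puv : all (@inY' d Y) (u ++ v) by rewrite -marks0_primed muv.
apply/negP => /andP [ic /allP al].
have cz : c = unprimed z.
  case/or4P: ci => [cu|/eqP //|cv|].
  - by have := puv c; rewrite mem_cat cu /inY' => /(_ isT) pc; move: ic; rewrite /inY pc.
  - by have := puv c; rewrite mem_cat cv orbT /inY' => /(_ isT) pc; move: ic; rewrite /inY pc.
  by rewrite mem_nseq => /andP [_ /eqP ec]; move: ic; rewrite ec.
have := al (primed y); rewrite cz mem_cat inE mem_cat mem_nseq eqxx !orbT => /(_ isT).
by rewrite plus_le ltNge (ltW zy) /= gt_eqF.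
Qed.

Lemma sorted_marked u y k b : sorted <=%O u -> all (fun c => c < unprimed y)%O u ->
  sorted <=%O (u ++ (y, b) :: nseq k (primed y)).
Proof.
move=> su /allP lu; rewrite sorted_cat_le su; apply/and3P; split=> //.
  apply/allrelP => c c' /lu cy; rewrite inE => /orP [/eqP ->|].
    by apply: le_trans (ltW cy) _; rewrite plus_le eqxx orbT.
  rewrite mem_nseq => /andP [_ /eqP ->].
  by apply: le_trans (ltW cy) _; rewrite plus_le eqxx orbT.
case: k => // k /=; rewrite plus_le eqxx implybT /= orbT.
by elim: k => //= k ->; rewrite lexx.
Qed.

(** With good_form, the shape of the exceptional marked words; unform is the
    shape of the unmarked words with a letter. The two are in bijection,
    through the greatest letter of the last run, which loses or gains its
    prime. *)
Definition exform X u y k o : W :=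
  X ++ run (u ++ unprimed y :: nseq k (primed y)) ++ optR o.
Definition unform X u y k o : W :=
  X ++ run (u ++ nseq k.+1 (primed y)) ++ optR o.

(** The letters of u are smaller than y, so that y and its primed copies are
    the greatest letters of the run. *)
Definition good_form X u y (k : nat) (o : option W) : bool :=
  [&& closed_end X, normal X, marks X == 0%N, normal (optR o), sorted <=%O u,
      all (@inY' d Y) u & all (fun c => c < unprimed y)%O u].

Definition primeS (x : sym Z) : sym Z :=
  if x is Letter c then Letter (primed c.1) else x.
Definition prime_word w : W := map primeS w.

Lemma prime_word_id w : marks w = 0%N -> prime_word w = w.
Proof.
elim: w => [//|[c|z] w IH] /=.
  rewrite /marks /= => /eqP; rewrite addn_eq0 => /andP [mc /eqP mw].
  congr (_ :: _); last exact: IH.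
  by case: c mc => c [].
by move=> mw; congr (_ :: _); exact: IH.
Qed.

Lemma sumn_mk0 s : all (@inY' d Y) s -> sumn (map (@mk d Y) s) = 0%N.
Proof. by rewrite -marks0_primed => /eqP. Qed.

Lemma prime_exform X u y k o : good_form X u y k o ->
  prime_word (exform X u y k o) = unform X u y k o.
Proof.
case/and5P => _ _ /eqP mX _ /and3P [_ pu _].
rewrite /prime_word !map_cat -!/(prime_word _) (prime_word_id mX).
rewrite [prime_word (optR o)]prime_word_id ?marks_optR //; congr (_ ++ _ ++ _).
rewrite run_cat [prime_word _]map_cat -/(prime_word _) prime_word_id ?marks_run ?sumn_mk0 //.
rewrite run_cat; congr (_ ++ _) => /=; congr (_ :: _).
by rewrite -/(run _) -/(prime_word _) prime_word_id // marks_run sumn_mk0 // all_nseq orbT.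
Qed.

Lemma no_R_run s r : s != [::] -> no_R_head (run s ++ r).
Proof. by case: s. Qed.

Lemma no_letter_optR (o : option W) : no_letter_head (optR o).
Proof. by case: o. Qed.

Lemma all_primed_nseq k (y : Y) : all (@inY' d Y) (nseq k (primed y)).
Proof. by rewrite all_nseq orbT. Qed.

Lemma good_exform X u y k o : good_form X u y k o ->
  [/\ normal (exform X u y k o), marks (exform X u y k o) = 1%N &
      wexc (exform X u y k o)].
Proof.
case/and5P => cX nX /eqP mX no /and3P [su pu lu].
have s0 : u ++ unprimed y :: nseq k (primed y) != [::] by case: (u).
split.
- rewrite /exform normal_closed_cat ?no_R_run // nX normal_run ?no_letter_optR //.
  by rewrite no andbT sorted_marked.
- rewrite /exform !marks_cat marks_optR mX marks_run map_cat sumn_cat sumn_mk0 //=.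
  by rewrite sumn_mk0 ?all_primed_nseq.
by rewrite /wexc lastrun_closed // (rexc_perm (permEl (perm_rev _))) rexc_mark.
Qed.

Lemma good_unform X u y k o : good_form X u y k o ->
  [/\ normal (unform X u y k o), marks (unform X u y k o) = 0%N &
      deg (unform X u y k o) = deg (exform X u y k o)].
Proof.
case/and5P => cX nX /eqP mX no /and3P [su pu lu].
have s0 : u ++ nseq k.+1 (primed y) != [::] by case: (u).
split.
- rewrite /unform normal_closed_cat ?no_R_run // nX normal_run ?no_letter_optR //.
  by rewrite no andbT sorted_marked.
- rewrite /unform !marks_cat marks_optR mX marks_run map_cat sumn_cat sumn_mk0 //.
  by rewrite sumn_mk0 ?all_primed_nseq.
by rewrite !deg_cat !deg_run !size_cat /= size_nseq.
Qed.

Lemma exc_form e : normal e -> marks e = 1%N -> wexc e ->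
  exists X u y k o, good_form X u y k o /\ e = exform X u y k o.
Proof.
move=> ne me we.
have he : has_letter e by apply: has_letter_marks; rewrite me.
have [X [s [o [ee s0 cX]]]] := letter_decomp ne he.
move: we; rewrite ee /wexc lastrun_closed // (rexc_perm (permEl (perm_rev _))) => rs.
move: ne; rewrite ee normal_closed_cat ?no_R_run // normal_run ?no_letter_optR //.
move=> /and3P [nX ss no].
have ms0 : sumn (map (@mk d Y) s) != 0%N.
  by rewrite marks0_primed; apply: contraL rs; exact: rexc_primed.
move: me; rewrite ee !marks_cat marks_run marks_optR => me.
have ms : sumn (map (@mk d Y) s) = 1%N by lia.
have mX : marks X == 0%N by move: me; rewrite ms addn0 addn1 => -[->].
have [u [y [k [es pu lu]]]] := rexc_decomp ss ms rs.
exists X, u, y, k, o; split; last by rewrite /exform -es.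
have su : sorted <=%O u by move: ss; rewrite es sorted_cat_le => /and3P[].
by apply/and5P; split=> //; apply/and3P.
Qed.

Lemma unmarked_form (t : W) : normal t -> marks t = 0%N -> has_letter t ->
  exists X u y k o, good_form X u y k o /\ t = unform X u y k o.
Proof.
move=> nt mt ht.
have [X [s [o [et s0 cX]]]] := letter_decomp nt ht.
move: nt; rewrite et normal_closed_cat ?no_R_run // normal_run ?no_letter_optR //.
move=> /and3P [nX ss no].
move: mt; rewrite et !marks_cat marks_run marks_optR => mt.
move/eqP: mt; rewrite addn0 addn_eq0 => /andP [mX ms].
have ps : all (@inY' d Y) s by rewrite -marks0_primed.
have [u [y [k [es lu]]]] := primed_decomp s0 ss ps.
exists X, u, y, k, o; split; last by rewrite /unform -es.
have su : sorted <=%O u by move: ss; rewrite es sorted_cat_le => /and3P[].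
have pu : all (@inY' d Y) u by move: ps; rewrite es all_cat => /andP[].
by apply/and5P; split=> //; apply/and3P.
Qed.

(** Without letters to separate them, no two symbols can stand in a normal
    word. *)
Lemma no_letter_unmarked (t : W) : normal t -> t != [::] -> ~~ has_letter t ->
  exists2 z, t = [:: Rsym z] & legal z.
Proof.
move=> nt t0 ht; have [[z|] e] := no_letter_tail nt ht; last by rewrite e in t0.
by exists z => //; apply: (@legal_in_R _ _ _ [::]); rewrite -[[:: _]]/(optR (Some z)) -e.
Qed.

End Shapes.

(** * Filtration by degree *)

Lemma supported_lin (K : fieldType) (T T' : choiceType)
    (f : {free K[T]} -> {free K[T']}) (P : pred T) (Q : pred T') x :
  linear f -> (forall t, P t -> supported Q (f (bas t))) ->
  supported P x -> supported Q (f x).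
Proof.
move=> fL H sx; rewrite -(ext_id x) -[f _]/(mklin fL _) ext_lin.
exact: supported_ext sx.
Qed.

Section Filtration.
Variables (K : fieldType) (d : Order.disp_t) (Y : orderType d).
Variable cc : Y -> Y -> {free K[Y]}.
Hypothesis ccP : forall a b c,
  ext (cc^~ c) (cc a b - cc b a) = ext (cc a) (cc b c) - ext (cc b) (cc a c).
Local Notation Z := (plus Y).
Local Notation W := (word Z).
Local Notation F := {free K[W]}.
Local Notation br := (@br K d Y cc).
Local Notation mono := (mono br).
Local Notation lam := (lam cc).
Local Notation tauP := (@tauP K d Y).
Local Notation fock := (fock ccP).
Local Notation fmul := (fmul ccP).
Local Notation has_letter := (has (@is_letter d Y)).
Implicit Types (s t : seq Z) (w p q r : W) (x y : F).

(** A grading in m and a filtration in n. *)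
Definition fil m n w : bool := [&& normal w, marks w == m & deg w <= n]%N.
Definition low m n w : bool := [&& normal w, marks w == m & deg w < n]%N.
Arguments fil (m n)%_N w.
Arguments low (m n)%_N w.
Definition mrk s : nat := sumn (map (@mk d Y) s).

Lemma fil_bas w : normal w -> supported (fil (marks w) (deg w)) (bas w : F).
Proof. by move=> nw; apply: supported_bas; rewrite /fil nw eqxx leqnn. Qed.

Lemma filW m n n' x : (n <= n')%N -> supported (fil m n) x -> supported (fil m n') x.
Proof.
move=> nn'; apply: supportedW => w /and3P [nw mw dw].
by rewrite /fil nw mw (leq_trans dw).
Qed.

Lemma mu_normal r t : no_letter_head r -> normal r -> normal (run (sort <=%O t) ++ r).
Proof.
by move=> nr or; rewrite normal_run // or andbT; apply: sort_sorted; exact: le_total.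
Qed.

Lemma mrk_perm s t : perm_eq s t -> mrk s = mrk t.
Proof. by move=> st; apply: perm_sumn; apply: perm_map. Qed.

Lemma mrk_cat s t : mrk (s ++ t) = (mrk s + mrk t)%N.
Proof. by rewrite /mrk map_cat sumn_cat. Qed.

Lemma mrk_cons c s : mrk (c :: s) = (mk c + mrk s)%N.
Proof. by []. Qed.

Lemma mrk0 s : all (@inY' d Y) s -> mrk s = 0%N.
Proof. exact: sumn_mk0. Qed.

Lemma mu_marks r t : marks (run (sort <=%O t) ++ r) = (mrk t + marks r)%N.
Proof.
rewrite marks_cat marks_run; congr (_ + _)%N; apply: perm_sumn.
by apply: perm_map; rewrite perm_sort.
Qed.

Lemma mu_deg r t : deg (run (sort <=%O t) ++ r) = (size t + deg r)%N.
Proof. by rewrite deg_cat deg_run size_sort. Qed.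

Lemma mu_fil r t : no_letter_head r -> normal r ->
  supported (fil (mrk t + marks r) (size t + deg r)) (mu K r t).
Proof.
move=> nr or; have := fil_bas (mu_normal t nr or).
by rewrite mu_marks mu_deg /mu.
Qed.

Lemma dersum_mu_fil a r t : no_letter_head r -> normal r ->
  supported (fil (mk a + (mrk t + marks r)) (size t + deg r))
    (dersum (br a) (mu K r) t).
Proof.
move=> nr or.
apply: (dersum_subspace (supported_subspace _) (@mk_br _ _ _ cc a)) => t' st mt.
by rewrite -st addnA [(mk a + _)%N]addnC -[mrk t]/(sumn _) -mt; exact: mu_fil.
Qed.

Lemma lam_fil a m n x : supported (fil m n) x ->
  supported (fil (mk a + m) n.+1) (lam a x).
Proof.
apply: supported_lin; first exact: linear_lin.
move=> w /and3P [nw /eqP <- dw]; have [nr or ew] := normal_parts K nw.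
rewrite -ew lam_mu //.
have ms : marks w = (mrk (firstrun w) + marks (rest w))%N.
  by rewrite -{1}(run_split w) marks_cat marks_run.
have ds : deg w = (size (firstrun w) + deg (rest w))%N.
  by rewrite -{1}(run_split w) deg_cat deg_run.
apply: supportedD.
  have := @mu_fil _ (a :: firstrun w) nr or; rewrite /= -/(mrk _) -addnA -ms addSn -ds.
  exact: filW.
have := @dersum_mu_fil a _ (firstrun w) nr or; rewrite -ms -ds; apply: filW.
exact: leqW.
Qed.

Lemma tau_fil z m n x : legal z -> supported (fil m n) x ->
  supported (fil m (deg z + n)) (tauP z x).
Proof.
move=> Gz; apply: supported_lin; first exact: linear_lin.
move=> w /and3P [nw /eqP <- dw]; rewrite tauP_bas //.
apply: supportedW (pre_homog K Gz nw) => u /and5P [nu mu /eqP du _ _].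
by rewrite /fil nu mu du leq_add2l.
Qed.

(** The action of a word only merges letters by the bracket of C, which lowers
    the degree, or symbols, which preserves it. *)
Lemma act_fil m n x w : all (@okS d Y) w -> supported (fil m n) x ->
  supported (fil (marks w + m) (deg w + n)) (ract fock x w).
Proof.
move=> ow sx; apply: (@act_graded K d Y cc F (fun m n x => supported (fil m n) x)
  (rho fock) (tau fock)) sx => //.
- by move=> *; exact: supported_subspace.
- by move=> ? ? ?; apply: filW.
- by move=> *; exact: lam_fil.
by move=> *; exact: tau_fil.
Qed.

Lemma normal_ok w : normal w -> all (@okS d Y) w.
Proof. by case/andP. Qed.

Lemma fmul_fil m n m' n' x y : supported (fil m n) x -> supported (fil m' n') y ->
  supported (fil (m + m') (n + n')) (fmul x y).
Proof.
move=> sx sy; apply: (supported_lin (f := fmul^~ y)) sx; first exact: fmul_linearl.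
move=> w /and3P [nw /eqP <- dw]; rewrite fmul_bas //.
apply: filW (act_fil (normal_ok nw) sy); by rewrite leq_add2r.
Qed.

Lemma lowE m n : low m n.+1 =1 fil m n.
Proof. by move=> w; rewrite /low /fil ltnS. Qed.

Lemma low0 m x : supported (low m 0) x -> x = 0.
Proof.
move=> /supportedP sx; apply: fcoefP => w; rewrite fcoef0; apply: fcoef_outdom.
by apply/negP => /sx; rewrite /low ltn0 !andbF.
Qed.

Lemma lam_low a m n x : supported (low m n) x ->
  supported (low (mk a + m) n.+1) (lam a x).
Proof.
case: n => [/low0 ->|n]; first by rewrite linear0; exact: supported0.
move=> sx; apply: (supportedW (P := fil (mk a + m) n.+1)).
  by move=> w; rewrite lowE.
by apply: lam_fil; apply: supportedW sx => w; rewrite lowE.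
Qed.

Lemma act_low m n x w : all (@okS d Y) w -> supported (low m n) x ->
  supported (low (marks w + m) (deg w + n)) (ract fock x w).
Proof.
case: n => [ow /low0 ->|n ow sx].
  rewrite -[ract _ _ _]/(mklin (ract_linear fock w) 0) linear0; exact: supported0.
rewrite addnS; apply: (supportedW (P := fil (marks w + m) (deg w + n))).
  by move=> u; rewrite lowE.
by apply: act_fil => //; apply: supportedW sx => u; rewrite lowE.
Qed.

(** The derivation terms have lower degree, so in top degree the product of
    two monomials is the product of commuting letters. *)
Lemma mono_merge r s t : no_letter_head r -> normal r ->
  supported (low (mrk s + (mrk t + marks r)) (size s + (size t + deg r)))
    (mono lam (mu K r t) s - mu K r (s ++ t)).
Proof.
move=> nr or; elim: s => [|a s IH]; first by rewrite subrr; exact: supported0.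
rewrite mono_cons; set D := dersum _ _ _.
have -> : lam a (mono lam (mu K r t) s) - D - mu K r ((a :: s) ++ t) =
  lam a (mono lam (mu K r t) s - mu K r (s ++ t)) + dersum (br a) (mu K r) (s ++ t) - D.
  by rewrite linearB /= [in RHS]lam_mu //; zmodule.
have catE : (mrk s + (mrk t + marks r))%N = (mrk (s ++ t) + marks r)%N.
  by rewrite /mrk map_cat sumn_cat addnA.
have dcat : (size s + (size t + deg r))%N = (size (s ++ t) + deg r)%N.
  by rewrite size_cat addnA.
rewrite /= -!/(mrk _) -addnA; apply: supportedB.
  apply: supportedD; first exact: lam_low.
  rewrite catE addSn dcat; apply: (supportedW (P := fil (mk a + (mrk (s ++ t) + marks r)) (size (s ++ t) + deg r))).
    by move=> u; rewrite lowE.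
  exact: dersum_mu_fil.
rewrite addSn; apply: (supportedW (P := fil (mk a + (mrk s + (mrk t + marks r))) (size s + (size t + deg r)))).
  by move=> u; rewrite lowE.
apply: (dersum_subspace (supported_subspace _) (@mk_br _ _ _ cc a)) => t' st mt.
have := mono_graded (Q := fun m n (x : F) => supported (fil m n) x)
  (fun m n => supported_subspace _) (fun m n x => filW (leqnSn n)) (@mk_br _ _ _ cc)
  (fun a m n x => @lam_fil a m n x) t' (@mu_fil _ t nr or).
by rewrite st mt -/(mrk s) [(mrk s + mk a)%N]addnC -addnA.
Qed.

(** The error terms of leading_term. On such words the inverse of the
    derivation is either known by induction on the degree, or it is w -> R(w).
    *)
Definition below n w : bool :=
  [&& normal w, marks w == 1%N & (deg w < n)%N || (deg w == n) && ~~ wexc w].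

Arguments below n%_N w.

Lemma low_below n x : supported (low 1 n) x -> supported (below n) x.
Proof. by apply: supportedW => w /and3P [nw mw dw]; rewrite /below nw mw dw. Qed.

Lemma below_fil n x : supported (below n) x -> supported (fil 1 n) x.
Proof.
apply: supportedW => w /and3P [nw mw dw]; rewrite /fil nw mw /=.
by case/orP: dw => [/ltnW //|/andP [/eqP -> _]].
Qed.

(** Contrapositively, multiplying by primed letters does not make a word
    exceptional. *)
Lemma wexc_run_add s t r : normal r -> no_letter_head r -> all (@inY' d Y) t ->
  wexc (run (sort <=%O (s ++ t)) ++ r) -> wexc (run s ++ r).
Proof.
move=> or nr pt; have [hr|hr] := boolP (has_letter r).
  by rewrite /wexc !lastrun_cat.
have [o ->] := no_letter_tail or hr; rewrite /wexc !lastrun_run.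
rewrite !(rexc_perm (permEl (perm_rev _))).
rewrite (rexc_perm (permEl (perm_sort _ _))); exact: rexc_add.
Qed.

(** In top degree, a primed letter is added to the first run, and the
    derivation terms have lower degree. *)
Lemma lam_below a n x : inY' a -> supported (below n) x -> supported (below n.+1) (lam a x).
Proof.
move=> pa; apply: supported_lin; first exact: linear_lin.
move=> w Jw; move: (Jw) => /and3P [nw mw dw].
have [nr or ew] := normal_parts K nw.
have ms : marks w = (mrk (firstrun w) + marks (rest w))%N.
  by rewrite -{1}(run_split w) marks_cat marks_run.
have ds : deg w = (size (firstrun w) + deg (rest w))%N.
  by rewrite -{1}(run_split w) deg_cat deg_run.
have ma : mk a = 0%N by rewrite /mk /inY; move: pa; rewrite /inY' => ->.
rewrite -ew lam_mu //; apply: supportedD; last first.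
  apply: low_below; apply: (supportedW (P := fil 1 n)); first by move=> u; rewrite lowE.
  have := @dersum_mu_fil a _ (firstrun w) nr or.
  rewrite -ms -ds ma (eqP mw); apply: filW.
  by case/orP: dw => [/ltnW //|/andP [/eqP -> _]].
apply: supported_bas; rewrite /below mu_normal // mu_marks mu_deg /=.
rewrite -[mrk (a :: _)]/(mk a + mrk (firstrun w))%N ma add0n -ms mw addSn -ds eqSS ltnS.
case/orP: dw => [->//|/andP [-> ne]].
apply/orP; right; apply: contra ne.
have -> : wexc w = wexc (run (firstrun w) ++ rest w) by rewrite run_split.
have <- : sort <=%O (firstrun w ++ [:: a]) = sort <=%O (a :: firstrun w).
  by apply/perm_sort_leP; rewrite perm_catC.
by apply: wexc_run_add; rewrite //= pa.
Qed.

Lemma tau_below z n x : legal z -> supported (below n) x -> supported (below (deg z + n)) (tauP z x).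
Proof.
move=> Gz; apply: supported_lin; first exact: linear_lin.
move=> w /and3P [nw /eqP mw dw]; rewrite tauP_bas //.
apply: supportedW (pre_homog K Gz nw) => u /and5P [nu mu /eqP du /eqP eu _].
by rewrite /below nu (eqP mu) mw du eu ltn_add2l eqn_add2l dw.
Qed.

Lemma belowW n x : supported (below n) x -> supported (below n.+1) x.
Proof.
move/below_fil => sx; apply: low_below; apply: supportedW sx => w; by rewrite lowE.
Qed.

(** Left multiplication by words without unprimed letters preserves the error
    terms. *)
Lemma act_below n x w : normal w -> marks w = 0%N -> supported (below n) x ->
  supported (below (deg w + n)) (ract fock x w).
Proof.
move=> nw mw sx.
have := @act_graded K d Y cc F (fun m n x => m = 0%N -> supported (below n) x)
  (rho fock) (tau fock) _ _ _ _ 0%N n x w (normal_ok nw) (fun _ => sx).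
rewrite mw addn0; apply => //.
- move=> m n'; split=> [_|c u v hu hv m0]; first exact: supported0.
  by apply: supportedD; [apply: supportedZ; apply: hu | apply: hv].
- by move=> m n' v h m0; apply: belowW; apply: h.
- move=> a m n' v h /eqP; rewrite addn_eq0 => /andP [ma /eqP m0].
  by apply: lam_below (h m0); move: ma; rewrite /mk /inY /inY'; case: (a.2).
by move=> z m n' v Gz h m0; apply: tau_below => //; apply: h.
Qed.

End Filtration.

(** * The leading term of the derivation *)

Section LeadingTerm.
Variables (K : fieldType) (d : Order.disp_t) (Y : orderType d).
Variable cc : Y -> Y -> {free K[Y]}.
Hypothesis ccP : forall a b c,
  ext (cc^~ c) (cc a b - cc b a) = ext (cc a) (cc b c) - ext (cc b) (cc a c).
Local Notation Z := (plus Y).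
Local Notation W := (word Z).
Local Notation F := {free K[W]}.
Local Notation br := (@br K d Y cc).
Local Notation mono := (mono br).
Local Notation lam := (lam cc).
Local Notation fmul := (fmul ccP).
Local Notation der := (der ccP).
Local Notation mark := (@mark K d Y).
Local Notation has_letter := (has (@is_letter d Y)).
Implicit Types (s t : seq Z) (w p q r X : W) (x y : F).

Lemma app_homog p q : normal p -> legal q ->
  supported (fun w => [&& normal w, marks w == marks p, deg w == deg p + deg q,
     wexc w == wexc p & ~~ no_R_head (rev w)])%N (app K p q).
Proof.
move=> np Gq; apply: app_homog_aux => // p1 p' e; apply: star_homog => //.
by apply: (@legal_in_rcons _ _ _ p'); rewrite -e.
Qed.

Lemma der_fil m n x : supported (fil m n) x -> supported (fil m.+1 n) (der x).
Proof.
apply: supported_lin; first exact: der_linear.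
move=> w /and3P [nw /eqP mw dw]; rewrite /der extact_bas //.
have H := @act_graded K d Y cc (F * F)%type
  (fun m n uv => supported (fil m n) uv.1 /\ supported (fil m.+1 n) uv.2)
  (rho (dual ccP)) (tau (dual ccP)) _ _ _ _ 0%N 0%N (bas [::], 0) w (normal_ok nw).
rewrite !addn0 mw in H.
suff [_] : supported (fil m (deg w)) (ract (dual ccP) (bas [::], 0) w).1 /\
  supported (fil m.+1 (deg w)) (ract (dual ccP) (bas [::], 0) w).2.
  exact: filW.
apply: H.
- move=> m' n'; split=> [|c u v [u1 u2] [v1 v2]]; first by split; exact: supported0.
  by split; (apply: supportedD; first exact: supportedZ).
- by move=> m' n' v [v1 v2]; split; apply: filW (leqnSn _) _.
- move=> a m' n' [u v] /= [u1 v1]; split; first exact: lam_fil.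
  apply: supportedD; last by have := lam_fil cc a v1; rewrite addnS.
  case: a => a b; rewrite lamdE; case: b; last exact: supported0.
  exact: (lam_fil cc (unprimed a) u1).
- move=> z m' n' [u v] Gz /= [u1 v1]; split; first exact: tau_fil.
  apply: supportedD; last exact: tau_fil.
  have /and3P [nz /eqP mz _] : [&& normal z, marks z == 1%N & ~~ wexc z] by rewrite -legalE.
  by have := fmul_fil ccP (fil_bas K nz) u1; rewrite mz.
split; last exact: supported0.
exact: fil_bas.
Qed.

Lemma dersum_mark_subspace (Q : F -> Prop) (g : seq Z -> F) u : subspace Q ->
  all (@inY' d Y) u ->
  (forall u1 z u2, u = u1 ++ primed z :: u2 -> Q (g (u1 ++ unprimed z :: u2))) ->
  Q (dersum mark g u).
Proof.
move=> sQ; elim: u g => [|c u IH] g; first by case: sQ.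
move=> /andP [pc pu] H; case: c pc H => [z []] // _ H /=.
apply: subspaceD => //; first by rewrite /mark ext_bas; exact: (H [::]).
by apply: IH => // u1 z' u2 e; apply: (H (primed z :: u1)); rewrite e.
Qed.

(** Each of the equal letters gives the same term. Hence the factor k+1, and
    the need for characteristic zero. *)
Lemma dersum_mark_nseq (y : Y) n (f : seq Z -> F) c :
  (forall s, perm_eq s (unprimed y :: nseq n (primed y)) -> f s = c) ->
  dersum mark f (nseq n.+1 (primed y)) = n.+1%:R *: c.
Proof.
elim: n f => [|n IH] f H.
  by rewrite /= /mark ext_bas H // addr0 scale1r.
rewrite -[LHS]/(ext (fun z => f (z :: nseq n.+1 (primed y))) (mark (primed y)) +
  dersum mark (fun s => f (primed y :: s)) (nseq n.+1 (primed y))).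
rewrite /mark ext_bas H // -/mark IH => [|s ps].
  by rewrite [n.+2%:R]mulrS scalerDl scale1r.
apply: H; rewrite /= -[unprimed y :: primed y :: _]cat1s -[primed y :: nseq _ _]cat1s.
by rewrite perm_sym perm_catCA /= perm_cons perm_sym.
Qed.

Lemma below_le n w : normal w -> marks w = 1%N -> (deg w <= n)%N -> ~~ wexc w -> below n w.
Proof. by move=> nw mw dw ew; rewrite /below nw mw /= ew andbT orbC -leq_eqVlt. Qed.

Lemma concat_below X s o n : closed_end X -> normal X -> normal (optR o) ->
  sorted <=%O s -> s != [::] -> (marks X + mrk s)%N = 1%N ->
  (deg X + (size s + deg (optR o)) <= n)%N -> ~~ rexc s ->
  supported (below n) (bas (X ++ run s ++ optR o) : F).
Proof.
move=> cX nX no ss s0 m1 dn er; apply: supported_bas; apply: below_le.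
- rewrite normal_closed_cat ?no_R_run // nX normal_run ?no_letter_optR //.
  by rewrite ss no.
- by rewrite !marks_cat marks_run marks_optR addn0.
- by rewrite !deg_cat deg_run.
by rewrite /wexc lastrun_closed // (rexc_perm (permEl (perm_rev _))).
Qed.

Section Form.
Variables (X : W) (u : seq Z) (y : Y) (k : nat) (o : option W).
Hypothesis gf : good_form X u y k o.
Let v := u ++ nseq k.+1 (primed y).
Let r := optR o.
Let N := deg (unform X u y k o).

Lemma form_facts : [/\ [/\ closed_end X, normal X, marks X = 0%N & normal r],
  [/\ sorted <=%O u, all (@inY' d Y) u & all (fun c => c < unprimed y)%O u] &
  [/\ sorted <=%O v, all (@inY' d Y) v, v != [::] & mrk v = 0%N] ].
Proof.
case/and5P: gf => cX nX /eqP mX no /and3P [su pu lu]; split=> //.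
have pv : all (@inY' d Y) v by rewrite all_cat pu all_primed_nseq.
split=> //; first exact: sorted_marked.
  by rewrite /v; case: (u).
exact: sumn_mk0.
Qed.

Lemma degN : N = (deg X + (size v + deg r))%N.
Proof. by rewrite /N /unform !deg_cat deg_run. Qed.

Lemma normal_vr : normal (run v ++ r).
Proof.
have [[cX nX mX no] _ [sv pv v0 mv]] := form_facts.
by rewrite normal_run ?no_letter_optR // sv.
Qed.

Lemma fmul_vr : fmul (bas (run v)) (bas r) = bas (run v ++ r).
Proof. by rewrite fmul_concat ?no_letter_optR //; exact: normal_vr. Qed.

Lemma fmul_form : bas (unform X u y k o) = fmul (bas X) (fmul (bas (run v)) (bas r)).
Proof.
have [[cX nX mX no] _ [sv pv v0 mv]] := form_facts.
rewrite fmul_vr fmul_concat //; last by rewrite -[no_letter_head (rev X)]/(closed_end X) cX orbT.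
by rewrite normal_closed_cat ?no_R_run // nX normal_vr.
Qed.

(** The derivative of the last run: its greatest letters, all equal, give the
    leading term, and a smaller letter that loses its prime does not make the
    word exceptional. *)
Lemma form_T2 : supported (below N)
  (fmul (bas X) (fmul (der (bas (run v))) (bas r)) - k.+1%:R *: bas (exform X u y k o)).
Proof.
have [[cX nX mX no] [su pu lu] [sv pv v0 mv]] := form_facts.
pose P w := [&& sorted <=%O (firstrun w), mrk (firstrun w) == 1%N,
  size (firstrun w) == size v, w == run (firstrun w) & ~~ rexc (firstrun w)].
pose f x := fmul (bas X) (fmul x (bas r)).
have fL : linear f.
  by move=> c a b; rewrite /f fmul_linearl fmul_linearr.
have catE s : sorted <=%O s -> s != [::] -> f (bas (run s)) = bas (X ++ run s ++ r).
  move=> ss s0; have nsr : normal (run s ++ r) by rewrite normal_run ?no_letter_optR // ss.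
  rewrite /f fmul_concat ?no_letter_optR // fmul_concat //.
    by rewrite normal_closed_cat ?no_R_run // nX.
  by rewrite -[no_letter_head (rev X)]/(closed_end X) cX orbT.
rewrite -[fmul (bas X) _]/(f (der (bas (run v)))) der_run // dersum_cat.
have -> : dersum mark (fun t' => mu K [::] (u ++ t')) (nseq k.+1 (primed y)) =
   k.+1%:R *: bas (run (u ++ unprimed y :: nseq k (primed y))).
  rewrite (dersum_mark_nseq (c := mu K [::] (u ++ unprimed y :: nseq k (primed y)))).
    by rewrite mu_sorted ?cats0 // sorted_marked.
  by move=> s ps; apply: mu_perm; rewrite perm_cat2l.
rewrite [X in f X]addrC fL catE; last by case: (u).
  rewrite [X in supported _ X](_ : _ = f (dersum mark (fun s' => mu K [::] (s' ++ nseq k.+1 (primed y))) u)); last first.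
    by rewrite /exform -/r; zmodule.
  apply: (supported_lin (P := P) fL) => [w /and5P [sw /eqP mw /eqP dw /eqP ew rw]|].
    have w0 : firstrun w != [::] by rewrite -size_eq0 dw size_eq0.
    rewrite ew catE //; apply: concat_below => //; first by rewrite mX mw.
    by rewrite dw degN.
  apply: dersum_mark_subspace => // [|u1 z u2 eu]; first exact: supported_subspace.
  apply: supported_bas; rewrite /P cats0 firstrun_run0 eqxx size_sort.
  have su12 : mrk (u1 ++ u2) = 0%N.
    move: pu; rewrite eu all_cat /= => /andP [p1 p2].
    by rewrite /mrk sumn_mk0 // all_cat p1.
  rewrite sort_sorted ?size_cat ?eu /=; last exact: le_total.
  rewrite (rexc_perm (permEl (perm_sort _ _))) -catA cat_cons not_rexc_mark ?andbT //.
    rewrite size_cat /= eqxx andbT.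
    rewrite (mrk_perm (permEl (perm_sort _ _))) mrk_cat mrk_cons mrk_cat.
    rewrite [mrk (primed y :: _)]mrk0 ?(all_primed_nseq k.+1) // addn0 addnCA -mrk_cat.
    by rewrite su12.
  have := allP lu (primed z); rewrite eu mem_cat mem_head orbT plus_lt => /(_ isT).
  by rewrite /= andbF orbF.
by apply: sorted_marked.
Qed.

(** The derivative of the symbol after the last run: it opens to a legal word,
    which is not exceptional. *)
Lemma form_T3 : supported (below N) (fmul (bas X) (fmul (bas (run v)) (der (bas r)))).
Proof.
have [[cX nX mX no] [su pu lu] [sv pv v0 mv]] := form_facts.
have nv : normal (run v) by rewrite -[run v]cats0 normal_run // sv.
have fm0 x : fmul x 0 = 0 by exact: bil_0r (fmul_bilinear ccP) x.
rewrite degN; move: no; rewrite /r; case: (o) => [q|] no; last first.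
  by rewrite der1 !fm0; exact: supported0.
have Gq : legal q := legal_in_R no.
rewrite der_R // [fmul (bas (run v)) _]fmul_bas // fmul_bas //.
apply: act_below => //; rewrite -deg_run deg_R addn0.
apply: act_below => //; first by rewrite marks_run.
have /and3P [nq /eqP mq eq] : [&& normal q, marks q == 1%N & ~~ wexc q] by rewrite -legalE.
by apply: supported_bas; apply: below_le.
Qed.

(** A legal word z followed by the last run. If their runs merge, the primed
    letters of the second do not make the first exceptional, by rexc_add. *)
Lemma form_T1b z : legal z -> supported (below (deg z + (size v + deg r)))
  (fmul (bas z) (bas (run v ++ r))).
Proof.
have [[cX nX mX no] [su pu lu] [sv pv v0 mv]] := form_facts.
rewrite legalE => /and3P [nz /eqP mz ez].
have [cz|nc] := boolP (closed_end z).
  rewrite fmul_concat; first last.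
    by rewrite -[no_letter_head (rev z)]/(closed_end z) cz orbT.
    by rewrite normal_closed_cat ?no_R_run // nz normal_vr.
  by apply: concat_below => //; rewrite ?mz ?mv //; exact: rexc_primed.
have hz : has_letter z by apply: has_letter_marks; rewrite mz.
have [X1 [s [o1 [ze s0 c1]]]] := letter_decomp nz hz.
have o1E : o1 = None.
  case: (o1) ze => // q ze; move: nc.
  by rewrite /closed_end ze catA cats1 rev_rcons.
rewrite o1E cats0 in ze.
have n1 : normal X1 by case: (@normal_cat _ _ X1 (run s)); rewrite -?ze.
have ss : sorted <=%O s.
  move: nz; rewrite ze normal_closed_cat //; last by rewrite -[run s]cats0 no_R_run.
  by rewrite -[run s]cats0 normal_run // => /and3P[].
have ns : normal (run s) by rewrite -[run s]cats0 normal_run // ss.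
have m1s : (marks X1 + mrk s)%N = 1%N by rewrite -mz ze marks_cat marks_run.
have -> : bas z = fmul (bas X1) (bas (run s)).
  rewrite fmul_concat -?ze // -[no_letter_head (rev X1)]/(closed_end X1) c1.
  by rewrite orbT.
have nr := no_letter_optR o.
have Er : fmul (bas (run s)) (bas (run v ++ r)) = mono lam (mu K r v) s.
  by rewrite fmul_bas // -{1}[run s]cats0 ract_run // mu_sorted.
rewrite -fmulA Er.
set D := mono lam _ _; have -> : D = (D - mu K r (s ++ v)) + mu K r (s ++ v) by zmodule.
have dz : (deg z + (size v + deg r))%N = (deg X1 + (size s + (size v + deg r)))%N.
  by rewrite ze deg_cat deg_run -!addnA.
rewrite fmulDr; apply: supportedD; rewrite [fmul _ _]fmul_bas // dz.
  have := act_low ccP (normal_ok n1) (mono_merge cc s v nr no).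
  rewrite mv /r marks_optR !addn0 m1s; exact: low_below.
rewrite /mu ract_concat; first last.
- by rewrite -[no_letter_head (rev X1)]/(closed_end X1) c1 orbT.
- rewrite normal_closed_cat ?no_R_run //; last first.
    by rewrite -size_eq0 size_sort size_cat; case: (s) s0.
  by rewrite n1 mu_normal.
have rs : ~~ rexc s.
  apply: contra ez; rewrite ze /wexc => h.
  have := @lastrun_closed _ _ X1 s None s0 c1; rewrite cats0 => ->.
  by rewrite (rexc_perm (permEl (perm_rev _))).
apply: concat_below => //.
- by apply: sort_sorted; exact: le_total.
- by rewrite -size_eq0 size_sort size_cat; case: (s) s0.
- by rewrite (mrk_perm (permEl (perm_sort _ _))) mrk_cat mv addn0.
- by rewrite size_sort size_cat -!addnA.
rewrite (rexc_perm (permEl (perm_sort _ _))); apply: contra rs; exact: rexc_add.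
Qed.

(** The derivative before the last run. Either the last run is still a run of
    primed letters, or it is joined to the last run of a legal word. *)
Lemma form_T1 : supported (below N) (fmul (der (bas X)) (fmul (bas (run v)) (bas r))).
Proof.
have [[cX nX mX no] [su pu lu] [sv pv v0 mv]] := form_facts.
rewrite fmul_vr degN.
case/lastP: X cX nX mX => [|X' [c|z]]; rewrite /closed_end ?rev_rcons //.
  move=> _ _ _; rewrite der1 (bil_0l (fmul_bilinear ccP)); exact: supported0.
move=> _ nX mX; have Gz := legal_in_rcons nX.
have nz : normal [:: Rsym z] by rewrite normal_R Gz.
have [n' _] : normal X' /\ normal [:: Rsym z] by apply: normal_cat; rewrite cats1.
have -> : bas (rcons X' (Rsym z)) = fmul (bas X') (bas [:: Rsym z]).
  by rewrite fmul_concat ?cats1.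
rewrite der_fmul; [|exact: supported_bas..].
rewrite fmulDl der_R // deg_rcons; apply: supportedD.
  apply: (supported_lin (f := fun x => fmul (fmul x (bas [:: Rsym z])) (bas (run v ++ r)))
    (P := fil 1 (deg X'))).
  - by move=> c a b; rewrite !fmul_linearl.
  - move=> w /and3P [nw /eqP mw dw]; rewrite app_fmul //.
    apply: (supported_lin (f := fmul^~ (bas (run v ++ r)))) (app_homog nw Gz).
      exact: fmul_linearl.
    move=> p /and5P [np /eqP mp /eqP dp _ hp].
    have cp : closed_end p by rewrite /closed_end; case: (rev p) hp => [|[]].
    rewrite fmul_concat; first last.
    + by rewrite -[no_letter_head (rev p)]/(closed_end p) cp orbT.
    + by rewrite normal_closed_cat ?no_R_run // np normal_vr.
    apply: concat_below => //; rewrite ?mv ?mp ?mw //; last exact: rexc_primed.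
    by rewrite dp leq_add2r leq_add2r.
  have := der_fil (fil_bas K n'); rewrite (_ : marks X' = 0%N) //.
  by move: mX; rewrite marks_rcons addn0.
rewrite -fmulA fmul_bas //= -/(deg z) -addnA.
apply: act_below => //; first by move: mX; rewrite marks_rcons addn0.
exact: form_T1b.
Qed.

(** The three places where the derivative can fall: on, after and before the
    last run. *)
Lemma leading_term : supported (below N)
  (der (bas (unform X u y k o)) - k.+1%:R *: bas (exform X u y k o)).
Proof.
have [[cX nX mX no] [su pu lu] [sv pv v0 mv]] := form_facts.
have nv : normal (run v) by rewrite -[run v]cats0 normal_run // sv.
rewrite fmul_form der_fmul; [|exact: supported_bas|]; last first.
  by rewrite fmul_vr; apply: supported_bas; exact: normal_vr.
rewrite der_fmul; [|exact: supported_bas..].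
rewrite fmulDr -addrA; apply: supportedD; first exact: form_T1.
rewrite addrAC; apply: supportedD; [exact: form_T2 | exact: form_T3].
Qed.

End Form.
End LeadingTerm.

(** * The Rota-Baxter operator *)

Section RotaBaxter.
Variables (K : fieldType) (d : Order.disp_t) (Y : orderType d).
Hypothesis charK : [pchar K] =i pred0.
Variable cc : Y -> Y -> {free K[Y]}.
Hypothesis ccP : forall a b c,
  ext (cc^~ c) (cc a b - cc b a) = ext (cc a) (cc b c) - ext (cc b) (cc a c).
Local Notation Z := (plus Y).
Local Notation W := (word Z).
Local Notation F := {free K[W]}.
Local Notation br := (@br K d Y cc).
Local Notation mono := (mono br).
Local Notation rep := (@rep K d Y cc).
Local Notation fmul := (fmul ccP).
Local Notation der := (der ccP).
Local Notation has_letter := (has (@is_letter d Y)).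
Implicit Types (s : seq Z) (e t w p q r X : W) (x y : F).

Definition marked w : bool := normal w && (marks w == 1%N).

(** The multiplicity k+1 of leading_term, read off as a coefficient to avoid
    decomposing e. *)
Definition lead_coef e : K := fcoef (der (bas (prime_word e))) e.
Definition lower_part e : F := der (bas (prime_word e)) - lead_coef e *: bas e.

(** The preimage of e under the derivation, found by solving der t = c e +
    (lower part) for e. The error terms have lower degree or are legal, so a
    bound n for the degree serves for the recursion. *)
Fixpoint invd (n : nat) e : F :=
  if ~~ marked e then 0 else
  if ~~ wexc e then bas [:: Rsym e] else
  if n is m.+1 then
    (lead_coef e)^-1 *: (bas (prime_word e) - ext (invd m) (lower_part e))
  else 0.

Definition rb (x : F) : F := ext (fun e => invd (deg e) e) x.

Lemma rb_linear : linear rb.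
Proof. exact: linearP. Qed.

Lemma rb_bas e : rb (bas e) = invd (deg e) e.
Proof. by rewrite /rb ext_bas. Qed.

Lemma legal_marked w : legal w = marked w && ~~ wexc w.
Proof. by rewrite legalE /marked andbA. Qed.

Lemma invd_legal n e : legal e -> invd n e = bas [:: Rsym e].
Proof. by rewrite legal_marked; case: n => [|n] /= /andP [-> ->]. Qed.

Lemma invd_unmarked n e : ~~ marked e -> invd n e = 0.
Proof. by case: n => [|n] /= ->. Qed.

(** This is where the characteristic is used: k+1 is invertible. *)
Lemma exc_facts e : marked e -> wexc e ->
  [/\ [/\ normal (prime_word e), marks (prime_word e) = 0%N,
          prime_word e != [::] & deg (prime_word e) = deg e],
      (0 < deg e)%N, lead_coef e != 0 & supported (below (deg e)) (lower_part e)].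
Proof.
move=> /andP [ne /eqP me] we.
have [X [u [y [k [o [gf ee]]]]]] := exc_form ne me we.
have pe : prime_word e = unform X u y k o by rewrite ee prime_exform.
have [nt mt dt] := good_unform gf.
have L := leading_term ccP gf; rewrite -ee -pe in L.
rewrite -pe -ee in dt; rewrite -pe in nt mt.
set j := der _ - _ in L.
have cj : fcoef j e = 0.
  apply: fcoef_outdom; apply/negP => h.
  by have := (supportedP _ _).1 L e h; rewrite /below dt ltnn we !andbF.
have cE : lead_coef e = k.+1%:R.
  have -> : lead_coef e = fcoef (j + k.+1%:R *: bas e) e by rewrite /j subrK.
  by rewrite fcoefD cj add0r fcoefZ fcoef_bas eqxx mulr1.
split.
- split=> //; rewrite pe /unform; case: (X) => //; case: (u) => //.
- rewrite ee /exform !deg_cat deg_run size_cat /=; lia.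
- by rewrite cE ((pcharf0P K).1 charK).
by rewrite /lower_part cE -dt.
Qed.

Lemma below_cases n w : below n w -> marked w /\ (legal w \/ deg w < n)%N.
Proof.
rewrite /below => /and3P [nw mw]; rewrite /marked nw mw => /orP [h|/andP [_ ew]].
  by split=> //; right.
by split=> //; left; rewrite legal_marked /marked nw mw.
Qed.

Lemma invd_stable n m e : (deg e <= n)%N -> (deg e <= m)%N -> invd n e = invd m e.
Proof.
elim: n m e => [|n IH] m e en em.
  have [me|me] := boolP (marked e); last by rewrite !invd_unmarked.
  have [we|we] := boolP (wexc e); last by rewrite !invd_legal // legal_marked me we.
  by have [_ e0 _ _] := exc_facts me we; rewrite leqNgt e0 in en.
have [me|me] := boolP (marked e); last by rewrite !invd_unmarked.
have [we|we] := boolP (wexc e); last by rewrite !invd_legal // legal_marked me we.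
have [_ e0 _ LJ] := exc_facts me we.
case: m em => [|m] em; first by rewrite leqNgt e0 in em.
rewrite /= me we /=; congr (_ *: (_ - _)).
apply: (eq_supported _ LJ) => w /below_cases [mw [Gw|wk]]; first by rewrite !invd_legal.
by apply: IH; rewrite -ltnS; [exact: leq_trans en|exact: leq_trans em].
Qed.

(** The recursive equation of invd with the bound removed. *)
Lemma rb_exc e : marked e -> wexc e ->
  rb (bas e) = (lead_coef e)^-1 *: (bas (prime_word e) - rb (lower_part e)).
Proof.
move=> me we; have [_ e0 _ LJ] := exc_facts me we; rewrite rb_bas.
case E : (deg e) e0 => [//|k] _ /=; rewrite me we /=.
congr (_ *: (_ - _)); apply: (eq_supported _ LJ) => w /below_cases [mw [Gw|wk]].
  by rewrite !invd_legal.
by apply: invd_stable => //; rewrite -ltnS -E.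
Qed.

Lemma rb_legal e : legal e -> rb (bas e) = bas [:: Rsym e].
Proof. by move=> Ge; rewrite rb_bas invd_legal. Qed.

Lemma rb_unmarked e : ~~ marked e -> rb (bas e) = 0.
Proof. by move=> me; rewrite rb_bas invd_unmarked. Qed.

(** With der_rb, the derivation and rb are inverse to each other. *)
Lemma rb_der t : normal t -> marks t = 0%N -> t != [::] -> rb (der (bas t)) = bas t.
Proof.
move=> nt mt t0; have [ht|ht] := boolP (has_letter t); last first.
  by have [z -> Gz] := no_letter_unmarked nt t0 ht; rewrite der_R // rb_legal.
have [X [u [y [k [o [gf et]]]]]] := unmarked_form nt mt ht.
pose e := exform X u y k o.
have pe : prime_word e = t by rewrite et prime_exform.
have [ne me we] := good_exform gf.
have Me : marked e by rewrite /marked ne me.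
have [_ _ c0 _] := exc_facts Me we.
have -> : der (bas t) = lead_coef e *: bas e + lower_part e.
  by rewrite /lower_part pe; zmodule.
rewrite rb_linear rb_exc // scalerA divff // scale1r pe; zmodule.
Qed.

Lemma der_rb x : supported marked x -> der (rb x) = x.
Proof.
suff H e : marked e -> der (rb (bas e)) = bas e.
  move=> sx; rewrite -[RHS](ext_id x) -[x in LHS]ext_id /rb !ext_lin.
  rewrite -[LHS]/(mklin (der_linear ccP) _) ext_lin.
  by apply: (eq_supported _ sx) => e /H; rewrite /rb.
have [n] := ubnP (deg e); elim: n e => // n IH e en me.
have [we|we] := boolP (wexc e); last first.
  by have Ge : legal e by [rewrite legal_marked me we]; rewrite rb_legal // der_R.
have [_ _ c0 LJ] := exc_facts me we.
rewrite rb_exc //.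
have derL : linear der by exact: der_linear.
have dl : der (rb (lower_part e)) = lower_part e.
  rewrite -[RHS](ext_id (lower_part e)) -[lower_part e in LHS]ext_id /rb ext_lin.
  rewrite -[LHS]/(mklin derL _) ext_lin.
  apply: (eq_supported _ LJ) => w /below_cases [mw [Gw|wk]] /=.
    by rewrite -/(rb _) rb_legal // der_R.
  by rewrite -/(rb _) IH //; apply: leq_trans wk _; rewrite -ltnS.
rewrite -[LHS]/(mklin derL _) linearZ linearB /= dl /lower_part.
by rewrite opprB addrCA subrr addr0 scalerA mulVf // scale1r.
Qed.

(** The unmarked words without the constant term, which is killed by the
    derivation. *)
Definition tpos n w : bool := [&& normal w, marks w == 0%N, (deg w <= n)%N & w != [::]].

Lemma tposW n n' x : (n <= n')%N -> supported (tpos n) x -> supported (tpos n') x.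
Proof.
move=> nn'; apply: supportedW => w /and4P [nw mw dw w0].
by rewrite /tpos nw mw w0 (leq_trans dw).
Qed.

Lemma rb_tpos n x : supported (fun w => deg w <= n)%N x -> supported (tpos n) (rb x).
Proof.
suff H e : supported (tpos (deg e)) (rb (bas e)).
  move=> sx; apply: (supported_lin rb_linear) sx => w wn; exact: tposW wn (H w).
have [m] := ubnP (deg e); elim: m e {n x} => // n IH e en.
have [me|me] := boolP (marked e); last by rewrite rb_unmarked //; exact: supported0.
have HG w : legal w -> supported (tpos (deg w)) (rb (bas w)).
  move=> Gw; rewrite rb_legal //; apply: supported_bas.
  by rewrite /tpos normal_R Gw /= deg_R addn0 leqnn.
have [we|we] := boolP (wexc e); last by apply: HG; rewrite legal_marked me we.
have [[nt mt t0 dt] _ c0 LJ] := exc_facts me we.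
rewrite rb_exc //; apply: supportedZ; apply: supportedB.
  by apply: supported_bas; rewrite /tpos nt mt t0 dt leqnn.
apply: (supported_lin rb_linear) LJ => w Jw; have [mw [Gw|wk]] := below_cases Jw.
  apply: tposW (HG w Gw); move: Jw => /and3P [_ _ /orP [/ltnW//|/andP [/eqP -> _]]] //.
apply: tposW (IH w _); first exact: ltnW.
by apply: leq_trans wk _; rewrite -ltnS.
Qed.

Lemma zero_linear (V : lmodType K) : linear (fun _ : V => 0 : V).
Proof. by move=> c u v; rewrite scaler0 addr0. Qed.
Definition zero_map (V : lmodType K) := mklin (@zero_linear V).

Lemma triv_rhoC (a b : Z) (u : K^o) :
  zero_map _ (zero_map _ u) - zero_map _ (zero_map _ u) =
  ext (fun=> zero_map _ u) (br a b - br b a) :> K^o.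
Proof. by rewrite subrr [RHS](ext0 K^o). Qed.

Lemma triv_tauM p q (u : K^o) : legal p -> legal q ->
  zero_map _ (zero_map _ u) = ext (fun=> zero_map _ u) (star K p q) :> K^o.
Proof. by rewrite [RHS](ext0 K^o). Qed.

(** The augmentation as a representation. It shows that the vectors without
    constant term are closed under multiplication. *)
Definition triv : rep K^o := Rep triv_rhoC triv_tauM.

Lemma mono_triv (v : K^o) s : s != [::] -> mono (rho triv) v s = 0.
Proof.
pose f s' : K^o := if s' is [::] then v else 0.
move=> s0; transitivity (f s); last by case: s s0.
apply: (mono_unique (f := f)) => a t /=.
rewrite (_ : dersum _ _ _ = 0) ?addr0 //.
case: t => // b t; rewrite (eq_dersum _ (g := fun=> 0)) ?dersum0 // => t'.
by case: t'.
Qed.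

Lemma ract_triv (v : K^o) w : w != [::] -> ract triv v w = 0.
Proof.
elim/word_ind: w => [//|s w nw s0 _ _|z w _ _]; last exact: ract_R.
by rewrite ract_run // mono_triv.
Qed.

Lemma extact_triv (v : K^o) x : extact triv v x = fcoef x [::] * v.
Proof.
apply: (eq_on_basis (f := extact triv v) (g := fun x => fcoef x [::] * v : K^o)).
- exact: linear_lin.
- by move=> c a b; rewrite fcoefD fcoefZ mulrDl -mulrA.
move=> w; rewrite fcoef_bas; have [->|w0] := eqVneq w [::].
  by rewrite extact_bas // mul1r.
rewrite mul0r; have [nw|nw] := boolP (normal w); last by rewrite extact_not_normal.
by rewrite extact_bas // ract_triv.
Qed.

Lemma fcoef_fmul x y : fcoef (fmul x y) [::] = fcoef x [::] * fcoef y [::].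
Proof.
have := extact_fmul ccP triv 1 x y; rewrite !extact_triv !mulr1.
by [].
Qed.

Lemma fil_tpos n x : supported (fil 0 n) x -> fcoef x [::] = 0 -> supported (tpos n) x.
Proof.
move=> /supportedP sx x0; apply/supportedP => w wx.
have /and3P [nw mw dw] := sx w wx; rewrite /tpos nw mw dw /=.
by apply: contraTneq wx => ->; rewrite mem_supp x0 eqxx.
Qed.

Lemma tpos_fil n x : supported (tpos n) x -> supported (fil 0 n) x /\ fcoef x [::] = 0.
Proof.
move=> /supportedP sx; split.
  by apply/supportedP => w /sx /and4P [nw mw dw _]; rewrite /fil nw mw.
by apply: fcoef_outdom; apply/negP => /sx; rewrite /tpos eqxx !andbF.
Qed.

Lemma tpos_fmul m n x y : supported (tpos m) x -> supported (tpos n) y ->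
  supported (tpos (m + n)) (fmul x y).
Proof.
move=> /tpos_fil [fx x0] /tpos_fil [fy y0]; apply: fil_tpos.
  exact: (fmul_fil ccP fx fy).
by rewrite fcoef_fmul x0 mul0r.
Qed.

Lemma rb_der_tpos n x : supported (tpos n) x -> rb (der x) = x.
Proof.
move=> sx; rewrite -[RHS](ext_id x) -[x in LHS]ext_id.
rewrite -[LHS]/(mklin (linear_comp rb_linear (der_linear ccP)) _) ext_lin.
apply: (eq_supported _ sx) => w /and4P [nw /eqP mw dw w0].
by rewrite mklinE rb_der.
Qed.

(** A non-normal word multiplies by zero on the left but not on the right. The
    projection makes the product symmetric in this respect. *)
Definition pn x : F := ext (fun w => if normal w then bas w else 0) x.

Lemma pn_linear : linear pn. Proof. exact: linearP. Qed.

Lemma pn_bas w : pn (bas w) = if normal w then bas w else 0.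
Proof. by rewrite /pn ext_bas. Qed.

Lemma pn_id x : supported (@normal d Y) x -> pn x = x.
Proof.
move=> sx; rewrite -[RHS]ext_id; apply: (eq_supported _ sx) => w nw.
by rewrite nw.
Qed.

Lemma pn_normal x : supported (@normal d Y) (pn x).
Proof.
apply: subspace_ext; first exact: supported_subspace.
by move=> w _; case: ifP => nw; [exact: supported_bas|exact: supported0].
Qed.

Lemma fil_normal m n x : supported (fil m n) x -> supported (@normal d Y) x.
Proof. by apply: supportedW => w /and3P[]. Qed.
Lemma tpos_normal n x : supported (tpos n) x -> supported (@normal d Y) x.
Proof. by apply: supportedW => w /and4P[]. Qed.

Lemma fmul_pn x y : fmul (pn x) y = fmul x y.
Proof.
apply: (eq_on_basis (f := fun x => fmul (pn x) y) (g := fmul^~ y)).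
- by apply: (linear_comp (f := fmul^~ y)); [exact: fmul_linearl|exact: pn_linear].
- exact: fmul_linearl.
move=> w; rewrite pn_bas; case: ifP => // /negbT nw.
by rewrite (bil_0l (fmul_bilinear ccP)) [RHS]extact_not_normal.
Qed.

Lemma supported_normal_fmul x y : supported (@normal d Y) x ->
  supported (@normal d Y) y -> supported (@normal d Y) (fmul x y).
Proof.
move=> sx; apply: (supported_lin (fmul_linearr ccP x)) => w2 n2.
apply: (supported_lin (f := fmul^~ (bas w2))) sx; first exact: fmul_linearl.
move=> w1 n1; exact: fil_normal (fmul_fil ccP (fil_bas K n1) (fil_bas K n2)).
Qed.

Definition bmul x y : F := fmul x (pn y).

Lemma bmul_bilin : bilinear_op bmul.
Proof.
split=> [y c a b|x c a b]; rewrite /bmul; first exact: fmul_linearl.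
by rewrite pn_linear fmul_linearr.
Qed.

Lemma bmulA : associative bmul.
Proof.
move=> x y z; rewrite /bmul -[fmul y _ in LHS]fmul_pn pn_id ?fmulA //.
by apply: supported_normal_fmul; exact: pn_normal.
Qed.

Lemma rb0 : rb 0 = 0. Proof. exact: (linear0 (mklin rb_linear)). Qed.
Lemma rb_fil m n x : m != 1%N -> supported (fil m n) x -> rb x = 0.
Proof.
move=> m1 sx; rewrite -[x]ext_id /rb ext_lin -[RHS](ext0 F x).
apply: (eq_supported _ sx) => w /and3P [_ /eqP mw _].
by rewrite -[LHS]/(rb (bas w)) rb_unmarked // /marked mw negb_and m1 orbT.
Qed.

Lemma rb_tposw w : supported (tpos (deg w)) (rb (bas w)).
Proof. by apply: rb_tpos; apply: supported_bas. Qed.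

(** With x = der t and y = der u, the identity is t u = rb (der (t u)), the
    Leibniz rule. A basis word that is not marked is killed by rb, and its
    products with vectors without unprimed letters are not marked either, so
    that both sides vanish. *)
Lemma rb_rb : rb_operator bmul rb.
Proof.
have L1 : forall y, linear (fun x => bmul (rb x) (rb y)).
  by move=> y c a b; rewrite rb_linear bmul_bilin.1.
have L2 : forall y, linear (fun x => rb (bmul (rb x) y + bmul x (rb y))).
  move=> y; apply: linear_comp; first exact: rb_linear.
  by apply: linear_add => c a b; rewrite ?rb_linear bmul_bilin.1.
have R1 : forall x, linear (fun y => bmul (rb x) (rb y)).
  by move=> x c a b; rewrite rb_linear bmul_bilin.2.
have R2 : forall x, linear (fun y => rb (bmul (rb x) y + bmul x (rb y))).
  move=> x; apply: linear_comp; first exact: rb_linear.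
  by apply: linear_add => c a b; rewrite ?rb_linear bmul_bilin.2.
suff H e1 e2 : bmul (rb (bas e1)) (rb (bas e2)) =
    rb (bmul (rb (bas e1)) (bas e2) + bmul (bas e1) (rb (bas e2))).
  move=> x y; apply: (eq_on_basis (L1 y) (L2 y)) => e1.
  by apply: (eq_on_basis (R1 _) (R2 _)) => e2; exact: H.
have b0l x : bmul 0 x = 0 by exact: bil_0l bmul_bilin x.
have b0r x : bmul x 0 = 0 by exact: bil_0r bmul_bilin x.
have nt e : supported (@normal d Y) (rb (bas e)) := tpos_normal (rb_tposw e).
have [m1|m1] := boolP (marked e1); have [m2|m2] := boolP (marked e2).
- rewrite /bmul !pn_id //; last by apply: supported_bas; case/andP: m2.
  set t := rb (bas e1); set u := rb (bas e2).
  have -> : bas e1 = der t by rewrite der_rb //; exact: supported_bas.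
  have -> : fmul t (bas e2) = fmul t (der u) by rewrite der_rb //; exact: supported_bas.
  rewrite addrC -der_fmul //; try exact: nt.
  by rewrite (rb_der_tpos (tpos_fmul (rb_tposw e1) (rb_tposw e2))).
- rewrite (rb_unmarked m2) !b0r addr0 /bmul pn_bas.
  case: ifP => n2; last by rewrite (bil_0r (fmul_bilinear ccP)) rb0.
  symmetry; apply: (rb_fil _ (fmul_fil ccP (tpos_fil (rb_tposw e1)).1 (fil_bas K n2))).
  by move: m2; rewrite /marked n2.
- rewrite (rb_unmarked m1) !b0l add0r /bmul pn_id //.
  have [n1|n1] := boolP (normal e1); last by rewrite [fmul _ _]extact_not_normal // rb0.
  symmetry; apply: (rb_fil _ (fmul_fil ccP (fil_bas K n1) (tpos_fil (rb_tposw e2)).1)).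
  by rewrite addn0; move: m1; rewrite /marked n1.
by rewrite (rb_unmarked m1) (rb_unmarked m2) !b0l b0r addr0 rb0.
Qed.

Definition fockRB : rbAssAlg K := RBAssAlg bmul_bilin bmulA rb_linear rb_rb.

End RotaBaxter.

Local Open Scope classical_set_scope.
Local Open Scope ring_scope.

(** * The set E *)

Section WordsOfE.
Variables (d : Order.disp_t) (Y : orderType d).
Local Notation Z := (plus Y).
Local Notation W := (word Z).
Local Notation has_letter := (has (@is_letter d Y)).
Implicit Types (s : seq Z) (w z p q X : W) (us ws : seq (seq Z)) (zs : seq W)
  (o ol oq oql : option W).

Lemma alternating_cons s ws a zs o : size ws = (size zs).+1 ->
  alternating None (s :: ws) (a :: zs) o =
  run s ++ alternating (Some a) ws zs o.
Proof. by case: ws => //= h t _; rewrite /alternating /= -catA. Qed.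

Lemma alternating_Some a ws zs o :
  alternating (Some a) ws zs o = Rsym a :: alternating None ws zs o.
Proof. by []. Qed.

Lemma alternating_end o1 us s zs o : size us = size zs ->
  exists2 X, closed_end X & alternating o1 (rcons us s) zs o = X ++ run s ++ optR o.
Proof.
have cR a X : closed_end X -> closed_end (Rsym a :: X).
  by rewrite /closed_end rev_cons; case: (rev X) => [|[]].
elim: zs us o1 => [|a zs IH] [|u us] // o1.
  move=> _; exists (optR o1); first by case: o1.
  by rewrite /alternating /=.
case=> e.
have [X cX eX] := IH us (Some a) e.
have H : alternating None (rcons (u :: us) s) (a :: zs) o = run u ++ X ++ run s ++ optR o.
  by rewrite -eX -alternating_cons // size_rcons e.
have cX' : closed_end (run u ++ X).
  move: eX; rewrite alternating_Some.
  case: X cX {H} => [|x X] cX eX.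
    have [X' _ eX'] := IH us None e; move: eX; rewrite eX'.
    move/(congr1 (fun w : W => size w)); rewrite /= !size_cat; lia.
  rewrite /closed_end rev_cat; move: cX; rewrite /closed_end rev_cons.
  by case: (rev X).
case: o1 => [z|].
  exists (Rsym z :: run u ++ X); first exact: cR.
  by rewrite alternating_Some H /= -catA.
by exists (run u ++ X); rewrite // H -catA.
Qed.

Lemma excluded_wexc (S : set W) z : excluded S z -> wexc z.
Proof.
move=> [oq [us [ut [y [k [qs [oql [sz _ _ /andP [/andP [_ pu] lu] ->]]]]]]]].
have [X cX ->] := alternating_end oq (ut ++ unprimed y :: nseq k (primed y)) oql sz.
rewrite /wexc lastrun_closed //; last by case: (ut).
by rewrite (rexc_perm (permEl (perm_rev _))) rexc_mark.
Qed.

(** The parse of a normal word into runs and symbols in the format of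
    alternating. A last run s and a last symbol o are kept as parameters, for
    s may be exceptional. *)
Lemma closed_parse X : normal X -> closed_end X ->
  exists o1 us zs, [/\ size us = size zs, all (@in_Com d Y) us,
    sumn (map (@mrk d Y) us) = marks X, (isSome o1 = ~~ no_R_head X) &
    forall s o, X ++ run s ++ optR o = alternating o1 (rcons us s) zs o].
Proof.
elim/word_ind: X => [|s0 X nX s00 IH|z X IH].
- by exists None, [::], [::].
- rewrite normal_run // => /andP [ss nX'].
  rewrite /closed_end rev_cat => cX.
  case: X nX nX' cX IH => [|x X] nX nX' cX IH.
    by move: cX; case/lastP: s0 s00 {ss IH} => // s0 c _; rewrite /run map_rcons rev_rcons.
  have cX' : closed_end (x :: X).
    by move: cX; rewrite /closed_end rev_cons; case: (rev X).
  have [[a|] [us [zs [e1 e2 e3 e4 e5]]]] := IH nX' cX'; last by case: (x) nX e4.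
  exists None, (s0 :: us), (a :: zs); split=> /=.
  - by rewrite e1.
  - by rewrite e2 /in_Com s00 ss.
  - by rewrite e3 marks_cat marks_run.
  - by case: (s0) s00.
  by move=> s o; rewrite -catA alternating_cons ?size_rcons ?e1 // -e5.
rewrite normal_R => /and3P [Gz hX nX] cX.
have cX' : closed_end X.
  by move: cX; rewrite /closed_end rev_cons; case: (rev X) => [|[]].
have [o1 [us [zs [e1 e2 e3 e4 e5]]]] := IH nX cX'.
exists (Some z), us, zs; split=> // s o.
by rewrite alternating_Some cat_cons e5; case: o1 e4 {e5} => //; rewrite hX.
Qed.

Lemma mrk_count s : mrk s = count (@inY d Y) s.
Proof. by elim: s => //= c s <-. Qed.

(** Counting the runs that contain an unprimed letter, each with one such
    letter, amounts to counting the unprimed letters. *)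
Lemma one_unprimed_sum ws : one_unprimed ws = (sumn (map (@mrk d Y) ws) == 1%N).
Proof.
rewrite /one_unprimed.
have H0 us : (sumn (map (@mrk d Y) us) == 0%N) = (count (has (@inY d Y)) us == 0%N).
  elim: us => //= u us IH; rewrite !addn_eq0 IH mrk_count has_count.
  by case: (count _ u).
elim: ws => //= w ws IH; rewrite mrk_count has_count.
case: (count _ w) => [|[|n]] /=; first by rewrite !add0n.
  rewrite add1n add1n !eqSS H0.
  have [e|//] := eqVneq (count (has (@inY d Y)) ws) 0%N.
  rewrite /=; apply/allP => u us; apply/implyP => hu.
  by move/eqP: e; rewrite -leqn0 leqNgt -has_count => /hasPn /(_ u us); rewrite hu.
by rewrite andbF.
Qed.

Lemma present_R o1 ws zs ol q : size ws = (size zs).+1 ->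
  List.In q (present o1 zs ol) -> Rsym q \in alternating o1 ws zs ol.
Proof.
move=> e /(in_alternating o1 ol q e); elim: (alternating _ _ _ _) => //= x l IH.
by case=> [->|/IH]; rewrite inE ?eqxx // => ->; rewrite orbT.
Qed.

Lemma mem_In (x : sym Z) (l : W) : x \in l -> List.In x l.
Proof. by elim: l => //= y l IH; rewrite inE => /orP [/eqP ->|/IH]; [left|right]. Qed.

Lemma letter_wexc w : letter_words w -> wexc w.
Proof.
move=> [y _ <-]; have := @lastrun_run _ _ [:: unprimed y] None; rewrite /wexc /= => ->.
exact: (@rexc_mark _ _ [::] y 0).
Qed.

(** The converse of excluded_wexc needs the word to be marked: then the
    unprimed letter of the last run is the only one. *)
Lemma wexc_excluded (S : set W) z : marked z -> wexc z ->
  (forall q, Rsym q \in z -> (S `\` letter_words (Y:=Y)) q) -> excluded S z.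
Proof.
move=> /andP [nz /eqP mz] wz HS.
have [X [u [y [k [o [/and5P [cX nX /eqP mX no /and3P [su pu lu]] ez]]]]]] := exc_form nz mz wz.
have [o1 [us [zs [e1 e2 e3 _ e5]]]] := closed_parse nX cX.
exists o1, us, u, y, k, zs, o; split=> //.
- apply/List.Forall_forall => q /(present_R (ws := rcons us (u ++ unprimed y :: nseq k (primed y)))).
  by rewrite size_rcons e1 -e5 => /(_ erefl) h; apply: HS; rewrite ez.
- move: e3; rewrite mX; elim: us e2 {e1 e5} => //= w us IH /andP [cw cu] /eqP.
  rewrite addn_eq0 => /andP [mw /eqP mu]; rewrite cw IH // andbT.
  by rewrite -marks0_primed.
- by rewrite su pu lu.
by rewrite ez -e5.
Qed.

Lemma alternating_normal o1 ws zs ol : size ws = (size zs).+1 ->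
  all (@in_Com d Y) ws -> (forall q, List.In q (present o1 zs ol) -> legal q) ->
  normal (alternating o1 ws zs ol) /\
  marks (alternating o1 ws zs ol) = sumn (map (@mrk d Y) ws).
Proof.
elim: zs o1 ws => [|a zs IH] o1 [|w ws] // [e] /= /andP [/andP [w0 sw] cw] HG.
  case: ws e cw => // _ _.
  have no : normal (optR ol).
    by case: (ol) HG => // q HG; rewrite normal_R HG //= /present /=; apply: List.in_or_app; right; left.
  have nw : normal (run w ++ optR ol) by rewrite normal_run ?no_letter_optR // sw.
  rewrite /alternating /= -/(run w) addn0 !marks_cat !marks_optR marks_run addn0.
  split=> //; case: o1 HG => // q HG; rewrite normal_R no_R_run // nw HG //.
  by left.
have [nA mA] : normal (alternating (Some a) ws zs ol) /\
    marks (alternating (Some a) ws zs ol) = sumn (map (@mrk d Y) ws).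
  apply: IH => // q qi; apply: HG; apply: List.in_or_app; right.
  exact: qi.
have nB : normal (alternating None (w :: ws) (a :: zs) ol) /\
    marks (alternating None (w :: ws) (a :: zs) ol) = (mrk w + sumn (map (@mrk d Y) ws))%N.
  by rewrite alternating_cons // marks_cat marks_run mA normal_run // sw nA.
case: o1 HG => [z|] // HG; rewrite alternating_Some normal_R marks_R nB.1 nB.2.
rewrite alternating_cons // no_R_run // HG //.
by left.
Qed.

Lemma E_depth_marked n w : E_depth n w -> marked w.
Proof.
elim: n w => [//|n IH] w /= [[y _ <-]|[o1 [ws [zs [ol [[e cw] HX one nex ->]]]]]].
  by [].
have HG q : List.In q (present o1 zs ol) -> legal q.
  move=> qi; have [Eq nlq] := (List.Forall_forall _ _).1 HX q qi.
  have := (List.Forall_forall _ _).1 nex q qi => nxq.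
  rewrite legal_marked IH //=; apply/negP => wq; apply: nxq.
  apply: wexc_excluded => //; first exact: IH.
  by move=> p /mem_In; exact: (E_depth_closed Y n).1.
have [nA mA] := alternating_normal e cw HG.
by rewrite /marked nA mA -one_unprimed_sum.
Qed.

Lemma sz_R_mem q w : Rsym q \in w -> (sz q < sz w)%N.
Proof.
elim: w => //= x w IH; rewrite inE /sz /= => /orP [/eqP <-|/IH]; rewrite /= -/(sz q) -/(sz w).
  by rewrite addSn ltnS leq_addr.
by move=> h; apply: leq_trans h _; exact: leq_addl.
Qed.

Lemma marked_E w : marked w -> E Y w.
Proof.
have [n] := ubnP (sz w); elim: n w => // n IH w wn mw.
have HE q : Rsym q \in w -> E Y q /\ legal q.
  move=> qw; have Gq : legal q by case/andP: mw => /andP [_ /allP /(_ _ qw)].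
  split=> //; apply: IH; last by move: Gq; rewrite legal_marked => /andP[].
  by apply: leq_trans (sz_R_mem qw) _; rewrite -ltnS.
move: (mw) => /andP [nw /eqP m1].
have hw : has_letter w by apply: has_letter_marks; rewrite m1.
have [X [s [o [ew s0 cX]]]] := letter_decomp nw hw.
move: nw; rewrite ew normal_closed_cat ?no_R_run // normal_run ?no_letter_optR //.
move=> /and3P [nX ss no].
have [o1 [us [zs [e1 e2 e3 _ e5]]]] := closed_parse nX cX.
have e : size (rcons us s) = (size zs).+1 by rewrite size_rcons e1.
rewrite E_unfold; right; exists o1, (rcons us s), zs, o; split=> //.
- by rewrite all_rcons e2 /in_Com s0 ss.
- apply/List.Forall_forall => q /(present_R e); rewrite -e5 -ew => /HE [Eq Gq].
  split=> // /letter_wexc; move: Gq; rewrite legal_marked => /andP [_ /negP]; exact.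
- rewrite one_unprimed_sum map_rcons sumn_rcons e3 -m1 ew !marks_cat marks_run.
  by rewrite marks_optR addn0.
apply/List.Forall_forall => q /(present_R e); rewrite -e5 -ew => /HE [_ Gq].
by move/excluded_wexc; move: Gq; rewrite legal_marked => /andP [_ /negP]; exact.
Qed.

(** Both sides satisfy the same recursion, on the depth of R on the left and
    on the size of the word on the right. *)
Lemma E_marked w : E Y w <-> marked w.
Proof. by split=> [[n /E_depth_marked]|/marked_E]. Qed.

End WordsOfE.

(** * Values and structure constants *)

Section MulSeq.
Variables (K : fieldType) (A : rbAssAlg K).
Local Notation mulA_ := (@rbass_mul K A).

Lemma foldl_mul (a c : A) (s : seq A) :
  foldl mulA_ (mulA_ a c) s = mulA_ a (foldl mulA_ c s).
Proof. by elim: s c => //= e s IH c; rewrite -rbass_assoc IH. Qed.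

Lemma mulseq_cons (a : A) (s : seq A) : s != [::] ->
  mulseq (a :: s) = mulA_ a (mulseq s).
Proof. by case: s => // c s _ /=; rewrite foldl_mul. Qed.

End MulSeq.

Section ValueHom.
Variables (K : fieldType) (A B : rbAssAlg K) (h : A -> B).
Hypothesis hH : rbass_hom h.
Variables (d : Order.disp_t) (Y : orderType d) (x : Y -> A).

Lemma hom_mulseq (s : seq A) : h (mulseq s) = mulseq (map h s).
Proof.
have [hL hM _] := hH.
case: s => [|a s] /=; first exact: (linear0 (mklin hL)).
by elim: s a => //= c s IH a; rewrite IH hM.
Qed.

Lemma hom_value w : h (value x w) = value (h \o x) w.
Proof.
have [hL hM hR] := hH.
have [n] := ubnP (sz w); elim: n w => // n IH w wn.
rewrite /value hom_mulseq -map_comp; congr mulseq.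
apply/eq_in_map => -[c|z] zw /=; first by case: ifP.
rewrite hR; congr (rbass_op _); rewrite -[mulseq (map (value_sym x) z)]/(value x z) IH //.
exact: leq_trans (sz_R_mem zw) wn.
Qed.

End ValueHom.

Section Coordinates.
Variables (K : fieldType) (C : prelieAlg K) (d : Order.disp_t) (Y : orderType d).
Variable b : Y -> C.
Hypotheses (b_inj : injective b) (b_basis : lin_basis (range b) setT).

Lemma ext_b_inj (x : {free K[Y]}) : ext b x = 0 -> x = 0.
Proof.
move=> x0; apply: fcoefP => y; rewrite fcoef0.
have [ys|/fcoef_outdom //] := boolP (y \in fm_supp x).
pose c v := \sum_(t <- fm_supp x | b t == v) fcoef x t.
have cb t : t \in fm_supp x -> c (b t) = fcoef x t.
  move=> ts; rewrite /c big_mkcond (bigD1_seq t) ?fset_uniq //= eqxx big1 ?addr0 // => u ut.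
  by case: eqP => // /b_inj tu; rewrite tu eqxx in ut.
have := b_basis.1 (map b (fm_supp x)) c.
rewrite map_inj_uniq // fset_uniq => /(_ isT) H; rewrite -cb //; apply: H.
- by move=> v /mapP [t _ ->]; exists t.
- rewrite big_map -[RHS]x0 extE; apply: eq_big_seq => t ts; by rewrite cb.
exact: map_f.
Qed.

Lemma coords_exists (c : C) : exists x : {free K[Y]}, ext b x = c.
Proof.
have : (@setT C) c by [].
rewrite -b_basis.2 => -[s [a [sb ->]]].
elim: s sb => [|v s IH] sb; first by exists 0; rewrite linear0 big_nil.
have [y _ bv] := sb v (mem_head _ _).
have [|x ex] := IH; first by move=> u us; apply: sb; rewrite inE us orbT.
by exists (a v *: bas y + x); rewrite linearP /= ext_bas bv ex big_cons.
Qed.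

Definition coords (c : C) : {free K[Y]} := projT1 (cid (coords_exists c)).

Lemma coordsK c : ext b (coords c) = c.
Proof. by rewrite /coords; case: (cid _). Qed.

Lemma coords_uniq c x : ext b x = c -> coords c = x.
Proof.
move=> e; apply/eqP; rewrite -subr_eq0; apply/eqP/ext_b_inj.
by rewrite linearB /= coordsK e subrr.
Qed.

Lemma coords_linear : linear coords.
Proof. by move=> a u v; apply: coords_uniq; rewrite linearP /= !coordsK. Qed.

Lemma coords_b y : coords (b y) = bas y.
Proof. by apply: coords_uniq; rewrite ext_bas. Qed.

Definition cst (y z : Y) : {free K[Y]} := coords (prelie_mul (b y) (b z)).

Let mB := prelie_bilin C.
Lemma mulC_linearl v : linear (fun u : C => prelie_mul u v).
Proof. by move=> a u w; rewrite mB.1. Qed.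
Lemma mulC_linearr v : linear (fun u : C => prelie_mul v u).
Proof. by move=> a u w; rewrite mB.2. Qed.

Lemma ext_cstl z x : ext b (ext (cst^~ z) x) = prelie_mul (ext b x) (b z).
Proof.
rewrite ext_lin -[RHS]/(mklin (mulC_linearl (b z)) _) ext_lin.
by apply: eq_ext => y; exact: coordsK.
Qed.

Lemma ext_cstr y x : ext b (ext (cst y) x) = prelie_mul (b y) (ext b x).
Proof.
rewrite ext_lin -[RHS]/(mklin (mulC_linearr (b y)) _) ext_lin.
by apply: eq_ext => u; exact: coordsK.
Qed.

Lemma cstP y z t :
  ext (cst^~ t) (cst y z - cst z y) =
  ext (cst y) (cst z t) - ext (cst z) (cst y t).
Proof.
apply/eqP; rewrite -subr_eq0; apply/eqP/ext_b_inj.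
rewrite !linearB /= !(ext_cstl, ext_cstr).
have e u v : ext b (cst u v) = prelie_mul (b u) (b v) by exact: coordsK.
rewrite !e.
have := prelie_axiom (b y) (b z) (b t) => /eqP; rewrite -subr_eq0 => /eqP a0.
by rewrite -[RHS]a0; zmodule.
Qed.

End Coordinates.

(** * Values of words in the model *)

Section Triangular.
Variables (K : fieldType) (d : Order.disp_t) (Y : orderType d).
Hypothesis charK : [pchar K] =i pred0.
Variable cc : Y -> Y -> {free K[Y]}.
Hypothesis ccP : forall a b c,
  ext (cc^~ c) (cc a b - cc b a) = ext (cc a) (cc b c) - ext (cc b) (cc a c).
Local Notation Z := (plus Y).
Local Notation W := (word Z).
Local Notation F := {free K[W]}.
Local Notation lam := (lam cc).
Local Notation fmul := (fmul ccP).
Local Notation rb := (rb ccP).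
Local Notation fockRB := (fockRB charK ccP).
Implicit Types (w p q z : W) (x y : F).

Definition letter (y : Y) : F := bas [:: Letter (unprimed y)].

Definition valB : W -> F := @value K fockRB d Y letter.

(** The empty word is a unit, and a letter acts on it as itself. *)
Lemma lam1 (c : Z) : lam c (bas [::]) = bas [:: Letter c].
Proof.
rewrite -[bas [::]]/(mu K [::] [::]) lam_mu // /dersum /=.
by rewrite addr0.
Qed.

Lemma fmul_letter (c : Z) x : fmul (bas [:: Letter c]) x = lam c x.
Proof. by rewrite -lam1 fmul_lam fmul1x. Qed.

(** The derivation of y' is y. *)
Lemma rb_letter (y : Y) : rb (letter y) = bas [:: Letter (primed y)].
Proof.
rewrite -[RHS](rb_der charK ccP) //; congr rb.
rewrite -[[:: Letter _]]/(run [:: primed y]) der_run // /dersum /= addr0 /mark /=.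
by rewrite ext_bas.
Qed.

(** The bracket of y' and t in the model is the product y o t, as it has to be
    in a Lie RB-algebra that receives C. *)
Lemma letter_comm (y t : Y) :
  bmul ccP (bas [:: Letter (primed y)]) (letter t) -
  bmul ccP (letter t) (bas [:: Letter (primed y)]) = ext letter (cc y t).
Proof.
have nl c : supported (@normal d Y) (bas [:: Letter c] : F) by exact: supported_bas.
rewrite /bmul /letter !pn_id // !fmul_letter -!lam1 (lamC ccP) subr0 ext_tagY.
by apply: eq_ext => u; rewrite lam1.
Qed.

Lemma fmul_low m n m' n' x y :
  supported (low m n) x -> supported (fil m' n') y ->
  supported (low (m + m') (n + n')) (fmul x y).
Proof.
case: n => [/low0 -> _|n sx sy].
  by rewrite -[fmul _ _]/(mklin (fmul_linearl ccP y) 0) linear0; exact: supported0.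
rewrite addSn; apply: (supportedW (P := fil (m + m') (n + n'))).
  by move=> u; rewrite lowE.
by apply: fmul_fil => //; apply: supportedW sx => u; rewrite lowE.
Qed.

Lemma fil_fmul_low m n m' n' x y :
  supported (fil m n) x -> supported (low m' n') y ->
  supported (low (m + m') (n + n')) (fmul x y).
Proof.
case: n' => [sx /low0 ->|n' sx sy].
  by rewrite -[fmul _ _]/(mklin (fmul_linearr ccP x) 0) linear0; exact: supported0.
rewrite addnS; apply: (supportedW (P := fil (m + m') (n + n'))).
  by move=> u; rewrite lowE.
by apply: fmul_fil => //; apply: supportedW sy => u; rewrite lowE.
Qed.

Lemma low_fil m n x : supported (low m n) x -> supported (fil m n) x.
Proof. by apply: supportedW => w /and3P [nw mw /ltnW dw]; rewrite /fil nw mw. Qed.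

(** A letter joins the first run up to derivation terms of lower degree, and a
    symbol is simply put in front. *)
Lemma fmul_cons s w : normal (s :: w) ->
  supported (low (marks (s :: w)) (deg (s :: w)))
    (fmul (bas [:: s]) (bas w) - bas (s :: w)).
Proof.
case: s => [c|z] nw; last first.
  have [_ nw'] := normal_cat (w1 := [:: Rsym z]) nw.
  rewrite (fmul_concat ccP (w := [:: Rsym z])) ?orbT // ?subrr; exact: supported0.
move: nw; rewrite -(run_split w); have := no_letter_rest w.
move: (firstrun w) (rest w) => t r nr.
rewrite -[Letter c :: _]/(run (c :: t) ++ r) normal_run // => /andP [st nr'].
rewrite fmul_letter -!mu_sorted ?(path_sorted st) // lam_mu // addrC addKr.
rewrite marks_cat deg_cat marks_run deg_run /= -addnA.
apply: (supportedW (P := fil (mk c + (mrk t + marks r)) (size t + deg r))).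
  by move=> u; rewrite lowE.
exact: dersum_mu_fil.
Qed.

(** Symbols and letters are multiplied with an error of lower degree, and rb
    maps an error term to terms of no greater degree. *)
Lemma triangular w : normal w -> w != [::] ->
  supported (low (marks w) (deg w)) (valB w - bas w).
Proof.
have [n] := ubnP (sz w); elim: n w => // n IH [//|s w] wn nw _.
have valS : supported (low (mkS s) (degS s))
    (@value_sym K fockRB d Y letter s - bas [:: s]).
  have [ns _] := normal_cat (w1 := [:: s]) nw.
  case: s wn nw ns => [[y []]|z] wn nw ns.
  - rewrite -[X in X - _]/(rb (letter y)) rb_letter subrr; exact: supported0.
  - by rewrite subrr; exact: supported0.
  have := ns; rewrite normal_R => /andP [Gz _].
  have [mz ez] := andP (etrans (esym (legal_marked z)) Gz).
  have [nz /eqP m1] := andP mz.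
  have z0 : z != [::] by apply: contra_eq_neq m1 => ->.
  rewrite -[@value_sym _ _ _ _ _ _]/(rb (valB z)) -(rb_legal ccP Gz).
  rewrite -[_ - _]/(_ + - _) -scaleN1r addrC -rb_linear scaleN1r addrC.
  have := IH z _ nz z0; rewrite m1 => /(_ _) sl.
  have {sl} : supported (low 1 (deg z)) (valB z - bas z).
    by apply: sl; move: wn; rewrite sz_R; lia.
  rewrite -[degS _]/(deg z); case: (deg z) => [|m] sl.
    by rewrite (low0 sl) rb0; exact: supported0.
  apply: (supportedW (P := tpos m)).
    by move=> u /and4P [nu mu du _]; apply/and3P.
  apply: rb_tpos => //; apply: supportedW sl => u /and3P [_ _]; exact.
have [->|w0] := eqVneq w [::].
  by rewrite /marks /deg /= !addn0.
have [ns nw'] := normal_cat (w1 := [:: s]) nw.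
have /(_ _ nw' w0) lw := IH w.
have {}lw : supported (low (marks w) (deg w)) (valB w - bas w).
  by apply: lw; move: wn; rewrite /sz /=; case: (s) => [c|z] /=; lia.
have sw : supported (fil (marks w) (deg w)) (valB w).
  by rewrite -[valB w](subrK (bas w)); apply: supportedD (fil_bas K nw'); apply: low_fil.
have fs : supported (fil (mkS s) (degS s)) (bas [:: s] : F).
  by have := fil_bas K ns; rewrite /marks /deg /= !addn0.
rewrite /valB /value map_cons mulseq_cons; last by case: (w) w0.
rewrite -[mulseq _]/(valB w) -[rbass_mul _ _]/(fmul _ (pn (valB w))).
rewrite pn_id; last exact: fil_normal sw.
rewrite -[@value_sym _ _ _ _ _ _](subrK (bas [:: s])) fmulDl.
have -> : fmul (bas [:: s]) (valB w) =
  fmul (bas [:: s]) (valB w - bas w) + fmul (bas [:: s]) (bas w).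
  by rewrite -fmulDr subrK.
rewrite -!addrA; apply: supportedD; first exact: fmul_low.
apply: supportedD; first exact: fil_fmul_low.
exact: fmul_cons.
Qed.

Lemma valB_fil w : normal w -> w != [::] ->
  supported (fil (marks w) (deg w)) (valB w).
Proof.
move=> nw w0; rewrite -[valB w](subrK (bas w)).
by apply: supportedD (fil_bas K nw); apply: low_fil; exact: triangular.
Qed.

(** On the marked vectors, taking values is the identity plus a map that
    lowers the degree; it is therefore bijective there. *)
Lemma ext_valB n x : supported (fil 1 n) x ->
  supported (low 1 n) (ext valB x - x).
Proof.
move=> sx; rewrite -[X in _ - X]ext_id -extB; apply: supported_ext sx.
move=> w /and3P [nw /eqP mw dw].
have w0 : w != [::] by apply: contra_eq_neq mw => ->.
have := triangular nw w0; rewrite mw; apply: supportedW.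
by move=> u /and3P [nu mu du]; rewrite /low nu mu (leq_trans du dw).
Qed.

Lemma ext_valB_inj n x : supported (fil 1 n) x -> ext valB x = 0 -> x = 0.
Proof.
elim: n x => [|n IH] x sx x0.
all: have := ext_valB sx; rewrite x0 sub0r => sl.
  by rewrite -[x]opprK (low0 sl) oppr0.
apply: IH => //; rewrite -[x]opprK -scaleN1r; apply: supportedZ.
by apply: supportedW sl => u; rewrite lowE.
Qed.

Lemma ext_valB_surj n x : supported (fil 1 n) x ->
  exists2 y : F, supported (@marked d Y) y & x = ext valB y.
Proof.
elim: n x => [|n IH] x sx; have sl := ext_valB sx.
all: have mx : supported (@marked d Y) x
   by apply: supportedW sx => w /and3P [nw mw _]; rewrite /marked nw.
  by exists x => //; apply/esym/eqP; rewrite -subr_eq0 (low0 sl).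
have [|y my ey] := IH (ext valB x - x); first by apply: supportedW sl => u; rewrite lowE.
exists (x - y); first exact: supportedB.
by rewrite linearB /= -ey; zmodule.
Qed.

End Triangular.

(** * Dual numbers over the unitization *)

Section DualNumbers.
Variables (K : fieldType) (A : rbAssAlg K).
Local Notation m := (@rbass_mul K A).
Local Notation A1 := (K^o * A)%type.
Local Notation V := (A1 * A1)%type.
Implicit Types (a b : A) (p q : A1) (e f : A * A) (v w : V).

Let mB := rbass_bilin A.
Lemma rbass_scalel c x y : m (c *: x) y = c *: m x y.
Proof. by have := mB.1 y c x 0; rewrite !addr0 (bil_0l mB) addr0. Qed.
Lemma rbass_scaler c x y : m x (c *: y) = c *: m x y.
Proof. by have := mB.2 x c y 0; rewrite !addr0 (bil_0r mB) addr0. Qed.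

(** Left multiplication by a in the unitization K + A. *)
Definition lop a p : A1 := (0, (p.1 : K) *: a + m a p.2).
Definition mulU p q : A1 :=
  (p.1 * q.1, (p.1 : K) *: q.2 + (q.1 : K) *: p.2 + m p.2 q.2).
(** Left multiplication by e.1 plus the infinitesimal e.2, on the dual numbers
    over K + A. *)
Definition op e v : V := (lop e.1 v.1, lop e.2 v.1 + lop e.1 v.2).
(** Right multiplication by q. It commutes with all left multiplications,
    which makes values multiplicative. *)
Definition rop (q v : V) : V := (mulU v.1 q.1, mulU v.1 q.2 + mulU v.2 q.1).
Definition one_dual : V := ((1, 0), (0, 0)).

Lemma lop_linearl p : linear (lop^~ p).
Proof.
move=> c a b; congr (_, _) => /=; first by rewrite scaler0 addr0.
rewrite (bil_addl mB) rbass_scalel !scalerDr !scalerA [c * _]mulrC; zmodule.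
Qed.

Lemma lop_linearr a : linear (lop a).
Proof.
move=> c p q; congr (_, _) => /=; first by rewrite scaler0 addr0.
rewrite (bil_addr mB) rbass_scaler scalerDl scalerDr scalerA; zmodule.
Qed.

Lemma lop_lop a b p : lop a (lop b p) = lop (m a b) p.
Proof.
congr (_, _); rewrite /= scale0r add0r (bil_addr mB) rbass_scaler.
by rewrite rbass_assoc.
Qed.

Lemma mulU_linear q : linear (mulU^~ q).
Proof.
move=> c p p'; congr (_, _) => /=; first by rewrite mulrDl -mulrA.
rewrite (bil_addl mB) rbass_scalel !scalerDr !scalerDl !scalerA [q.1 * c]mulrC; zmodule.
Qed.

Lemma mulU_lop a p q : mulU (lop a p) q = lop a (mulU p q).
Proof.
congr (_, _); rewrite /= ?mul0r // scale0r add0r.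
rewrite (bil_addl mB) !(bil_addr mB) !(rbass_scalel, rbass_scaler) rbass_assoc.
by rewrite scalerDr scalerA [q.1 * _]mulrC; zmodule.
Qed.

Lemma op_linear e : linear (op e).
Proof.
move=> c v w; congr (_, _); first exact: lop_linearr.
rewrite /= !lop_linearr.
rewrite -[c *: (op e v).2]/(c *: (lop e.2 v.1 + lop e.1 v.2)) scalerDr; zmodule.
Qed.

Lemma op_linearl v : linear (op^~ v).
Proof.
move=> c e f; congr (_, _); first exact: lop_linearl.
rewrite /= !lop_linearl.
rewrite -[c *: (op e v).2]/(c *: (lop e.2 v.1 + lop e.1 v.2)) scalerDr; zmodule.
Qed.

Lemma op_op e f v : op e (op f v) = op (m e.1 f.1, m e.2 f.1 + m e.1 f.2) v.
Proof.
congr (_, _); rewrite /= ?lop_lop //.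
rewrite -[lop e.1 _]/(mklin (lop_linearr e.1) _) linearD !mklinE !lop_lop.
rewrite -[lop (_ + _) _]/(mklin (lop_linearl _) _) linearD !mklinE; zmodule.
Qed.

Lemma rop_linear (q : V) : linear (rop q).
Proof.
move=> c v w; congr (_, _); first exact: mulU_linear.
rewrite /= !mulU_linear.
rewrite -[c *: (rop q v).2]/(c *: (mulU v.1 q.2 + mulU v.2 q.1)) scalerDr; zmodule.
Qed.

Lemma rop_op (q : V) e v : rop q (op e v) = op e (rop q v).
Proof.
congr (_, _); rewrite /= ?mulU_lop //.
rewrite -[mulU (_ + _) _]/(mklin (mulU_linear _) _) linearD !mklinE !mulU_lop.
rewrite -[lop e.1 (_ + _)]/(mklin (lop_linearr _) _) linearD !mklinE; zmodule.
Qed.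

Lemma rop1 (q : V) : rop q one_dual = q.
Proof.
case: q => [[k a] [l b]]; congr (_, _) => /=.
  by congr (_, _) => /=; rewrite ?mul1r // scale1r scaler0 (bil_0l mB) !addr0.
congr (_, _) => /=; first by rewrite mul1r mul0r addr0.
by rewrite scale1r scale0r !scaler0 !(bil_0l mB) !addr0.
Qed.

Lemma op_dual1 e v : (op e v).2.1 = 0.
Proof. exact: addr0. Qed.

End DualNumbers.

(** * Representations in an RB-algebra *)

Section Evaluation.
Variables (K : fieldType) (A : rbAssAlg K).
Variables (d : Order.disp_t) (Y : orderType d).
Variable cc : Y -> Y -> {free K[Y]}.
Hypothesis ccP : forall a b c,
  ext (cc^~ c) (cc a b - cc b a) = ext (cc a) (cc b c) - ext (cc b) (cc a c).
Local Notation Z := (plus Y).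
Local Notation W := (word Z).
Local Notation F := {free K[W]}.
Local Notation m := (@rbass_mul K A).
Local Notation R := (@rbass_op K A).
Local Notation V := ((K^o * A) * (K^o * A))%type.
Local Notation br := (@br K d Y cc).
Local Notation fmul := (fmul ccP).
Variable x : Y -> A.
Hypothesis xP : forall y z, m (R (x y)) (x z) - m (x z) (R (x y)) = ext x (cc y z).
Implicit Types (a b : Z) (w p q : W) (v : V).

Let RL := @rbass_op_linear K A.
Let mB := rbass_bilin A.

(** The primed letters are finite and the unprimed ones infinitesimal, because
    the words of interest are linear in the latter. *)
Definition dl (a : Z) : A * A := if a.2 then (R (x a.1), 0) else (0, x a.1).

Definition rhoA (a : Z) : {linear V -> V} := mklin (op_linear (dl a)).

Lemma pair_ext (f g : Y -> A) (u : {free K[Y]}) :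
  ext (fun y => (f y, g y)) u = (ext f u, ext g u) :> A * A.
Proof.
have fL : linear (fst : (A * A)%type -> A) by [].
have sL : linear (snd : (A * A)%type -> A) by [].
rewrite [LHS]surjective_pairing; congr (_, _).
  exact: (ext_lin (mklin fL)).
exact: (ext_lin (mklin sL)).
Qed.

Lemma ext_dl e u : ext dl (tagY e u) =
  if e then (R (ext x u), 0) else (0, ext x u).
Proof.
rewrite ext_tagY /dl /=; case: e; rewrite pair_ext ext0 //.
by rewrite -[R (ext x u)]/(mklin RL _) ext_lin.
Qed.

(** Between two primed letters, this is the Rota-Baxter identity; between a
    primed and an unprimed one, it is the bracket in C; two infinitesimals
    multiply to zero. *)
Lemma dl_comm a b :
  (m (dl a).1 (dl b).1, m (dl a).2 (dl b).1 + m (dl a).1 (dl b).2) -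
  (m (dl b).1 (dl a).1, m (dl b).2 (dl a).1 + m (dl b).1 (dl a).2) =
  ext dl (br a b - br b a).
Proof.
have b0 y z : br (y, false) z = 0 by [].
have b1 y z e : br (y, true) (z, e) = tagY e (cc y z) by [].
rewrite linearB /=; case: a b => [y []] [z []]; rewrite ?b0 ?b1 ?linear0 ?ext_dl /dl /=;
  congr (_, _); rewrite /= ?(bil_0l mB) ?(bil_0r mB) ?(addr0, add0r, subr0) ?oppr0 //.
rewrite !rbass_rb -!xP -(lin_sub RL) -(lin_sub RL); congr (R _); zmodule.
by rewrite -xP opprB.
Qed.

Lemma rhoA_C a b v : rhoA a (rhoA b v) - rhoA b (rhoA a v) =
  ext (fun z => rhoA z v) (br a b - br b a).
Proof.
rewrite !mklinE !op_op -[RHS](ext_lin (mklin (op_linearl v))) -dl_comm.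
by rewrite -[RHS]/(mklin (op_linearl v) _) linearB.
Qed.

Let v0 := one_dual A.

(** R(z) acts by R of the value of z, which in turn is defined by the action
    of the symbols in z. *)
Fixpoint eval_sym (s : sym Z) : Z + (V -> V) :=
  match s with
  | Letter a => inl a
  | Rsym w => inr (op (R (@actL K d Y cc V rhoA v0 [::] (map eval_sym w)).2.2, 0))
  end.

Definition eval w : A := (@actL K d Y cc V rhoA v0 [::] (map eval_sym w)).2.2.

Definition tauA (z : W) : {linear V -> V} := mklin (op_linear (R (eval z), 0)).

Lemma evalE w : eval w = (act cc rhoA tauA v0 w).2.2.
Proof. by rewrite /eval /act; congr (actL _ _ _ _ _).2.2; apply: eq_map => -[]. Qed.

Lemma act_dual1 v w : normal w -> v.2.1 = 0 -> (act cc rhoA tauA v w).2.1 = 0.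
Proof.
move=> nw h; apply: (@act_graded K d Y cc V (fun _ _ v => v.2.1 = 0)) (normal_ok nw) h => //.
- move=> _ _; split=> // c a b /= -> ->.
  by rewrite scaler0 addr0.
- by move=> a m' n v' _; exact: op_dual1.
- by move=> z m' n v' _ _; exact: op_dual1.
Unshelve. all: exact: 0%N.
Qed.

(** Words act by left multiplications. *)
Lemma act_rop (q : V) v w :
  rop q (act cc rhoA tauA v w) = act cc rhoA tauA (rop q v) w.
Proof.
by apply: (act_lin _ (F := mklin (rop_linear q))) => [a u|z u _]; exact: rop_op.
Qed.

Lemma eval_R z w : normal w -> eval (Rsym z :: w) = m (R (eval z)) (eval w).
Proof.
move=> nw; rewrite [LHS]evalE act_R [X in X.2.2]/= [eval w]evalE.
set u := act _ _ _ _ w; have u0 : u.2.1 = 0 by exact: act_dual1.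
by rewrite /op /lop /= u0 scale0r (bil_0l mB) scaler0 !add0r.
Qed.

Lemma eval_rcons_R z w : normal w ->
  eval (rcons w (Rsym z)) = m (eval w) (R (eval z)).
Proof.
move=> nw; rewrite [LHS]evalE -cats1 act_cat // act_R.
have -> : tauA z (act cc rhoA tauA v0 [::]) = rop ((0, R (eval z)), (0, 0)) v0.
  rewrite rop1 /= /op /lop /= scale1r !scale0r !(bil_0l mB) !(bil_0r mB) !addr0.
  by rewrite scaler0.
rewrite -act_rop /rop /mulU /= !scaler0 scale0r !(bil_0r mB) !addr0 !add0r.
rewrite [eval w]evalE; set u := act _ _ _ _ w.
by rewrite (_ : u.2.1 = 0) ?scale0r ?add0r //; exact: act_dual1.
Qed.

(** pre and app are R(p)q and pR(q), and their values are the corresponding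
    products. The two statements need each other, because the symbols at the
    ends are multiplied by star, the sum of both. *)
Lemma eval_pre_app n p q : (sz p + sz q < n)%N ->
  (legal p -> normal q -> ext eval (pre K p q) = m (R (eval p)) (eval q)) /\
  (normal p -> legal q -> ext eval (app K p q) = m (eval p) (R (eval q))).
Proof.
elim: n p q => // n IH p q pq.
have star_eval p' q' : (sz p' + sz q' < n)%N -> legal p' -> legal q' ->
    ext (fun z => R (eval z)) (star K p' q') = m (R (eval p')) (R (eval q')).
  move=> pq' Gp Gq; have [P1 P2] := IH _ _ pq'.
  rewrite -[LHS](ext_lin (mklin RL)) mklinE starE linearD /=.
  by rewrite (P1 Gp (legal_normal Gq)) (P2 (legal_normal Gp) Gq) rbass_rb.
split=> [Gp nq|np Gq].
  have [h|] := boolP (no_R_head q); first by rewrite pre_bas // ext_bas eval_R.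
  case: q nq pq => [|[c|q1] q] // nq; rewrite sz_R => pq _.
  have nq' : normal q by move: nq; rewrite normal_R => /and3P [].
  rewrite pre_R ext_ext (eq_ext (g := fun z => m (R (eval z)) (eval q))); last first.
    by move=> z; rewrite ext_bas eval_R.
  have mL : linear (m^~ (eval q)) by move=> c a b; rewrite mB.1.
  rewrite -[LHS](ext_lin (mklin mL)) mklinE star_eval //; first by rewrite eval_R // rbass_assoc.
    by lia.
  exact: legal_in_R nq.
have [h|] := boolP (no_R_head (rev p)).
  by rewrite app_bas // ext_bas eval_rcons_R.
case/lastP: p np pq => [|p [c|p1]]; rewrite ?rev_rcons // => np.
rewrite sz_rcons -[szS _]/(sz p1).+1 => pq _.
have np' : normal p by move: np; rewrite normal_rcons_R => /and3P [].
rewrite app_R ext_ext (eq_ext (g := fun z => m (eval p) (R (eval z)))); last first.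
  by move=> z; rewrite ext_bas eval_rcons_R.
have mL : linear (m (eval p)) by move=> c a b; rewrite mB.2.
rewrite -[LHS](ext_lin (mklin mL)) mklinE star_eval //; first by rewrite eval_rcons_R // rbass_assoc.
  by lia.
exact: legal_in_rcons np.
Qed.

Lemma eval_star p q : legal p -> legal q ->
  ext (fun z => R (eval z)) (star K p q) = m (R (eval p)) (R (eval q)).
Proof.
move=> Gp Gq; have [P1 P2] := eval_pre_app (ltnSn (sz p + sz q)).
rewrite -[LHS](ext_lin (mklin RL)) mklinE starE linearD /=.
by rewrite (P1 Gp (legal_normal Gq)) (P2 (legal_normal Gp) Gq) rbass_rb.
Qed.

Lemma tauA_M p q v : legal p -> legal q ->
  tauA p (tauA q v) = ext (fun z => tauA z v) (star K p q).
Proof.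
move=> Gp Gq; rewrite !mklinE op_op /= (bil_0l mB) (bil_0r mB) addr0 -eval_star //.
have ->: (ext (fun z => R (eval z)) (star K p q), 0) =
  ext (fun z => (R (eval z), 0)) (star K p q) :> A * A.
  have iL : linear (fun a : A => (a, 0) : (A * A)%type).
    by move=> c a b; congr (_, _); rewrite /= scaler0 addr0.
  by rewrite -[LHS]/(mklin iL _) ext_lin.
by rewrite -[LHS]/(mklin (op_linearl v) _) ext_lin.
Qed.

Definition repA : rep cc V := Rep rhoA_C tauA_M.

(** The value of a vector in the dual numbers over K + A. *)
Definition dval (f : F) : V := extact repA v0 f.

Lemma dval_linear : linear dval. Proof. exact: linear_lin. Qed.

(** Acting on v is acting on 1 followed by right multiplication by v. *)
Lemma dval_fmul f g : dval (fmul f g) = rop (dval g) (dval f).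
Proof.
rewrite /dval extact_fmul -[X in extact repA X f]rop1.
have -> u : extact repA (rop u v0) f = rop u (extact repA v0 f); last by [].
apply: (eq_on_basis (f := extact repA (rop u v0)) (g := fun f => rop u (extact repA v0 f))).
- exact: linear_lin.
- by apply: linear_comp; [exact: rop_linear | exact: linear_lin].
move=> w; have [nw|nw] := boolP (normal w).
  by rewrite !extact_bas // [RHS]act_rop.
by rewrite !extact_not_normal // -[RHS]/(mklin (rop_linear u) 0) linear0.
Qed.

End Evaluation.

(** * Components of the value of a vector *)

Section Retraction.
Variables (K : fieldType) (A : rbAssAlg K).
Hypothesis charK : [pchar K] =i pred0.
Variables (d : Order.disp_t) (Y : orderType d).
Variable cc : Y -> Y -> {free K[Y]}.
Hypothesis ccP : forall a b c,
  ext (cc^~ c) (cc a b - cc b a) = ext (cc a) (cc b c) - ext (cc b) (cc a c).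
Local Notation Z := (plus Y).
Local Notation W := (word Z).
Local Notation F := {free K[W]}.
Local Notation m := (@rbass_mul K A).
Local Notation R := (@rbass_op K A).
Local Notation V := ((K^o * A) * (K^o * A))%type.
Local Notation fmul := (fmul ccP).
Local Notation der := (der ccP).
Local Notation rb := (rb ccP).
Variable x : Y -> A.
Hypothesis xP : forall y z, m (R (x y)) (x z) - m (x z) (R (x y)) = ext x (cc y z).
Local Notation eval := (@eval K A d Y cc x).
Local Notation dval := (@dval K A d Y cc x xP).
Local Notation rhoA := (@rhoA K A d Y x).
Local Notation tauA := (@tauA K A d Y cc x).
Implicit Types (w p q : W) (v : V) (f g : F).

Let RL := @rbass_op_linear K A.
Let mB := rbass_bilin A.
Let v0 := one_dual A.

(** The finite part of the value, without its scalar; imD is the infinitesimal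
    part. The first matters for unmarked vectors, the second for marked ones.
    *)
Definition imT f : A := (dval f).1.2.
Definition imD f : A := (dval f).2.2.

Lemma imT_linear : linear imT.
Proof. by move=> c f g; rewrite /imT dval_linear. Qed.

Lemma imD_linear : linear imD.
Proof. by move=> c f g; rewrite /imD dval_linear. Qed.

Lemma dval_bas w : normal w -> dval (bas w) = act cc rhoA tauA v0 w.
Proof. by move=> nw; rewrite /dval extact_bas. Qed.

Lemma imD_bas w : normal w -> imD (bas w) = eval w.
Proof. by move=> nw; rewrite /imD dval_bas // evalE. Qed.

Lemma dval_bas0 w : ~~ normal w -> dval (bas w) = 0.
Proof. by move=> nw; rewrite /dval extact_not_normal. Qed.

Lemma dval_scalar f : (dval f).1.1 = fcoef f [::].
Proof.
rewrite -[RHS]mulr1 -(extact_triv cc 1 f).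
apply: (eq_on_basis (f := fun f => (dval f).1.1) (g := extact (triv cc) 1)).
- by move=> c f' g; rewrite dval_linear.
- exact: linear_lin.
move=> w; have [nw|nw] := boolP (normal w); last first.
  by rewrite dval_bas0 // extact_not_normal.
have sL : linear (fun v : V => v.1.1) by [].
rewrite dval_bas // extact_bas //.
exact: (act_lin (rho' := fun a => rho (triv cc) a) (tau' := fun z => tau (triv cc) z) _ (F := mklin sL)).
Qed.

Lemma dval_scalar2 f : (dval f).2.1 = 0.
Proof.
apply: (eq_on_basis (f := fun f => (dval f).2.1) (g := fun _ => 0 : K^o)).
- by move=> c f' g; rewrite dval_linear.
- by move=> c f' g; rewrite scaler0 addr0.
move=> w; have [nw|nw] := boolP (normal w); last by rewrite dval_bas0.
by rewrite dval_bas //; apply: act_dual1.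
Qed.

(** Each unprimed letter contributes a factor e with e^2 = 0. *)
Definition graded (k : nat) v : Prop :=
  match k with 0 => v.2 = 0 | 1 => v.1 = 0 | _ => v = 0 end.

Lemma graded_subspace k : subspace (graded k).
Proof.
split; first by case: k => [|[]].
case: k => [|[|k]] c u v /=; rewrite /graded => hu hv; rewrite /= hu hv;
  by rewrite scaler0 addr0.
Qed.

Lemma act_gradedA w : normal w -> graded (marks w) (act cc rhoA tauA v0 w).
Proof.
move=> nw; rewrite -[marks w]addn0.
apply: (@act_graded K d Y cc V (fun k _ => graded k) _ _ _ _ _ _ 0 0 v0 w) => //.
- by move=> k _; exact: graded_subspace.
- move=> a k n u; rewrite mklinE /op /dl.
  have L0 (a' : A) : lop a' 0 = 0 by exact: (linear0 (mklin (lop_linearr a'))).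
  have L0' (p : (K^o * A)%type) : lop 0 p = 0 by exact: (linear0 (mklin (lop_linearl p))).
  case: a => [y []]; case: k => [|[|k]]; rewrite /graded /= => hu;
    by rewrite ?hu ?L0 ?L0' ?addr0.
- move=> z k n u _; rewrite mklinE /op.
  have L0 (a' : A) : lop a' 0 = 0 by exact: (linear0 (mklin (lop_linearr a'))).
  have L0' (p : (K^o * A)%type) : lop 0 p = 0 by exact: (linear0 (mklin (lop_linearl p))).
  case: k => [|[|k]]; rewrite /graded /= => hu; by rewrite ?hu ?L0 ?L0' ?addr0.
exact: normal_ok.
Qed.

Lemma dval_graded k n f : supported (fil k n) f -> graded k (dval f).
Proof.
move=> sf; rewrite -[f]ext_id -[dval _]/(mklin (dval_linear xP) _) ext_lin.
apply: (subspace_supported (graded_subspace k)) sf => w /and3P [nw /eqP <- _].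
by rewrite mklinE dval_bas //; exact: act_gradedA.
Qed.

Lemma dval_tpos n f : supported (tpos n) f -> dval f = ((0, imT f), (0, 0)).
Proof.
move=> /tpos_fil [ff f0]; rewrite [LHS]surjective_pairing (dval_graded ff).
by rewrite [(dval f).1]surjective_pairing dval_scalar f0.
Qed.

Lemma dval_fil1 n f : supported (fil 1 n) f -> dval f = ((0, 0), (0, imD f)).
Proof.
move=> ff; rewrite [LHS]surjective_pairing (dval_graded ff).
by rewrite [(dval f).2]surjective_pairing dval_scalar2.
Qed.

Lemma imT_mul k n f g : supported (tpos k) f -> supported (tpos n) g ->
  imT (fmul f g) = m (imT f) (imT g).
Proof.
move=> sf sg; rewrite {1}/imT dval_fmul (dval_tpos sf) (dval_tpos sg) /=.
by rewrite !scale0r !add0r.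
Qed.

Lemma imD_mul k n f g : supported (tpos k) f -> supported (fil 1 n) g ->
  imD (fmul f g) = m (imT f) (imD g).
Proof.
move=> sf sg; rewrite {1}/imD dval_fmul (dval_tpos sf) (dval_fil1 sg) /=.
by rewrite !scale0r !add0r (bil_0l mB) addr0.
Qed.

Lemma imD_mulr k n f g : supported (fil 1 k) f -> supported (tpos n) g ->
  imD (fmul f g) = m (imD f) (imT g).
Proof.
move=> sf sg; rewrite {1}/imD dval_fmul (dval_fil1 sf) (dval_tpos sg) /=.
by rewrite !scale0r !(bil_0l mB) !add0r.
Qed.

Lemma marks_le_deg w : (marks w <= deg w)%N.
Proof.
elim: w => [//|s w IH]; rewrite /marks /deg /= leq_add //.
by case: s => [[y []]|z].
Qed.

Lemma deg_gt0 s w : normal (s :: w) -> (0 < degS s)%N.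
Proof.
case: s => [//|z]; rewrite normal_R legalE => /andP [/and3P [_ /eqP mz _] _].
by rewrite -[degS _]/(deg z) (leq_trans _ (marks_le_deg z)) // mz.
Qed.

Lemma dval_letter (c : Z) : dval (bas [:: Letter c]) = op (dl x c) v0.
Proof.
rewrite dval_bas // -[[:: Letter c]]/(run [:: c] ++ [::]) act_run //.
by rewrite mono_cons subr0.
Qed.

Lemma imT_letter y : imT (bas [:: Letter (primed y)]) = R (x y).
Proof. by rewrite /imT dval_letter /= scale1r (bil_0r mB) addr0. Qed.

Lemma imD_letter y : imD (letter K y) = x y.
Proof. by rewrite /imD dval_letter /= scale1r (bil_0r mB) (bil_0l mB) scaler0 !addr0. Qed.

(** Both sides are multiplicative, the right one because of the Rota-Baxter
    identity and the Leibniz rule, and they agree on letters and symbols. A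
    word is the product of its symbols up to lower degree. *)
Lemma imT_der n f : supported (tpos n) f -> imT f = R (imD (der f)).
Proof.
pose Q f := imT f = R (imD (der f)).
have sQ : subspace Q.
  have dL : linear (fun f => R (imD (der f))).
    apply: linear_comp; [exact: RL|apply: linear_comp; [exact: imD_linear|exact: der_linear]].
  split; last by move=> c u v; rewrite /Q imT_linear dL => -> ->.
  by rewrite /Q -[LHS]/(mklin imT_linear 0) -[RHS]/(mklin dL 0) !linear0.
rewrite -/(Q f); elim: n f => [|n IH] f sf.
all: rewrite -[f]ext_id; apply: (subspace_supported sQ) sf => -[|s w] /and4P [] //.
  by move=> nw _; rewrite leqn0 /deg /= addn_eq0 eqn0Ngt (deg_gt0 nw).
move=> nw m0 dw _; have s0 := deg_gt0 nw.
have [ns nw'] := normal_cat (w1 := [:: s]) nw.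
have [ms mw] : mkS s = 0%N /\ marks w = 0%N.
  by move: m0; rewrite /marks /= addn_eq0 => /andP [/eqP ? /eqP ?].
have Qs : Q (bas [:: s]).
  case: s ms ns {nw m0 dw s0} => [[y []]|z] // _ ns; last first.
    have Gz := legal_in_R ns.
    rewrite /Q der_R // imD_bas ?legal_normal // /imT dval_bas // act_R.
    by rewrite /op /lop /= scale1r (bil_0r mB) addr0.
  have ml : supported (@marked d Y) (letter K y) by exact: supported_bas.
  have dl : der (bas [:: Letter (primed y)]) = letter K y.
    by rewrite -(rb_letter charK ccP) der_rb.
  by rewrite /Q -/(primed y) dl imT_letter imD_letter.
have [->//|w0] := eqVneq w [::].
have tw : supported (tpos n) (bas w : F).
  apply: supported_bas; rewrite /tpos nw' mw eqxx w0 andbT /=.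
  by move: dw; rewrite /deg /=; lia.
have ts : supported (tpos (degS s)) (bas [:: s] : F).
  by apply: supported_bas; rewrite /tpos ns /marks /deg /= addn0 ms addn0 leqnn.
have Qp : Q (fmul (bas [:: s]) (bas w)).
  rewrite /Q (imT_mul ts tw) der_fmul; last 2 first.
  - exact: supported_bas.
  - exact: supported_bas.
  have [fs _] := tpos_fil ts; have [fw _] := tpos_fil tw.
  rewrite -[imD _]/(mklin imD_linear _) linearD /= (imD_mul ts (der_fil ccP fw)).
  by rewrite (imD_mulr (der_fil ccP fs) tw) Qs (IH _ tw) rbass_rb addrC.
rewrite -[bas (s :: w)](subKr (fmul (bas [:: s]) (bas w))).
apply: (subspaceB sQ) => //; apply: IH.
have lw := fmul_cons ccP nw.
apply: fil_tpos.
  apply: supportedW lw => u /and3P [nu mu' du].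
  by rewrite /fil nu (eqP mu') (eqP m0) eqxx -ltnS (leq_trans du dw).
rewrite -scaleN1r fcoefD fcoefZ fcoef_fmul !fcoef_bas.
by rewrite !mul0r mulr0 addr0.
Qed.

(** Hence taking values is compatible with the Rota-Baxter operators. *)
Lemma imT_rb n f : supported (fil 1 n) f -> imT (rb f) = R (imD f).
Proof.
move=> sf; rewrite (imT_der (n := n)) ?der_rb //.
  by apply: supportedW sf => w /and3P [nw mw _]; rewrite /marked nw.
by apply: rb_tpos => //; apply: supportedW sf => w /and3P [].
Qed.

End Retraction.

(** * The span of the values *)

Section Span.
Variables (K : fieldType) (A : rbAssAlg K).
Hypothesis charK : [pchar K] =i pred0.
Variables (d : Order.disp_t) (Y : orderType d).
Variable cc : Y -> Y -> {free K[Y]}.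
Hypothesis ccP : forall a b c,
  ext (cc^~ c) (cc a b - cc b a) = ext (cc a) (cc b c) - ext (cc b) (cc a c).
Local Notation Z := (plus Y).
Local Notation W := (word Z).
Local Notation F := {free K[W]}.
Local Notation m := (@rbass_mul K A).
Local Notation R := (@rbass_op K A).
Local Notation fmul := (fmul ccP).
Local Notation rb := (rb ccP).
Local Notation valB := (valB charK ccP).
Local Notation fockRB := (fockRB charK ccP).
Variable x : Y -> A.
Hypothesis xP : forall y z, m (R (x y)) (x z) - m (x z) (R (x y)) = ext x (cc y z).
Local Notation imT := (imT xP).
Local Notation imD := (imD xP).
Local Notation symB := (@value_sym K fockRB d Y (@letter K d Y)).
Implicit Types (w p q : W) (f g : F).

Lemma valB_cons s w : normal w -> w != [::] ->
  valB (s :: w) = fmul (symB s) (valB w).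
Proof.
move=> nw w0; rewrite -[LHS]/(@value K fockRB d Y (@letter K d Y) _) /value map_cons mulseq_cons; last by case: (w) w0.
rewrite -[mulseq _]/(valB w) -[LHS]/(fmul _ (pn (valB w))) pn_id //.
exact: fil_normal (valB_fil charK ccP nw w0).
Qed.

Lemma value_cons s w : w != [::] -> value x (s :: w) = m (value_sym x s) (value x w).
Proof. by move=> w0; rewrite /value map_cons mulseq_cons //; case: (w) w0. Qed.

Lemma im_valB w : normal w -> w != [::] ->
  (marks w = 0%N -> supported (tpos (deg w)) (valB w) /\ imT (valB w) = value x w) /\
  (marks w = 1%N -> imD (valB w) = value x w).
Proof.
have [n] := ubnP (sz w); elim: n w => // n IH [//|s w] wn nw _.
have [ns nw'] := normal_cat (w1 := [:: s]) nw.
have [S0 S1] : (mkS s = 0%N -> supported (tpos (degS s)) (symB s) /\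
      imT (symB s) = value_sym x s) /\
    (mkS s = 1%N -> supported (fil 1 (degS s)) (symB s) /\ imD (symB s) = value_sym x s).
  case: s wn nw ns => [[y []]|z] wn nw ns; split=> // _.
  - rewrite -[symB _]/(rb (letter K y)) rb_letter // imT_letter; split=> //.
    exact: supported_bas.
  - by rewrite -[symB _]/(letter K y) imD_letter; split=> //; exact: supported_bas.
  have := ns; rewrite normal_R => /andP [Gz _].
  have [mz ez] := andP (etrans (esym (legal_marked z)) Gz).
  have [nz /eqP m1] := andP mz.
  have z0 : z != [::] by apply: contra_eq_neq m1 => ->.
  have zn : (sz z < n)%N by move: wn; rewrite sz_R; lia.
  have [_ /(_ m1) ev] := IH z zn nz z0.
  have := valB_fil charK ccP nz z0; rewrite m1 => fz.
  rewrite -[symB _]/(rb (valB z)) (imT_rb charK ccP xP fz) ev; split=> //.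
  by apply: rb_tpos => //; apply: supportedW fz => u /and3P [].
have [->|w0] := eqVneq w [::].
  by rewrite /marks /deg /= !addn0; split=> h; [exact: S0 | have [] := S1 h].
have wn' : (sz w < n)%N.
  by move: wn; rewrite /sz /=; case: (s) => [c|z] /=; lia.
have [W0 W1] := IH w wn' nw' w0.
have fw := valB_fil charK ccP nw' w0.
rewrite valB_cons // value_cons //; split; rewrite /marks /= -/(marks w).
  move=> /eqP; rewrite addn_eq0 => /andP [/eqP /S0 [ts es] /eqP /W0 [tw ew]].
  by rewrite (imT_mul ccP xP ts tw) es ew; split=> //; exact: tpos_fmul.
case e : (mkS s) => [|k]; rewrite ?addSn ?add0n => h.
  have [ts es] := S0 e; rewrite h in fw.
  by rewrite (imD_mul ccP xP ts fw) es W1.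
have [k0 mw] : k = 0%N /\ marks w = 0%N by move: h; lia.
rewrite k0 in e; have [ts es] := S1 e; have [tw ew] := W0 mw.
by rewrite (imD_mulr ccP xP ts tw) es ew.
Qed.

Lemma imD_ext_valB f : supported (@marked d Y) f ->
  imD (ext valB f) = ext (value x) f.
Proof.
move=> mf; rewrite -[LHS]/(mklin (imD_linear xP) _) ext_lin.
apply: (eq_supported _ mf) => w /andP [nw /eqP mw].
have w0 : w != [::] by apply: contra_eq_neq mw => ->.
by rewrite mklinE; have [_ ->] := im_valB nw w0.
Qed.

Lemma marked_fil f : supported (@marked d Y) f -> exists n, supported (fil 1 n) f.
Proof.
move=> /supportedP mf; exists (\max_(w <- fm_supp f) deg w).
apply/supportedP => w wf; have /andP [nw mw] := mf w wf.
by rewrite /fil nw mw; exact: leq_bigmax_seq.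
Qed.

(** For x and y marked, R(imD x)(imD y) is the value of the product of rb x
    and y, which is marked. *)
Lemma imD_closed : @preass_closed K (preass_of_rbass A)
  [set a | exists n f, supported (fil 1 n) f /\ a = imD f].
Proof.
split=> [|c a b|a b|a b].
- exists 0, 0; split; first exact: supported0.
  by rewrite -[RHS]/(mklin (imD_linear xP) 0) linear0.
- move=> [n [f [sf ->]]] [k [g [sg ->]]]; exists (maxn n k), (c *: f + g).
  rewrite imD_linear; split=> //; apply: supportedD.
    by apply: supportedZ; apply: filW sf; exact: leq_maxl.
  by apply: filW sg; exact: leq_maxr.
- move=> [n [f [sf ->]]] [k [g [sg ->]]]; exists (n + k)%N, (fmul (rb f) g).
  have tf : supported (tpos n) (rb f).
    by apply: rb_tpos => //; apply: supportedW sf => w /and3P [].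
  rewrite (imD_mul ccP xP tf sg) (imT_rb charK ccP xP sf); split=> //.
  by have [ff _] := tpos_fil tf; exact: (fmul_fil ccP ff sg).
- move=> [n [f [sf ->]]] [k [g [sg ->]]]; exists (n + k)%N, (fmul f (rb g)).
  have tg : supported (tpos k) (rb g).
    by apply: rb_tpos => //; apply: supportedW sg => w /and3P [].
  rewrite (imD_mulr ccP xP sf tg) (imT_rb charK ccP xP sg); split=> //.
  by have [fg _] := tpos_fil tg; exact: (fmul_fil ccP sf fg).
Qed.

Section Generated.
Variable U : set A.
Hypothesis UP : @preass_closed K (preass_of_rbass A) U.
Hypothesis Ux : forall y, U (x y).

(** The unprimed letter is multiplied successively by factors R(g), g
    generated, on either side, and these are the preassociative operations. *)
Lemma value_gen w : normal w -> marks w = 1%N -> U (value x w).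
Proof.
have [_ _ Us Up] := UP.
have [n] := ubnP (sz w); elim: n w => // n IH w.
have symU s : (szS s <= n)%N -> okS s -> mkS s = 0%N ->
    exists2 g, U g & value_sym x s = R g.
  case: s => [[y []]|z] // zn oz _; first by exists (x y).
  have Gz : legal z by [].
  have := Gz; rewrite legalE => /and3P [nz /eqP mz _].
  by exists (value x z) => //; apply: IH.
have foldU a v : (sz v <= n)%N -> all (@okS d Y) v -> marks v = 0%N -> U a ->
    U (foldl m a (map (value_sym x) v)).
  elim: v a => // s v IHv a; rewrite /sz /marks /= => vn /andP [os ov].
  move=> /eqP; rewrite addn_eq0 => /andP [/eqP ms /eqP mv] Ua.
  apply: IHv => //; first by rewrite /sz; lia.
  by have [|g Ug ->] := symU s _ os ms; [lia | exact: Up].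
case: w => // s w; rewrite -[marks _]/(mkS s + marks w)%N ltnS => wn nw mw.
have /andP [os ow] : all (@okS d Y) (s :: w) by exact: normal_ok.
have [ns nw'] := normal_cat (w1 := [:: s]) nw.
have szs : (0 < szS s)%N by case: (s).
case e : (mkS s) => [|k].
  have w0 : w != [::] by move: mw; rewrite e; case: (w).
  rewrite value_cons //; have [|g Ug ->] := symU s _ os e.
    by move: wn; rewrite /sz /=; lia.
  apply: Us => //; apply: IH => //; last by rewrite -mw e.
  by move: wn; rewrite /sz /=; lia.
case: s e {os ns szs nw} mw wn => [[y []]|z] // _ mw wn.
rewrite /value /=; apply: foldU => //.
  by move: wn; rewrite /sz /=; lia.
by case: mw.
Qed.

End Generated.
End Span.

(** The coefficients of equal vectors are added up. *)
Lemma ext_lin_span (K : fieldType) (T : choiceType) (V : lmodType K) (g : T -> V)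
    (S : set V) (f : {free K[T]}) :
  (forall t, t \in fm_supp f -> S (g t)) -> lin_span S (ext g f).
Proof.
move=> Sg; pose c v := \sum_(t <- fm_supp f | g t == v) fcoef f t.
exists (undup (map g (fm_supp f))), c; split.
  by move=> v; rewrite mem_undup => /mapP [t tf ->]; exact: Sg.
rewrite extE (eq_bigr (fun v => \sum_(t <- fm_supp f | g t == v) fcoef f t *: g t)).
  rewrite (exchange_big_dep xpredT) //=; apply: eq_big_seq => t tf.
  rewrite -big_filter (_ : filter _ _ = [:: g t]) ?big_seq1 //.
  rewrite (eq_filter (a2 := pred1 (g t))); last by move=> v; rewrite eq_sym.
  by rewrite filter_pred1_uniq ?undup_uniq // mem_undup map_f.
by move=> v _; rewrite scaler_suml; apply: eq_bigr => t /eqP ->.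
Qed.

(** * The basis theorem *)

Section Embedding.
Variables (K : fieldType) (charK : [pchar K] =i pred0) (C : prelieAlg K).
Variables (d : Order.disp_t) (Y : orderType d) (b : Y -> C).
Hypotheses (b_inj : injective b) (b_basis : lin_basis (range b) setT).
Local Notation ccP := (cstP b_inj b_basis).
Local Notation B := (fockRB charK ccP).

Definition embed (c : C) : B := ext (@letter K d Y) (coords b_basis c).

Lemma embed_b y : embed (b y) = letter K y.
Proof. by rewrite /embed coords_b // ext_bas. Qed.

Lemma embed_linear : linear embed.
Proof. by move=> a u v; rewrite /embed coords_linear // linearP. Qed.

Lemma subspace_basis (Q : C -> Prop) : subspace Q -> (forall y, Q (b y)) -> forall c, Q c.
Proof. by move=> sQ Qb c; rewrite -(coordsK b_basis c); apply: subspace_ext. Qed.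

(** By bilinearity it suffices to compare basis vectors, where it is
    letter_comm. *)
Lemma embed_hom : @prelie_hom K C (prelie_of_rblie (rblie_of_rbass B)) embed.
Proof.
split=> [|u v]; first exact: embed_linear.
set M := @prelie_mul K (prelie_of_rblie (rblie_of_rbass B)).
have MB : bilinear_op M := prelie_bilin _.
have mB := prelie_bilin C.
have lin1 w : linear (fun u => embed (prelie_mul u w) - M (embed u) (embed w)).
  by move=> a c e; rewrite mB.1 !embed_linear MB.1 scalerBr; zmodule.
have lin2 w : linear (fun v => embed (prelie_mul w v) - M (embed w) (embed v)).
  by move=> a c e; rewrite mB.2 !embed_linear MB.2 scalerBr; zmodule.
have subL (f : C -> B) : linear f -> subspace (fun c => f c = 0).
  move=> fL; split; first exact: (linear0 (mklin fL)).
  by move=> a c e; rewrite fL => -> ->; rewrite scaler0 addr0.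
apply/eqP; rewrite -subr_eq0; apply/eqP.
apply: (subspace_basis (subL _ (lin1 v))) => y.
apply: (subspace_basis (subL _ (lin2 (b y)))) => t.
rewrite !embed_b -[M _ _]/(bmul ccP (rb ccP (letter K y)) (letter K t) -
  bmul ccP (letter K t) (rb ccP (letter K y))).
by rewrite rb_letter // letter_comm subrr.
Qed.

End Embedding.

Theorem theorem7 (K : fieldType) (charK : [pchar K] =i pred0)
    (C : prelieAlg K)
    (d : Order.disp_t) (Y : orderType d) (b : Y -> C)
    (Ywo : well_order (<=%O : rel Y))
    (b_inj : injective b) (b_basis : lin_basis (range b) setT)
    (L : rbLieAlg K) (i : C -> L) (L_univ : univ_rblie i)
    (A : rbAssAlg K) (j : L -> A) (A_univ : univ_rbass j) :
  lin_basis (value (j \o i \o b) @` E Y)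
    (@preass_gen K (preass_of_rbass A) (range (j \o i))).
Proof.
pose ccP := cstP b_inj b_basis.
have [[iL iM] iU] := L_univ; have [[jL jM jR] jU] := A_univ.
have [g [gH gi] _] := iU _ _ (embed_hom charK b_inj b_basis).
have [H [HH Hj] _] := jU _ _ gH.
set x := j \o i \o b.
have Hx : H \o x = @letter K d Y.
  apply/funext => y; rewrite /x /= -[H _]/((H \o j) (i (b y))) Hj.
  by rewrite -[g _]/((g \o i) (b y)) gi embed_b.
have Hval w : H (value x w) = valB charK ccP w by rewrite (hom_value HH) Hx.
have jiL : linear (j \o i) by move=> a u v /=; rewrite iL jL.
have xE f : j (i (ext b f)) = ext x f.
  exact: (ext_lin (mklin jiL)).
have xP y z : rbass_mul (rbass_op (x y)) (x z) - rbass_mul (x z) (rbass_op (x y)) =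
    ext x (cst b_basis y z).
  rewrite -xE coordsK iM /= jM jR.
  by [].
have [HL _ _] := HH.
split.
  move=> s c us sE s0 v vs.
  have /choice [e eP] : forall v, exists w, v \in s -> E Y w /\ value x w = v.
    move=> v'; have [/sE [w Ew <-]|_] := boolP (v' \in s); last by exists [::].
    by exists w.
  pose f : {free K[word (plus Y)]} := \sum_(v <- s) c v *: bas (e v).
  (* The relation s0 lifts to the vector f of words, which is mapped to zero
     in the model. *)
  have mf : supported (@marked d Y) f.
    rewrite /f big_seq; apply: (big_ind (supported (@marked d Y))).
    - exact: supported0.
    - by move=> ? ?; exact: supportedD.
    move=> u /eP [Eu _]; apply: supportedZ; apply: supported_bas.
    by apply/E_marked.
  have f0 : ext (valB charK ccP) f = 0.
    rewrite /f linear_sum /= -[RHS](linear0 (mklin HL)) -[in RHS]s0.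
    rewrite linear_sum /=; apply: eq_big_seq => u us'.
    rewrite -[RHS]/(mklin HL (c u *: u)) [RHS]linearZ linearZ /= ext_bas.
    have [_ eu] := eP u us'; congr (_ *: _).
    by rewrite -Hval eu.
  have [n fn] := marked_fil mf.
  have fz := ext_valB_inj fn f0.
  have e_inj u : u \in s -> u != v -> e u != e v.
    move=> us' uv; apply: contra_neq uv => euv.
    by have [_ <-] := eP u us'; have [_ <-] := eP v vs; rewrite euv.
  have := congr1 (fun h => fcoef h (e v)) fz; rewrite fcoef0 /f fcoef_sum (bigD1_seq v) //=.
  rewrite fcoefZ fcoef_bas eqxx mulr1 big_seq_cond big1 ?addr0 // => u /andP [us' uv].
  by rewrite fcoefZ fcoef_bas (negbTE (e_inj u us' uv)) mulr0.
apply/seteqP; split=> a.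
  move=> [s [c [sE ->]]] U [Uc Ur].
  have [U0 UL _ _] := Uc.
  elim: s sE => [|v s IH] sE; first by rewrite big_nil.
  rewrite big_cons; apply: UL; last by apply: IH => u us; apply: sE; rewrite inE us orbT.
  have [w /E_marked /andP [nw /eqP mw] <-] := sE v (mem_head _ _).
  by apply: (value_gen Uc) => // y; apply: Ur; exists (b y).
(* The components imD of the marked vectors form a preassociative subalgebra
   that contains the image of C. *)
have Dc := imD_closed charK ccP xP.
have sub : range (j \o i) `<=` [set a | exists n f, supported (fil 1 n) f /\ a = imD xP f].
  move=> _ [c _ <-]; exists 1%N, (ext (@letter K d Y) (coords b_basis c)); split.
    apply: (supported_ext (P := predT)); last exact: all_predT.
    by move=> y _; exact: supported_bas.
  rewrite -[imD _ _]/(mklin (imD_linear xP) _) ext_lin -{1}(coordsK b_basis c).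
  rewrite -[(j \o i) _]/(j (i _)) xE; apply: eq_ext => y.
  by rewrite mklinE imD_letter.
move=> /(_ _ (conj Dc sub)) [n [f [sf ->]]].
have [y my ->] := ext_valB_surj charK ccP sf.
rewrite imD_ext_valB //; apply: ext_lin_span => w wy.
by exists w => //; apply/E_marked; move/supportedP: my; apply.
Qed.
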